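(* Let $R$ be a commutative Noetherian ring of prime characteristic $p$. Suppose that $R$ is equidimensional and integral over a regular excellent subring $A$, and let $\mathfrak{a}$ be an ideal of $R$ which is the extension of a proper ideal $\mathfrak{b}$ of $A$, that is, $\mathfrak{a}=\mathfrak{b}R$. Then (i) the ideal of $R^{\infty}$ to which the $f$-sequence $\big((\mathfrak{a}^{[p^n]})^+\big)_{n\in\mathbb{N}_0}$ corresponds has a primary decomposition; (ii) the $f$-sequence $\big((\mathfrak{a}^{[p^n]})^+\big)_{n\in\mathbb{N}_0}$ has linear growth of primary decompositions; (iii) the set $\bigcup_{n\in\mathbb{N}_0}\operatorname{ass}(\mathfrak{a}^{[p^n]})^+$ is finite; furthermore, if $R$ has a $p^{m_0}$-weak test element, for some $m_0\in\mathbb{N}_0$, then, in addition, (iv) $\mathfrak{a}^*S^{-1}R=(\mathfrak{a}S^{-1}R)^*$ for every multiplicatively closed subset $S$ of $R$; (v) the ideal of $R^{\infty}$ to which the $f$-sequence $\big((\mathfrak{a}^{[p^n]})^*\big)_{n\in\mathbb{N}_0}$ corresponds has a primary decomposition, and so the $f$-sequence $\big((\mathfrak{a}^{[p^n]})^*\big)_{n\in\mathbb{N}_0}$ has linear growth of primary decompositions; and (vi) $\bigcup_{n\in\mathbb{N}_0}\operatorname{ass}(\mathfrak{a}^{[p^n]})^*\subseteq\bigcup_{n\in\mathbb{N}_0}\operatorname{ass}(\mathfrak{a}^{[p^n]})^+$, so that the set $\bigcup_{n\in\mathbb{N}_0}\operatorname{ass}(\mathfrak{a}^{[p^n]})^*$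 is finite.
   Context: Rings have identity; $\mathbb{N}_0$ is the set of non-negative integers. $f:R\to R$, $r\mapsto r^p$, is the Frobenius homomorphism. For an ideal $\mathfrak{b}$, $\mathfrak{b}^{[p^n]}$ is the ideal generated by all $p^n$-th powers of elements of $\mathfrak{b}$. A Noetherian ring $R$ of finite Krull dimension is equidimensional if $\dim R/\mathfrak{p}=\dim R$ for every minimal prime $\mathfrak{p}$ of $R$. Plus closure: for a Noetherian domain $D$, $D^+$ is the integral closure of $D$ in an algebraic closure of its field of fractions, and for an ideal $\mathfrak{b}$ of $D$, $\mathfrak{b}^+=\mathfrak{b}D^+\cap D$. For general $R$ with minimal primes $\mathfrak{p}_1,\ldots,\mathfrak{p}_h$, the plus closure $\mathfrak{b}^+$ of an ideal $\mathfrak{b}$ of $R$ is the inverse image of $\prod_{i=1}^h((\mathfrak{b}+\mathfrak{p}_i)/\mathfrak{p}_i)^+$ under the natural map $R\to\prod_{i=1}^hR/\mathfrak{p}_i$. For a commutative Noetherian ring $B$ of characteristic $p$, $B^{\circ}$ is the complement in $B$ of the union of the minimal primes of $B$. The tight closure $\mathfrak{b}^*$ of an ideal $\mathfrak{b}$ of $B$ is the ideal of all $r\in B$ for which there exists $c\in B^{\circ}$ with $cr^{p^n}\in\mathfrak{b}^{[p^n]}$ for all $n\gg0$. (Thus $(\mathfrak{a}S^{-1}R)^*$ is computed in $S^{-1}R$.) A $p^{m_0}$-weak test element for $B$ is an element $c\in B^{\circ}$ such that, for every ideal $\mathfrak{b}$ of $B$ and every $r\in B$, one has $r\in\mathfrak{b}^*$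 if and only if $cr^{p^n}\in\mathfrak{b}^{[p^n]}$ for all $n\ge m_0$. Perfect closure: a ring of characteristic $p$ is perfect if its Frobenius homomorphism is bijective. $R^{\infty}$ is the perfect closure of $R$: a perfect commutative ring with a ring homomorphism $\psi_0:R\to R^{\infty}$ that is universal for ring homomorphisms from $R$ to perfect commutative rings of characteristic $p$. One has $\ker\psi_0=\sqrt{(0)}$, and each $\alpha\in R^\infty$ satisfies $\alpha^{p^m}\in\psi_0(R)$ for some $m\ge 0$. Put $\overline{r}=\psi_0(r)$, let $\overline{r}^{1/p^n}$ be its unique $p^n$-th root in $R^{\infty}$, and let $\psi_n:R\to R^{\infty}$ be the ring homomorphism $\psi_n(r)=\overline{r}^{1/p^n}$. An $f$-sequence of ideals of $R$ is a sequence $(\mathfrak{a}_n)_{n\in\mathbb{N}_0}$ of ideals of $R$ with $f^{-1}(\mathfrak{a}_{n+1})=\mathfrak{a}_n$ for all $n$. The map $\mathfrak{A}\mapsto(\psi_n^{-1}(\mathfrak{A}))_{n\in\mathbb{N}_0}$ is a bijection from the set of ideals of $R^{\infty}$ to the set of $f$-sequences of ideals of $R$, with inverse $(\mathfrak{a}_n)_n\mapsto\bigcup_n\psi_n(\mathfrak{a}_n)$; ''corresponds'' refers to this bijection. The sequences $\big((\mathfrak{a}^{[p^n]})^+\big)_n$ and $\big((\mathfrak{a}^{[p^n]})^*\big)_n$ are $f$-sequences. An ideal of a (not necessarily Noetherian) commutative ring has a primary decomposition if it is an intersection of finitely many primary ideals. For an ideal $\mathfrak{b}$ of $R$, $\operatorname{ass}\mathfrak{b}$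 is the set of associated primes of $\mathfrak{b}$, i.e. the radicals of the components of a minimal primary decomposition of $\mathfrak{b}$. An $f$-sequence $(\mathfrak{a}_n)_n$ of proper ideals of $R$ has linear growth of primary decompositions if there is a positive integer $h$ such that for every $n\in\mathbb{N}_0$ there is a minimal primary decomposition $\mathfrak{a}_n=\mathfrak{q}_{1,n}\cap\cdots\cap\mathfrak{q}_{k_n,n}$ with $\big((\sqrt{\mathfrak{q}_{i,n}})^{[p^n]}\big)^h\subseteq\mathfrak{q}_{i,n}$ for all $i=1,\ldots,k_n$. *)

(* Defs.v *)
From HB Require Import structures.
From mathcomp Require Export all_boot all_order all_algebra all_field.
From mathcomp Require Export boolp classical_sets cardinality.

Set Implicit Arguments.
Unset Strict Implicit.
Unset Printing Implicit Defensive.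

Import GRing.Theory.

Local Open Scope classical_set_scope.
Local Open Scope ring_scope.

(* All ideals are [set R] (MathComp's [idealr] are boolean and proper).
   Rings are [comPzRingType] wherever the zero ring may occur (localizations,
   tensor products, algebras of finite type).
   Quotients, localizations, completions, tensor products and perfect closures
   are given by predicates which characterize them up to unique isomorphism. *)

Section Ideals.
Variable R : comPzRingType.
Implicit Types (I J P Q M S X : set R).

Definition is_ideal I : Prop :=
  [/\ I 0, forall x y, I x -> I y -> I (x + y) & forall a x, I x -> I (a * x)].

Definition proper_ideal I : Prop := is_ideal I /\ ~ I 1.

Definition ideal_gen X : set R := smallest is_ideal X.

Definition ideal_mul I J : set R :=
  ideal_gen [set z | exists x y, [/\ I x, J y & z = x * y]].

Definition ideal_pow I (n : nat) : set R := iter n (ideal_mul I) setT.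

(* I^{[p^n]} *)
Definition frobenius_power (p n : nat) I : set R :=
  ideal_gen ((fun x => x ^+ (p ^ n)%N) @` I).

Definition radical I : set R := [set x | exists n : nat, I (x ^+ n)].

Definition prime_ideal P : Prop :=
  proper_ideal P /\ forall x y, P (x * y) -> P x \/ P y.

Definition primary_ideal Q : Prop :=
  proper_ideal Q /\ forall x y, Q (x * y) -> Q x \/ radical Q y.

Definition maximal_ideal M : Prop :=
  proper_ideal M /\ forall I, proper_ideal I -> M `<=` I -> I = M.

Definition minimal_prime P : Prop :=
  prime_ideal P /\ forall Q, prime_ideal Q -> Q `<=` P -> Q = P.

Definition mult_closed S : Prop :=
  S 1 /\ forall s t, S s -> S t -> S (s * t).

Definition noetherian : Prop :=
  forall I, is_ideal I -> exists s : seq R, I = ideal_gen [set` s].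

Definition has_primary_decomposition I : Prop :=
  exists (k : nat) (q : 'I_k -> set R),
    (forall i, primary_ideal (q i)) /\ I = \bigcap_i q i.

Definition minimal_primary_decomposition I (k : nat) (q : 'I_k -> set R) :
    Prop :=
  [/\ forall i, primary_ideal (q i),
      I = \bigcap_i q i,
      injective (fun i => radical (q i)) &
      forall j, ~ (\bigcap_(i in [set i | i != j]) q i `<=` q j)].

Definition ass I : set (set R) :=
  [set P | exists (k : nat) (q : 'I_k -> set R),
     minimal_primary_decomposition I q /\ exists i, P = radical (q i)].

(* P 0, ..., P n is a strictly increasing chain; later values are irrelevant. *)
Definition prime_chain (n : nat) (P : nat -> set R) : Prop :=
  (forall i, (i <= n)%N -> prime_ideal (P i)) /\
  (forall i, (i < n)%N -> P i `<` P i.+1).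

Definition has_krull_dim (d : nat) : Prop :=
  (exists P : nat -> set R, prime_chain d P) /\
  (forall (n : nat) (P : nat -> set R), prime_chain n P -> (n <= d)%N).

Definition saturated_chain (P Q : set R) (n : nat) (C : nat -> set R) : Prop :=
  [/\ prime_chain n C, C 0%N = P, C n = Q &
      forall i, (i < n)%N ->
        ~ exists T, [/\ prime_ideal T, C i `<` T & T `<` C i.+1]].

Definition catenary : Prop :=
  forall P Q, prime_ideal P -> prime_ideal Q -> P `<=` Q ->
    exists n : nat, (exists C, saturated_chain P Q n C) /\
      forall m C, saturated_chain P Q m C -> m = n.

Definition local_ring_with M : Prop :=
  maximal_ideal M /\ forall N, maximal_ideal N -> N = M.

Definition regular_local_ring : Prop :=
  noetherian /\
  exists M (d : nat), [/\ local_ring_with M, has_krull_dim d &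
    exists x : d.-tuple R, M = ideal_gen [set` tval x]].

End Ideals.

Section RingMaps.

Definition ideal_ext (A B : comPzRingType) (f : A -> B) (I : set A) : set B :=
  ideal_gen (f @` I).

(* f identifies B with A / I *)
Definition is_quotient (A B : comPzRingType) (I : set A)
    (f : {rmorphism A -> B}) : Prop :=
  (forall y, exists x, f x = y) /\ (forall x, f x = 0 <-> I x).

(* f identifies B with S^{-1} A *)
Definition is_localization (A B : comPzRingType) (S : set A)
    (f : {rmorphism A -> B}) : Prop :=
  [/\ forall s, S s -> exists t, f s * t = 1,
      forall y, exists x s, S s /\ f s * y = f x &
      forall x, f x = 0 <-> exists s, S s /\ s * x = 0].

(* f identifies B with the inverse limit of the rings A / I^n, the ideal J n
   being the kernel of the projection from B to A / I^n. *)
Definition is_completion (A B : comPzRingType) (I : set A)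
    (f : {rmorphism A -> B}) : Prop :=
  exists J : nat -> set B,
    [/\ forall n, is_ideal (J n) /\ J n.+1 `<=` J n,
        forall n, f @^-1` J n = ideal_pow I n,
        forall n y, exists x, J n (y - f x),
        \bigcap_n J n = [set 0] &
        forall x : nat -> A, (forall n, ideal_pow I n (x n.+1 - x n)) ->
          exists y, forall n, J n (y - f (x n))].

(* (T, u, v) is the tensor product of B and C over A, i.e. their pushout in
   commutative rings. *)
Definition is_tensor_product (A B C T : comPzRingType)
    (f : {rmorphism A -> B}) (g : {rmorphism A -> C})
    (u : {rmorphism B -> T}) (v : {rmorphism C -> T}) : Prop :=
  (forall a, u (f a) = v (g a)) /\
  forall (U : comPzRingType) (u' : {rmorphism B -> U}) (v' : {rmorphism C -> U}),
    (forall a, u' (f a) = v' (g a)) ->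
    exists w : {rmorphism T -> U},
      [/\ forall b, w (u b) = u' b, forall c, w (v c) = v' c &
          forall w' : {rmorphism T -> U},
            (forall b, w' (u b) = u' b) -> (forall c, w' (v c) = v' c) ->
            w' =1 w].

Definition finite_type (A B : comPzRingType) (f : {rmorphism A -> B}) : Prop :=
  exists s : seq B, forall X : set B,
    X 1 -> (forall x y, X x -> X y -> X (x - y)) ->
    (forall x y, X x -> X y -> X (x * y)) ->
    (forall a, X (f a)) -> (forall x, x \in s -> X x) ->
    forall y, X y.

End RingMaps.

Section RegularExcellent.

Definition regular_at (A : comPzRingType) (P : set A) : Prop :=
  forall (L : comPzRingType) (f : {rmorphism A -> L}),
    is_localization (~` P) f -> regular_local_ring L.

Definition regular_ring (A : comPzRingType) : Prop :=
  noetherian A /\ forall P : set A, prime_ideal P -> regular_at P.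

Definition geometrically_regular (K : fieldType) (B : comPzRingType)
    (g : {rmorphism K -> B}) : Prop :=
  forall (E : fieldExtType K) (T : comPzRingType)
         (u : {rmorphism B -> T}) (v : {rmorphism E -> T}),
    is_tensor_product g (in_alg E) u v -> regular_ring T.

(* For every prime P, the fibres of A_P -> (A_P)^ (the completion at the
   maximal ideal) are geometrically regular; D is the domain A_P / q, so
   {fraction D} is the residue field of q. *)
Definition formal_fibres_geometrically_regular (A : comPzRingType) : Prop :=
  forall P : set A, prime_ideal P ->
  forall (L : comPzRingType) (f : {rmorphism A -> L}),
    is_localization (~` P) f ->
  forall (M : set L), maximal_ideal M ->
  forall (Lhat : comPzRingType) (c : {rmorphism L -> Lhat}),
    is_completion M c ->
  forall q : set L, prime_ideal q ->
  forall (D : idomainType) (pi : {rmorphism L -> D}), is_quotient q pi ->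
  forall (F : comPzRingType) (u : {rmorphism Lhat -> F})
         (v : {rmorphism {fraction D} -> F}),
    is_tensor_product c (@tofrac D \o pi) u v ->
    geometrically_regular v.

(* The regular locus of every A-algebra of finite type is Zariski open. *)
Definition J2 (A : comPzRingType) : Prop :=
  forall (B : comPzRingType) (f : {rmorphism A -> B}), finite_type f ->
    exists I : set B, is_ideal I /\
      forall P : set B, prime_ideal P -> (regular_at P <-> ~ (I `<=` P)).

Definition universally_catenary (A : comPzRingType) : Prop :=
  forall (B : comPzRingType) (f : {rmorphism A -> B}),
    finite_type f -> catenary B.

Definition excellent (A : comPzRingType) : Prop :=
  [/\ noetherian A, universally_catenary A,
      formal_fibres_geometrically_regular A & J2 A].

(* Includes finiteness of the Krull dimension. *)
Definition equidimensional (R : comPzRingType) : Prop :=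
  exists d : nat, has_krull_dim R d /\
    forall P : set R, minimal_prime P ->
    forall (D : comPzRingType) (pi : {rmorphism R -> D}),
      is_quotient P pi -> has_krull_dim D d.

End RegularExcellent.

Section PlusClosure.

Definition algebraic_closure (K : fieldType) (E : closedFieldType)
    (j : {rmorphism K -> E}) : Prop :=
  forall z : E, algebraicOver j z.

(* b D^+ \cap D, where D^+ is the integral closure of D in E. *)
Definition plus_closure_domain (D : idomainType) (b : set D) : set D :=
  [set d | exists (E : closedFieldType) (j : {rmorphism {fraction D} -> E}),
     let emb x := j (tofrac x) in
     algebraic_closure j /\
     exists (n : nat) (x : 'I_n -> D) (z : 'I_n -> E),
       [/\ forall i, b (x i), forall i, integralOver emb (z i) &
           emb d = \sum_(i < n) emb (x i) * z i]].

Definition plus_closure (R : comPzRingType) (b : set R) : set R :=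
  [set r | forall P : set R, minimal_prime P ->
     forall (D : idomainType) (pi : {rmorphism R -> D}), is_quotient P pi ->
       plus_closure_domain (pi @` b) (pi r)].

End PlusClosure.

Section TightClosure.
Variables (p : nat) (B : comPzRingType).

(* B^\circ *)
Definition avoids_minimal_primes : set B :=
  ~` (\bigcup_(P in [set P : set B | minimal_prime P]) P).

Definition tight_closure (b : set B) : set B :=
  [set r | exists c, avoids_minimal_primes c /\
     exists N : nat, forall n : nat, (N <= n)%N ->
       frobenius_power p n b (c * r ^+ (p ^ n)%N)].

(* c is a p^{m0}-weak test element *)
Definition weak_test_element (m0 : nat) (c : B) : Prop :=
  avoids_minimal_primes c /\
  forall (b : set B), is_ideal b -> forall r : B,
    tight_closure b r <->
    forall n : nat, (m0 <= n)%N ->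
      frobenius_power p n b (c * r ^+ (p ^ n)%N).

End TightClosure.

Section FSequences.
Variable p : nat.

Definition perfect_ring (T : comNzRingType) : Prop :=
  p \in [pchar T] /\ bijective (fun x : T => x ^+ p).

Definition is_perfect_closure (R Rinf : comNzRingType)
    (psi0 : {rmorphism R -> Rinf}) : Prop :=
  perfect_ring Rinf /\
  forall (T : comNzRingType) (g : {rmorphism R -> T}), perfect_ring T ->
    exists h : {rmorphism Rinf -> T},
      (forall r, h (psi0 r) = g r) /\
      forall h' : {rmorphism Rinf -> T},
        (forall r, h' (psi0 r) = g r) -> h' =1 h.

(* The p^n-th root of psi0 r, which exists and is unique as Rinf is perfect. *)
Definition psi (R Rinf : comNzRingType) (psi0 : {rmorphism R -> Rinf})
    (n : nat) (r : R) : Rinf :=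
  xget 0 [set y | y ^+ (p ^ n)%N = psi0 r].

Definition f_sequence (R : comNzRingType) (a : nat -> set R) : Prop :=
  (forall n, is_ideal (a n)) /\
  (forall n, [set r | a n.+1 (r ^+ p)] = a n).

(* The ideal of Rinf to which the f-sequence a corresponds. *)
Definition corresponding_ideal (R Rinf : comNzRingType)
    (psi0 : {rmorphism R -> Rinf}) (a : nat -> set R) : set Rinf :=
  \bigcup_n (psi psi0 n @` a n).

Definition linear_growth (R : comNzRingType) (a : nat -> set R) : Prop :=
  [/\ f_sequence a, forall n, proper_ideal (a n) &
   exists h : nat, (0 < h)%N /\
     forall n : nat, exists (k : nat) (q : 'I_k -> set R),
       minimal_primary_decomposition (a n) q /\
       forall i, ideal_pow (frobenius_power p n (radical (q i))) h `<=` q i].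

End FSequences.

(* Main.v *)
(* Let N be the integral closure of A in an algebraically closed field containing the quotient of R
   by a minimal prime. As A is regular, N is flat over A (Huneke--Lyubeznik) and so is the Frobenius
   endomorphism of A (Kunz). Hence the operation c(b) = (bR)^+ on ideals b of A is compatible with
   colons by elements of A, with finite intersections and with Frobenius powers, and c(P) is contained
   in every prime Q of R over P. For a minimal primary decomposition of b with components q_l, these
   properties alone show that c(b^[q]) is the irredundant intersection, over the finitely many primes
   Q of R lying over some P_l = rad q_l, of the contractions of c(q_l^[q]) R_Q. Each of these is
   Q-primary and contains (Q^[q])^h with h independent of q, so the associated primes do not depend on
   q and growth is linear; for fixed Q they form an f-sequence, which corresponds to a primary ideal.

   A linear functional on the finite module generated by the powers of finitely many elements of N
   shows that plus closure is contained in tight closure. With a weak test element, r therefore lies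
   in (bR)^* if and only if some c outside the minimal primes satisfies c r^q in (b^[q] R)^+ for all
   large q. Thus b |-> (bR)^* has the same formal properties and the same associated primes. For
   localization at S, the components at primes meeting S contain v^q for one fixed v in S. *)

From HB Require Import structures.
From mathcomp Require Import ring zify generic_quotient ring_quotient.
Require Import Defs.

Set Implicit Arguments.
Unset Strict Implicit.
Unset Printing Implicit Defensive.

Import GRing.Theory.

Local Open Scope classical_set_scope.
Local Open Scope ring_scope.

(** The flatness of N over A is cited above but has to be proved here. By the local criterion it
    means that each member of a regular system of parameters is a nonzerodivisor on N modulo the
    others. The obstacle is that N is not noetherian. The claim is therefore made for finitely
    generated submodules D of a localization of N: a colon relation over D must become trivial over
    one larger D', the same for all exponents of the parameters, because exponents vary in the
    induction on the number of parameters.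

    N is already flat at the smaller primes, so a fixed power of every parameter kills the
    obstruction, which then lives in a finitely generated A-module independent of the exponents.
    Frobenius maps obstructions to obstructions. The iterates of one of them satisfy a linear
    recurrence, that is, a monic equation whose roots lie in N and trivialize it; finitely many
    generators suffice.

    Equidimensionality enters where minimal primes of R are contracted to A: the contraction is
    again minimal, hence no parameter vanishes in N. *)

Section Ideals.
Variable A : comPzRingType.
Implicit Types (I J P Q U : set A).

Lemma ideal0 I : is_ideal I -> I 0. Proof. by case. Qed.
Lemma idealD I x y : is_ideal I -> I x -> I y -> I (x + y).
Proof. by case=> _ h _; apply: h. Qed.
Lemma ideal_mull I a x : is_ideal I -> I x -> I (a * x).
Proof. by case=> _ _ h; apply: h. Qed.
Lemma ideal_mulr I a x : is_ideal I -> I x -> I (x * a).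
Proof. by rewrite mulrC; apply: ideal_mull. Qed.
Lemma idealN I x : is_ideal I -> I x -> I (- x).
Proof. by rewrite -mulN1r; apply: ideal_mull. Qed.
Lemma idealB I x y : is_ideal I -> I x -> I y -> I (x - y).
Proof. by move=> iI Ix Iy; apply: idealD => //; apply: idealN. Qed.
Lemma idealDl I x y : is_ideal I -> I x -> I (x + y) -> I y.
Proof. by move=> iI Ix Ixy; rewrite -(addKr x y) addrC; apply: idealB. Qed.
Lemma ideal_sum I (J : Type) (r : seq J) (Pr : pred J) (F : J -> A) :
  is_ideal I -> (forall i, Pr i -> I (F i)) -> I (\sum_(i <- r | Pr i) F i).
Proof.
move=> iI h; elim/big_ind: _ => //; first exact: ideal0.
by move=> *; apply: idealD.
Qed.
Lemma idealX I x n m : is_ideal I -> (n <= m)%N -> I (x ^+ n) -> I (x ^+ m).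
Proof. by move=> iI /subnK <-; rewrite exprD; apply: ideal_mull. Qed.

Lemma ideal_setT : is_ideal (setT : set A). Proof. by split. Qed.

Lemma ideal_setI I J : is_ideal I -> is_ideal J -> is_ideal (I `&` J).
Proof.
move=> iI iJ; split; first by split; apply: ideal0.
  by move=> x y [? ?] [? ?]; split; apply: idealD.
by move=> a x [? ?]; split; apply: ideal_mull.
Qed.

Definition colon I s : set A := [set c | I (c * s)].

Lemma colon_ideal I s : is_ideal I -> is_ideal (colon I s).
Proof.
move=> iI; split; rewrite /colon /=.
- by rewrite mul0r; apply: ideal0.
- by move=> x y hx hy; rewrite mulrDl; apply: idealD.
- by move=> a x hx; rewrite -mulrA; apply: ideal_mull.
Qed.

Lemma ideal_gen_ideal (X : set A) : is_ideal (ideal_gen X).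
Proof.
split.
- by move=> I [[]].
- by move=> x y hx hy I hI; apply: idealD; [case: hI | apply: hx | apply: hy].
- by move=> a x hx I hI; apply: ideal_mull; [case: hI | apply: hx].
Qed.

Lemma sub_ideal_gen (X : set A) x : X x -> ideal_gen X x.
Proof. by move=> Xx I [_]; apply. Qed.

Lemma ideal_gen_min (X : set A) I : is_ideal I -> X `<=` I -> ideal_gen X `<=` I.
Proof. by move=> iI XI y; apply. Qed.

Lemma ideal_genS (X Y : set A) : X `<=` Y -> ideal_gen X `<=` ideal_gen Y.
Proof.
move=> XY; apply: ideal_gen_min; first exact: ideal_gen_ideal.
by move=> x /XY; apply: sub_ideal_gen.
Qed.

Lemma ideal_genP (X : set A) y :
  ideal_gen X y <-> exists n (c x : 'I_n -> A),
    (forall i, X (x i)) /\ y = \sum_(i < n) c i * x i.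
Proof.
split; last first.
  move=> [n [c [x [Xx ->]]]]; apply: ideal_sum (ideal_gen_ideal X) _ => i _.
  by apply: ideal_mull (ideal_gen_ideal X) _; apply: sub_ideal_gen.
move: y; apply: ideal_gen_min; last first.
  move=> x Xx; exists 1%N, (fun=> 1), (fun=> x); split=> //.
  by rewrite big_ord1 mul1r.
split.
- by exists 0%N, (fun=> 0), (fun=> 0); split; [case | rewrite big_ord0].
- move=> _ _ [n [c [x [Xx ->]]]] [m [d [z [Xz ->]]]].
  exists (n + m)%N, (fun i => match split i with inl j => c j | inr j => d j end),
    (fun i => match split i with inl j => x j | inr j => z j end).
  split; first by move=> i; case: (split i).
  rewrite big_split_ord /=; congr (_ + _); apply: eq_bigr => i _.
    by rewrite (unsplitK (inl i)).
  by rewrite (unsplitK (inr i)).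
- move=> a _ [n [c [x [Xx ->]]]]; exists n, (fun i => a * c i), x; split=> //.
  by rewrite big_distrr; apply: eq_bigr => i _ /=; rewrite mulrA.
Qed.

Lemma prime_ideal_ideal P : prime_ideal P -> is_ideal P.
Proof. by case=> [[]]. Qed.
Lemma prime1 P : prime_ideal P -> ~ P 1. Proof. by case=> [[]]. Qed.
Lemma primeM P x y : prime_ideal P -> P (x * y) -> P x \/ P y.
Proof. by case=> _; apply. Qed.
Lemma primeNM P x y : prime_ideal P -> ~ P x -> ~ P y -> ~ P (x * y).
Proof. by move=> pP nx ny /(primeM pP) []. Qed.
Lemma primeX P x n : prime_ideal P -> P (x ^+ n) -> P x.
Proof.
move=> pP; elim: n => [|n IHn]; first by rewrite expr0 => /(prime1 pP).
by rewrite exprS => /(primeM pP) [].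
Qed.
Lemma primeNX P x n : prime_ideal P -> ~ P x -> ~ P (x ^+ n).
Proof. by move=> pP nx /(primeX pP). Qed.
Lemma primeN_prod P (I : Type) (r : seq I) (F : I -> A) :
  prime_ideal P -> (forall i, ~ P (F i)) -> ~ P (\prod_(i <- r) F i).
Proof.
move=> pP h; elim/big_ind: _ => //; first exact: prime1.
by move=> x y; apply: primeNM.
Qed.

Definition compl_mult P : prime_ideal P -> mult_closed (~` P).
Proof. by move=> pP; split; [apply: prime1 | move=> s t; apply: primeNM]. Qed.

Lemma mult_closedX (S : set A) s n : mult_closed S -> S s -> S (s ^+ n).
Proof.
by move=> [S1 SM] Ss; elim: n => [|n IH]; rewrite ?expr0 ?exprS //; apply: SM.
Qed.

(** The last conclusion records that [P] is maximal among the ideals containing [J] and missing [S].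
    Primality follows by multiplying two such elements of [S]; [lying_over] argues from the
    maximality itself. *)
Lemma exists_max_disjoint (S : set A) J :
  mult_closed S -> is_ideal J -> (forall x, J x -> ~ S x) ->
  exists P, [/\ prime_ideal P, J `<=` P, forall x, P x -> ~ S x &
    forall z, ~ P z -> exists m a, P m /\ S (m + a * z)].
Proof.
move=> [S1 SM] iJ JS.
pose F : set (set A) := [set I | I = set0 \/
  [/\ is_ideal I, J `<=` I & forall x, I x -> ~ S x]].
have [M [FM Mmax]] : exists M, F M /\ forall B, M `<` B -> ~ F B.
  apply: Zorn_bigcup => C CF totC.
  case: (pselect (exists X, C X /\ X !=set0)) => [[X [CX [x0 Xx0]]]|noX]; last first.
    left; apply/seteqP; split=> // x [X CX Xx]; apply: noX.
    by exists X; split=> //; exists x.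
  have memF Y y : C Y -> Y y ->
      [/\ is_ideal Y, J `<=` Y & forall x, Y x -> ~ S x].
    by move=> CY Yy; case: (CF _ CY) => // Y0; rewrite Y0 in Yy.
  right; split.
  - have [iX _ _] := memF X x0 CX Xx0; split.
    + by exists X => //; apply: ideal0.
    + move=> x y [Y CY Yx] [Z CZ Zy].
      have [iY _ _] := memF Y x CY Yx; have [iZ _ _] := memF Z y CZ Zy.
      case: (totC Y Z CY CZ) => [YZ|ZY].
        by exists Z => //; apply: idealD => //; apply: YZ.
      by exists Y => //; apply: idealD => //; apply: ZY.
    + move=> a x [Y CY Yx]; exists Y => //.
      by have [iY _ _] := memF Y x CY Yx; apply: ideal_mull.
  - by move=> y Jy; exists X => //; have [_ + _] := memF X x0 CX Xx0; apply.
  - by move=> y [Y CY Yy]; have [_ _] := memF Y y CY Yy; apply.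
have FJ : F J by right; split.
case: FM => [M0|[iM JM MS]].
  case: (Mmax J) => //; rewrite M0; split; first by [].
  by move=> /(_ 0 (ideal0 iJ)).
have ext z : ~ M z -> exists m a, M m /\ S (m + a * z).
  move=> nMz; apply: contrapT => no.
  pose B := [set u | exists m a, M m /\ u = m + a * z].
  apply: (Mmax B); last first.
    right; split.
    - split.
      + by exists 0, 0; rewrite mul0r addr0; split=> //; apply: ideal0.
      + move=> _ _ [m [a [Mm ->]]] [m' [a' [Mm' ->]]]; exists (m + m'), (a + a').
        by split; [apply: idealD | ring].
      + move=> c _ [m [a [Mm ->]]]; exists (c * m), (c * a).
        by split; [apply: ideal_mull | ring].
    - by move=> u /JM Mu; exists u, 0; rewrite mul0r addr0.
    - by move=> _ [m [a [Mm ->]]] Sm; apply: no; exists m, a.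
  split; last first.
    move=> /(_ z) BM; apply: nMz; apply: BM; exists 0, 1.
    by rewrite mul1r add0r; split=> //; apply: ideal0.
  by move=> u Mu; exists u, 0; rewrite mul0r addr0.
exists M; split=> //; split; first by split=> // /MS.
move=> x y Mxy.
apply: contrapT => /not_orP [nx ny].
have [m [a [Mm Sm]]] := ext x nx; have [m' [a' [Mm' Sm']]] := ext y ny.
apply: (MS _ _ (SM _ _ Sm Sm')).
rewrite (_ : _ * _ = m * (m' + a' * y) + (a * x * m' + a * a' * (x * y))); last by ring.
by apply: idealD => //; [apply: ideal_mulr | apply: idealD => //; apply: ideal_mull].
Qed.

Lemma exists_prime_disjoint (S : set A) J :
  mult_closed S -> is_ideal J -> (forall x, J x -> ~ S x) ->
  exists P, [/\ prime_ideal P, J `<=` P & forall x, P x -> ~ S x].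
Proof. by move=> mS iJ /(exists_max_disjoint mS iJ) [P [? ? ? _]]; exists P. Qed.

(** The union of a chain of ideals has finitely many generators, and these lie already in one member
    of the chain. *)
Lemma noeth_max (F : set (set A)) I0 : noetherian A ->
  (forall I, F I -> is_ideal I) -> F I0 ->
  exists M, [/\ F M, I0 `<=` M & forall J, F J -> M `<=` J -> J = M].
Proof.
move=> noeth Fi FI0.
pose G : set (set A) := [set I | I = set0 \/ (F I /\ I0 `<=` I)].
have [M [GM Mmax]] : exists M, G M /\ forall B, M `<` B -> ~ G B.
  apply: Zorn_bigcup => C CG totC.
  case: (pselect (exists X, C X /\ X !=set0)) => [[X [CX [x0 Xx0]]]|noX]; last first.
    left; apply/seteqP; split=> // x [X CX Xx]; apply: noX.
    by exists X; split=> //; exists x.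
  have memF Y y : C Y -> Y y -> F Y /\ I0 `<=` Y.
    by move=> CY Yy; case: (CG _ CY) => // Y0; rewrite Y0 in Yy.
  have [FX I0X] := memF X x0 CX Xx0.
  set U := \bigcup_(_ in _) _.
  have iU : is_ideal U.
    split.
    + by exists X => //; apply: ideal0; apply: Fi.
    + move=> x y [Y CY Yx] [Z CZ Zy].
      have [/Fi iY _] := memF Y x CY Yx; have [/Fi iZ _] := memF Z y CZ Zy.
      case: (totC Y Z CY CZ) => [YZ|ZY].
        by exists Z => //; apply: idealD => //; apply: YZ.
      by exists Y => //; apply: idealD => //; apply: ZY.
    + move=> a x [Y CY Yx]; exists Y => //.
      by have [/Fi iY _] := memF Y x CY Yx; apply: ideal_mull.
  have [s sU] := noeth U iU.
  have [Y [CY XY sY]] : exists Y, [/\ C Y, X `<=` Y & forall x, x \in s -> Y x].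
    have : forall x, x \in s -> U x by move=> x xs; rewrite sU; apply: sub_ideal_gen.
    elim: (s) => [_|x r IH h]; first by exists X; split.
    have [Y [CY XY Yr]] := IH (fun z zr => h z (mem_behead (s := x :: r) zr)).
    have [Z CZ Zx] := h x (mem_head x r).
    case: (totC Y Z CY CZ) => [YZ|ZY].
      exists Z; split=> //; first by move=> z /XY /YZ.
      by move=> z; rewrite inE => /orP [/eqP -> //|/Yr /YZ].
    exists Y; split=> // z; rewrite inE => /orP [/eqP ->|/Yr //]; exact: ZY.
  have Yx0 := XY _ Xx0; have [FY I0Y] := memF Y x0 CY Yx0.
  suff -> : U = Y by right.
  apply/seteqP; split; last by move=> y Yy; exists Y.
  by rewrite sU; apply: ideal_gen_min => //; apply: Fi.
have FI : G I0 by right; split.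
case: GM => [M0|[FM IM]].
  case: (Mmax I0) => //; rewrite M0; split; first by [].
  by move=> /(_ 0 (ideal0 (Fi _ FI0))).
exists M; split=> // J FJ MJ; apply: contrapT => nJM; apply: (Mmax J); last first.
  by right; split=> // x /IM /MJ.
by split=> // JM; apply: nJM; apply/seteqP.
Qed.

End Ideals.

(** * Dimension theory through saturated ideals *)

Section Saturation.
Variable A : comPzRingType.
Implicit Types (I J P Q U : set A).

(* [sat P U] is the contraction of the extension of [U] to A_P: saturated ideals stand for the ideals
   of A_P, so that no localization is needed. *)
Definition sat P U : set A := [set y | exists t, ~ P t /\ U (t * y)].
Definition saturated P U := forall t u, ~ P t -> U (t * u) -> U u.
Definition adj I x : set A := [set u | exists i a, I i /\ u = i + a * x].

Lemma sub_sat P U y : prime_ideal P -> U y -> sat P U y.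
Proof. by move=> pP Uy; exists 1; rewrite mul1r; split=> //; apply: prime1. Qed.
Lemma satS P U V : U `<=` V -> sat P U `<=` sat P V.
Proof. by move=> UV y [t [nt /UV]]; exists t. Qed.
Lemma sat_saturated P U : prime_ideal P -> saturated P (sat P U).
Proof.
move=> pP t u nt [s [ns]]; rewrite mulrA => h.
by exists (s * t); split=> //; apply: primeNM.
Qed.
Lemma sat_ideal P I : prime_ideal P -> is_ideal I -> is_ideal (sat P I).
Proof.
move=> pP iI; split.
- by apply: sub_sat => //; apply: ideal0.
- move=> x y [t [nt Itx]] [s [ns Isy]]; exists (t * s); split; first exact: primeNM.
  rewrite mulrDr; apply: idealD => //.
    by rewrite mulrAC; apply: ideal_mulr.
  by rewrite -mulrA; apply: ideal_mull.
- by move=> a x [t [nt Itx]]; exists t; split=> //; rewrite mulrCA; apply: ideal_mull.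
Qed.
Lemma sat_min P U V : saturated P V -> U `<=` V -> sat P U `<=` V.
Proof. by move=> sV UV y [t [nt /UV]]; apply: sV. Qed.
Lemma saturated_prime P Q : prime_ideal Q -> Q `<=` P -> saturated P Q.
Proof. by move=> pQ QP t u nt /(primeM pQ) [/QP|]. Qed.
Lemma sat_sub_prime P I Q : prime_ideal Q -> I `<=` Q -> Q `<=` P -> sat P I `<=` Q.
Proof. by move=> pQ IQ QP; apply: sat_min => //; apply: saturated_prime. Qed.

Lemma adj_ideal I x : is_ideal I -> is_ideal (adj I x).
Proof.
move=> iI; split.
- by exists 0, 0; rewrite mul0r addr0; split=> //; apply: ideal0.
- move=> _ _ [m [a [Mm ->]]] [m' [a' [Mm' ->]]]; exists (m + m'), (a + a').
  by split; [apply: idealD | ring].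
- move=> c _ [m [a [Mm ->]]]; exists (c * m), (c * a).
  by split; [apply: ideal_mull | ring].
Qed.
Lemma sub_adj I x : I `<=` adj I x.
Proof. by move=> y Iy; exists y, 0; rewrite mul0r addr0. Qed.
Lemma mem_adj I x : is_ideal I -> adj I x x.
Proof. by move=> iI; exists 0, 1; rewrite mul1r add0r; split=> //; apply: ideal0. Qed.
Lemma adj_min I x J : is_ideal J -> I `<=` J -> J x -> adj I x `<=` J.
Proof.
move=> iJ IJ Jx _ [i [a [/IJ Ji ->]]]; apply: idealD => //; exact: ideal_mull.
Qed.

(** The prime avoids the multiplicative set of all [t * y ^+ k] with [t] outside [P]. It is mostly
    used by contraposition, to put some [t * y ^+ k] into [J]. *)
Lemma exists_prime_notin P J y : prime_ideal P -> is_ideal J ->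
  (forall t k, ~ P t -> ~ J (t * y ^+ k)) ->
  exists Q, [/\ prime_ideal Q, J `<=` Q, Q `<=` P & ~ Q y].
Proof.
move=> pP iJ h.
have := @exists_prime_disjoint A [set u | exists t k, ~ P t /\ u = t * y ^+ k] J.
case=> //.
- split; first by exists 1, 0%N; rewrite mulr1; split=> //; apply: prime1.
  move=> _ _ [t [k [nt ->]]] [t' [k' [nt' ->]]]; exists (t * t'), (k + k')%N.
  by split; [apply: primeNM | rewrite exprD mulrACA].
- by move=> x Jx [t [k [nt xE]]]; apply: (h t k nt); rewrite -xE.
move=> Q [pQ JQ QS]; exists Q; split=> //.
- move=> x Qx; apply: contrapT => nPx; apply: (QS x) => //.
  by exists x, 0%N; rewrite expr0 mulr1.
- by move=> Qy; apply: (QS y) => //; exists 1, 1%N; rewrite mul1r; split=> //; apply: prime1.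
Qed.

Hypothesis noeth : noetherian A.

(** No generators of [U] are chosen. Let [W] be saturated over [V], maximal for not containing [U].
    For [y] in [U] outside [W], adding [y] to [W] recovers [U]; inserting this in the hypothesis
    gives [(s * t - x * b) * y] in [W], where the first factor is a unit of A_P because [x] lies in
    [P]. *)
Lemma nakayama P U V x : prime_ideal P -> P x -> is_ideal U -> is_ideal V ->
  (forall u, U u -> exists t v u', [/\ ~ P t, V v, U u' & t * u = v + x * u']) ->
  U `<=` sat P V.
Proof.
move=> pP Px iU iV h; apply: contrapT => nUV.
pose F : set (set A) := [set W | [/\ is_ideal W, saturated P W, V `<=` W & ~ U `<=` W]].
have [||W [[iW sW VW nUW] _ Wmax]] := @noeth_max A F (sat P V) noeth.
- by move=> I [].
- split=> //; [exact: sat_ideal | exact: sat_saturated | by move=> v; apply: sub_sat].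
have [y [Uy nWy]] : exists y, U y /\ ~ W y.
  by apply: contrapT => no; apply: nUW => y Uy; apply: contrapT => nWy; apply: no; exists y.
have UW' : U `<=` sat P (adj W y).
  apply: contrapT => nU; apply: nWy.
  rewrite -(Wmax (sat P (adj W y))).
  - by apply: sub_sat => //; apply: mem_adj.
  - split=> //; [exact/sat_ideal/adj_ideal | exact: sat_saturated | ].
    by move=> v /VW Wv; apply: sub_sat => //; apply: sub_adj.
  - by move=> v Wv; apply: sub_sat => //; apply: sub_adj.
have [t [v [u' [nt Vv Uu' tyE]]]] := h y Uy.
have [s [ns [w [b [Ww suE]]]]] := UW' u' Uu'.
apply: nWy; apply: (sW (s * t - x * b)).
  move=> Pst; apply: (primeNM pP ns nt); rewrite -(subrK (x * b) (s * t)).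
  by apply: idealD (prime_ideal_ideal pP) _ _ => //; apply: ideal_mulr => //; apply: prime_ideal_ideal.
rewrite (_ : _ * y = s * v + x * w); last first.
  transitivity (s * (t * y) - x * (b * y)); first by ring.
  by rewrite tyE (_ : b * y = s * u' - w); [ring | rewrite suE; ring].
by apply: idealD => //; apply: ideal_mull => //; apply: VW.
Qed.

(* A_P / I is Artinian when P is nilpotent modulo I; of the descending chain condition
   only one repetition is needed. *)
Lemma descending_repeat P : prime_ideal P ->
  forall I, is_ideal I -> saturated P I -> (forall y, P y -> exists k, I (y ^+ k)) ->
  forall U : nat -> set A, (forall n, is_ideal (U n)) -> (forall n, saturated P (U n)) ->
    (forall n, I `<=` U n) -> (forall n, U n.+1 `<=` U n) ->
  exists n, U n `<=` U n.+1.
Proof.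
move=> pP I iI sI nI; apply: contrapT => nD.
pose C I := [/\ is_ideal I, saturated P I & forall y, P y -> exists k, I (y ^+ k)].
pose D I := forall U : nat -> set A, (forall n, is_ideal (U n)) ->
  (forall n, saturated P (U n)) -> (forall n, I `<=` U n) ->
  (forall n, U n.+1 `<=` U n) -> exists n, U n `<=` U n.+1.
have [||M [[[iM sM nM] nDM] _ Mmax]] := @noeth_max A [set I | C I /\ ~ D I] I noeth.
- by move=> J [[]].
- by [].
have [M1|nM1] := pselect (M 1).
  apply: nDM => U iU sU MU _; exists 0%N => y _.
  by rewrite -[y]mulr1; apply: ideal_mull (iU _) _; apply: MU.
(* An element with maximal annihilator modulo [M] is killed by [P]: some power of [p] kills it, and
   its last multiple outside [M] has the same annihilator. *)
have [y [nMy Py]] : exists y, ~ M y /\ forall p, P p -> M (p * y).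
  have [||K [[y [nMy KE]] _ Kmax]] :=
    @noeth_max A [set K | exists y, ~ M y /\ K = [set c | M (c * y)]]
      [set c | M (c * 1)] noeth.
  - move=> _ [y [nMy ->]]; split=> /=.
    + by rewrite mul0r; apply: ideal0.
    + by move=> a b Ma Mb; rewrite mulrDl; apply: idealD.
    + by move=> a b Mb; rewrite -mulrA; apply: ideal_mull.
  - by exists 1.
  exists y; split=> // p Pp.
  have ex : exists k, `[< M (p ^+ k * y) >].
    have [k Mk] := nM p Pp; exists k; apply/asboolP; exact: ideal_mulr.
  case: (ex_minnP ex) => [[|k] /asboolP Mk mink].
    by rewrite expr0 mul1r in Mk.
  have nMk : ~ M (p ^+ k * y).
    by move=> /asboolP /mink; rewrite ltnn.
  have KEk : [set c | M (c * (p ^+ k * y))] = K.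
    apply: Kmax; first by exists (p ^+ k * y).
    by rewrite KE => c /= Mc; rewrite mulrCA; apply: ideal_mull.
  have : K p by rewrite -KEk /= mulrA -exprS.
  by rewrite KE.
pose M' := sat P (adj M y).
have M'D : D M'.
  apply: contrapT => nD'; apply: nMy; rewrite -(Mmax M').
  - by apply: sub_sat => //; apply: mem_adj.
  - split=> //; split; [exact/sat_ideal/adj_ideal | exact: sat_saturated | ].
    move=> z /nM [k Mk]; exists k; apply: sub_sat => //; exact: sub_adj.
  - by move=> v Mv; apply: sub_sat => //; apply: sub_adj.
apply: nDM => U iU sU MU dU.
(* If all members contain [y], they contain [M'], for which the claim holds. Otherwise the members
   enlarged by [y] repeat, and from [n0] on a multiple [a * y] in a member forces [a] into [P], so
   that [a * y] is already in [M]. *)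
have [Uy|] := pselect (forall n, U n y).
  apply: M'D => // n; apply: sat_min => //; apply: adj_min => //; exact: MU.
move/existsNP => [n0 nUy].
have dU' n m : U (n + m)%N `<=` U n.
  elim: m => [|m IH]; first by rewrite addn0.
  by rewrite addnS => u /dU; apply: IH.
have [||||n hn] := M'D (fun m => sat P (adj (U (n0 + m)%N) y)).
- by move=> n; exact/sat_ideal/adj_ideal.
- by move=> n; exact: sat_saturated.
- move=> n; apply: satS => _ [m [a [Mm ->]]]; exists m, a; split=> //; exact: MU.
- move=> n; apply: satS => _ [m [a [Mm ->]]]; exists m, a; split=> //.
  by apply: dU; rewrite -addnS.
exists (n0 + n)%N => u Uu.
have [t [nt [u' [a [Uu' tuE]]]]] : sat P (adj (U (n0 + n.+1)%N) y) u.
  by apply: hn; apply: sub_sat => //; apply: sub_adj.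
rewrite addnS in Uu'.
apply: (sU _ t) => //; rewrite tuE; apply: idealD => //.
have [Pa|nPa] := pselect (P a).
  by apply: (MU _ (a * y)); apply: Py.
case: nUy; apply: (dU' _ n); apply: (sU _ a) => //.
rewrite (_ : a * y = t * u - u'); last by rewrite tuE; ring.
by apply: idealB => //; [apply: ideal_mull | apply: dU].
Qed.

(** Krull's theorem as an exchange property of chains. Saturations at [Q1] of [Q0] plus powers of a
    single [z] play the part of the symbolic powers of [Q1]. Modulo [x] they fall under
    [descending_repeat], and [nakayama] then removes [x]; the contradiction is a cancellation of
    [z ^+ n] modulo [Q0]. *)
Lemma principal_ideal_theorem Q0 Q1 Q2 x : prime_ideal Q0 -> prime_ideal Q1 -> prime_ideal Q2 ->
  Q0 `<` Q1 -> Q1 `<` Q2 -> Q2 x ->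
  exists P, [/\ prime_ideal P, Q0 `<` P, P `<` Q2 & P x].
Proof.
move=> p0 p1 p2 Q01 Q12 Q2x; apply: contrapT => no.
have [iQ0 iQ1 iQ2] := And3 (prime_ideal_ideal p0) (prime_ideal_ideal p1) (prime_ideal_ideal p2).
have Q02 : Q0 `<=` Q2 by move=> y /Q01.1 /Q12.1.
have nQ1x : ~ Q1 x by move=> Q1x; apply: no; exists Q1; split.
have nQ0x : ~ Q0 x by move=> /Q01.1.
pose J := adj Q0 x.
have iJ : is_ideal J by exact: adj_ideal.
have nilJ y : Q2 y -> exists k, sat Q2 J (y ^+ k).
  move=> Q2y; apply: contrapT => nk; apply: no.
  have [|Q [pQ JQ QQ2 nQy]] := @exists_prime_notin Q2 J y p2 iJ.
    by move=> t k nt Jt; apply: nk; exists k, t.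
  have Qx : Q x by apply: JQ; apply: mem_adj.
  exists Q; split=> //.
  - split; first by move=> z Q0z; apply: JQ; apply: sub_adj.
    by move=> /(_ x Qx).
  - by split=> // /(_ y Q2y).
have [z [Q1z nQ0z]] : exists z, Q1 z /\ ~ Q0 z.
  apply: contrapT => nz; apply: Q01.2 => z Q1z; apply: contrapT => nQ0z.
  by apply: nz; exists z.
pose U n := sat Q1 (adj Q0 (z ^+ n)).
have iU n : is_ideal (U n) by exact/sat_ideal/adj_ideal.
have dU n : U n.+1 `<=` U n.
  apply: satS => _ [i [a [Q0i ->]]]; exists i, (a * z); split=> //.
  by rewrite exprS; ring.
pose V n := sat Q2 (adj (U n) x).
have [||||n Vn] := descending_repeat p2 (sat_ideal p2 iJ) (sat_saturated p2) nilJ (U := V).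
- by move=> n; exact/sat_ideal/adj_ideal.
- by move=> n; exact: sat_saturated.
- move=> n; apply: satS => _ [i [a [Q0i ->]]]; exists i, a; split=> //.
  by apply: sub_sat => //; apply: sub_adj.
- by move=> n; apply: satS => _ [i [a [/dU Q0i ->]]]; exists i, a.
have UU : U n `<=` sat Q2 (U n.+1).
  apply: (nakayama p2 Q2x) => // u Uu.
  have [s [ns [u' [a [Uu' suE]]]]] : V n.+1 u.
    by apply: Vn; apply: sub_sat => //; apply: sub_adj.
  exists s, u', a; split=> //; last by rewrite suE mulrC.
  apply: (sat_saturated p1 nQ1x).
  rewrite (_ : x * a = s * u - u'); last by rewrite suE; ring.
  by apply: (idealB (iU n)); [exact: (ideal_mull _ (iU n) Uu) | exact: dU].
have Uz : U n (z ^+ n) by apply: sub_sat => //; apply: mem_adj.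
have [s [ns [t [nt [i [a [Q0i E]]]]]]] := UU _ Uz.
have Q0E : Q0 (z ^+ n * (t * s - a * z)).
  rewrite (_ : _ * _ = i) //.
  by apply/eqP; rewrite mulrBr subr_eq mulrC -mulrA E exprS; apply/eqP; ring.
case: (primeM p0 Q0E) => [/(primeX p0) //|/Q01.1 Q1ts].
have : Q1 (t * s).
  rewrite -(subrK (a * z) (t * s)); apply: idealD => //; exact: ideal_mull.
by case/(primeM p1) => [//|/Q12.1].
Qed.

Lemma prime_chainW n m (Q : nat -> set A) : (m <= n)%N -> prime_chain n Q -> prime_chain m Q.
Proof.
move=> mn [pQ sQ]; split=> i im; [apply: pQ | apply: sQ]; lia.
Qed.

Lemma prime_chain_shift n (Q : nat -> set A) :
  prime_chain n.+1 Q -> prime_chain n (fun i => Q i.+1).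
Proof. by move=> [pQ sQ]; split=> i im; [apply: pQ | apply: sQ]. Qed.

Lemma prime_chain_cons n (Q : nat -> set A) T : prime_ideal T -> T `<` Q 0%N ->
  prime_chain n Q -> prime_chain n.+1 (fun i => if i is j.+1 then Q j else T).
Proof.
move=> pT TQ [pQ sQ]; split=> -[|i] //=; first by apply: pQ.
by move=> ?; apply: sQ.
Qed.

Lemma prime_chain_rcons n (Q : nat -> set A) T : prime_ideal T -> Q n `<` T ->
  prime_chain n Q -> prime_chain n.+1 (fun i => if (i <= n)%N then Q i else T).
Proof.
move=> pT QT [pQ sQ]; split=> i hi.
  by case: ifP => // hin; apply: pQ.
rewrite (_ : (i <= n)%N) //; case: ifP => hin; first exact: sQ.
by have -> : i = n by lia.
Qed.

Lemma prime_chain_le n (Q : nat -> set A) i j : prime_chain n Q -> (i <= j <= n)%N -> Q i `<=` Q j.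
Proof.
move=> [_ sQ] /andP[/subnKC <-]; elim: (j - i)%N => [|k IH]; first by rewrite addn0 => _ x.
rewrite addnS => h x Qx; apply: (proj1 (sQ _ h)); apply: IH => //; lia.
Qed.

(** Here [x] is pushed down the chain: if the last prime but one misses [x], the principal ideal
    theorem replaces it by one containing [x]. *)
Lemma prime_chain_through n (Q : nat -> set A) x : prime_chain n.+1 Q -> Q n.+1 x ->
  exists Q' : nat -> set A, [/\ prime_chain n.+1 Q', Q' 0%N = Q 0%N, Q' n.+1 = Q n.+1 & Q' 1%N x].
Proof.
elim: n Q => [|n IH] Q cQ Qx; first by exists Q.
have [Qnx|nQnx] := pselect (Q n.+1 x).
  have [Q' [cQ' Q'0 Q'n Q'1]] := IH Q (prime_chainW (leqnSn _) cQ) Qnx.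
  exists (fun i => if (i <= n.+1)%N then Q' i else Q n.+2); split=> //.
    apply: prime_chain_rcons cQ'; first by apply: cQ.1.
    by rewrite Q'n; apply: cQ.2.
  by rewrite ltnn.
have [P [pP QnP PQ Px]] := principal_ideal_theorem (cQ.1 n ltac:(lia)) (cQ.1 n.+1 ltac:(lia))
  (cQ.1 n.+2 ltac:(lia)) (cQ.2 n ltac:(lia)) (cQ.2 n.+1 ltac:(lia)) Qx.
have cQP := prime_chain_rcons pP QnP (prime_chainW (n := n.+2) (m := n) ltac:(lia) cQ).
have [|Q' [cQ' Q'0 Q'n Q'1]] := IH _ cQP; first by rewrite ltnn.
exists (fun i => if (i <= n.+1)%N then Q' i else Q n.+2); split=> //.
  apply: prime_chain_rcons cQ'; first by apply: cQ.1.
  by rewrite Q'n ltnn.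
by rewrite ltnn.
Qed.

Definition adjs I (xs : seq A) := foldl adj I xs.

Lemma adjs_ideal I xs : is_ideal I -> is_ideal (adjs I xs).
Proof. by elim: xs I => [|x xs IH] I //= iI; apply: IH; apply: adj_ideal. Qed.
Lemma sub_adjs I xs : I `<=` adjs I xs.
Proof. by elim: xs I => [|x xs IH] I //= y /(sub_adj x) /IH. Qed.
Lemma mem_adjs I xs x : is_ideal I -> x \in xs -> adjs I xs x.
Proof.
elim: xs I => [|z xs IH] I //= iI; rewrite inE => /orP [/eqP ->|].
  by apply: sub_adjs; apply: mem_adj.
by apply: IH; apply: adj_ideal.
Qed.
Lemma adjs_min I xs J : is_ideal J -> I `<=` J -> (forall x, x \in xs -> J x) ->
  adjs I xs `<=` J.
Proof.
elim: xs I => [|x xs IH] I //= iJ IJ h; apply: IH => //.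
  by apply: adj_min => //; apply: h; rewrite mem_head.
by move=> z zx; apply: h; rewrite inE zx orbT.
Qed.
Lemma adjs_perm I xs ys : is_ideal I -> perm_eq xs ys -> adjs I xs = adjs I ys.
Proof.
move=> iI pe; apply/seteqP; split; apply: adjs_min; try exact: adjs_ideal.
all: try exact: sub_adjs.
all: move=> x; rewrite ?(perm_mem pe) -?(perm_mem pe) => h; apply: mem_adjs => //.
by rewrite -(perm_mem pe).
Qed.

(** Krull's height theorem modulo [I]. The chain is bent so that its second prime contains the first
    generator; that generator moves into [I] and one prime is dropped. *)
Lemma height_le P I xs n (Q : nat -> set A) : is_ideal I -> prime_chain n Q -> Q n = P ->
  I `<=` Q 0%N -> (forall x, x \in xs -> P x) -> P `<=` sat P (adjs I xs) -> (n <= size xs)%N.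
Proof.
elim: xs I n Q => [|x xs IH] I n Q iI cQ QnP IQ xP hP /=.
  case: n cQ QnP => // n cQ QnP; exfalso.
  have [_] := cQ.2 0%N isT; apply.
  apply: (@subset_trans _ P); first by rewrite -QnP; apply: (prime_chain_le cQ); lia.
  apply: (subset_trans hP); apply: sat_sub_prime => //; first exact: cQ.1.
  by rewrite -QnP; apply: (prime_chain_le cQ); lia.
case: n cQ QnP => // n cQ QnP.
have [|Q' [cQ' Q'0 Q'n Q'1]] := prime_chain_through (x := x) cQ.
  by rewrite QnP; apply: xP; rewrite mem_head.
have iQ'1 : is_ideal (Q' 1%N) by apply: prime_ideal_ideal; apply: cQ'.1.
rewrite ltnS; apply: (IH (adj I x) n (fun i => Q' i.+1)) => //.
- exact: adj_ideal.
- exact: prime_chain_shift.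
- by rewrite Q'n.
- by apply: adj_min => // y /IQ; rewrite -Q'0; case: (cQ'.2 0%N isT) => + _; apply.
- by move=> z zx; apply: xP; rewrite inE zx orbT.
Qed.

(** A regular local ring, here A_P modulo [I], is a domain. By induction [I] plus [x] saturates to a
    prime, which [height_le] identifies with the second prime of a chain through [x]. Since [x]
    avoids the bottom prime, every element of that prime is, modulo [I] and up to units, a multiple
    [a * x] with [a] again in it, and [nakayama] applies. *)
Lemma regular_prime P I xs (Q : nat -> set A) : is_ideal I -> prime_ideal P ->
  prime_chain (size xs) Q -> Q (size xs) = P ->
  I `<=` Q 0%N -> (forall x, x \in xs -> P x) -> P `<=` sat P (adjs I xs) ->
  prime_ideal (sat P I).
Proof.
move=> + pP; elim: xs I Q => [|x xs IH] I Q iI cQ QnP IQ xP hP /=.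
  suff -> : sat P I = P by [].
  by apply/seteqP; split=> //; apply: sat_sub_prime => //; rewrite -QnP.
have [|Q' [cQ' Q'0 Q'n Q'1]] := prime_chain_through (x := x) cQ.
  by rewrite QnP; apply: xP; rewrite mem_head.
have p'1 : prime_ideal (Q' 1%N) by apply: cQ'.1.
have iQ'1 := prime_ideal_ideal p'1.
have Q'1P : Q' 1%N `<=` P by rewrite -QnP -Q'n; apply: (prime_chain_le cQ'); lia.
have sI' : adj I x `<=` Q' 1%N.
  by apply: adj_min => // y /IQ; rewrite -Q'0; case: (cQ'.2 0%N isT) => + _; apply.
have iI' : is_ideal (adj I x) by exact: adj_ideal.
have xsP z : z \in xs -> P z by move=> zx; apply: xP; rewrite inE zx orbT.
have pI' : prime_ideal (sat P (adj I x)).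
  apply: (IH (adj I x) (fun i => Q' i.+1)) => //; first exact: prime_chain_shift.
  by rewrite Q'n.
have sI'Q : sat P (adj I x) `<=` Q' 1%N by exact: sat_sub_prime.
have Q'1E : Q' 1%N `<=` sat P (adj I x).
  apply: contrapT => ne.
  have c1 := prime_chain_cons pI' (conj sI'Q ne) (prime_chain_shift cQ').
  have := @height_le P (adj I x) xs _ _ iI' c1; rewrite ltnn => h.
  suff: false by [].
  apply: h => //; first by rewrite Q'n.
  by move=> y; apply: sub_sat.
have p0 : prime_ideal (Q 0%N) by rewrite -Q'0; apply: cQ'.1.
have Q0P : Q 0%N `<=` P by rewrite -QnP; apply: (prime_chain_le cQ); lia.
have [Q01 nQ10] := cQ'.2 0%N isT; rewrite Q'0 in Q01 nQ10.
have nQx : ~ Q 0%N x.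
  move=> Q0x; apply: nQ10; apply: (subset_trans Q'1E); apply: sat_sub_prime => //.
  by apply: adj_min => //; apply: prime_ideal_ideal.
suff -> : sat P I = Q 0%N by [].
apply/seteqP; split; first exact: sat_sub_prime.
have Px : P x by apply: xP; rewrite mem_head.
apply: (nakayama pP Px) => // [|c Q0c]; first exact: prime_ideal_ideal.
have [t [nt [i [a [Ii E]]]]] := Q'1E _ (Q01 _ Q0c).
exists t, i, a; split=> //; last by rewrite E mulrC.
have : Q 0%N (a * x).
  have iQ := prime_ideal_ideal p0.
  rewrite (_ : a * x = t * c - i); last by rewrite E; ring.
  by apply: idealB => //; [apply: ideal_mull | apply: IQ].
by case/(primeM p0).
Qed.

(** Each element of [xs] lowers the dimension by at most one. *)
Lemma chain_above P I xs n (Q : nat -> set A) : is_ideal I ->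
  prime_chain (n + size xs)%N Q -> Q (n + size xs)%N = P ->
  I `<=` Q 0%N -> (forall x, x \in xs -> P x) ->
  exists Q' : nat -> set A, [/\ prime_chain n Q', Q' n = P & adjs I xs `<=` Q' 0%N].
Proof.
elim: xs I Q => [|x xs IH] I Q iI cQ QnP IQ xP /=.
  by rewrite addn0 in cQ QnP; exists Q.
rewrite /= addnS in cQ QnP.
have [|Q' [cQ' Q'0 Q'n Q'1]] := prime_chain_through (x := x) cQ.
  by rewrite QnP; apply: xP; rewrite mem_head.
have iQ'1 : is_ideal (Q' 1%N) by apply: prime_ideal_ideal; apply: cQ'.1.
apply: (IH (adj I x) (fun i => Q' i.+1)) => //.
- exact: adj_ideal.
- exact: prime_chain_shift.
- by rewrite Q'n.
- by apply: adj_min => // y /IQ; rewrite -Q'0; case: (cQ'.2 0%N isT) => + _; apply.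
- by move=> z zx; apply: xP; rewrite inE zx orbT.
Qed.

Section RegularSystem.
Variables (P : set A) (xs ys : seq A) (Q : nat -> set A).
Hypotheses (pP : prime_ideal P) (cQ : prime_chain (size xs + size ys)%N Q)
  (QnP : Q (size xs + size ys)%N = P) (zP : forall z, z \in xs ++ ys -> P z)
  (genP : P `<=` sat P (adjs [set 0] (xs ++ ys))).

Let i0 : is_ideal ([set 0] : set A).
Proof.
split=> //=; first by move=> x y -> ->; rewrite addr0.
by move=> a x ->; rewrite mulr0.
Qed.

Let above : exists Q' : nat -> set A, [/\ prime_chain (size ys) Q', Q' (size ys) = P & adjs [set 0] xs `<=` Q' 0%N].
Proof.
apply: (chain_above (Q := Q)) => //; rewrite 1?addnC //.
  by move=> _ ->; apply: ideal0; apply: prime_ideal_ideal; apply: cQ.1.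
by move=> z zx; apply: zP; rewrite mem_cat zx.
Qed.

Lemma regular_system_prime : prime_ideal (sat P (adjs [set 0] xs)).
Proof.
have [Q' [cQ' Q'P hQ']] := above.
apply: (regular_prime (xs := ys) (Q := Q')) => //.
- exact: adjs_ideal.
- by move=> z zx; apply: zP; rewrite mem_cat zx orbT.
- by rewrite /adjs -foldl_cat.
Qed.

(** If [y] were redundant, the rest of [ys] would generate [P] over [xs] with one generator too few
    for the chain of [above]. *)
Lemma regular_system_notin y : y \in ys -> ~ sat P (adjs [set 0] xs) y.
Proof.
move=> yys sy; have [Q' [cQ' Q'P hQ']] := above.
have pe := perm_to_rem yys.
have ixs := adjs_ideal xs i0.
have := @height_le P (adjs [set 0] xs) (rem y ys) _ _ ixs cQ' Q'P hQ'.
rewrite (perm_size pe) ltnn => h; suff : false by []; apply: h.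
  by move=> z zx; apply: zP; rewrite mem_cat (mem_rem zx) orbT.
apply: (subset_trans genP); apply: sat_min; first exact: sat_saturated.
have -> : adjs [set 0] (xs ++ ys) = adjs (adj (adjs [set 0] xs) y) (rem y ys).
  rewrite /adjs foldl_cat -/(adjs _ xs) -/(adjs _ ys) (adjs_perm _ pe) //.
apply: adjs_min.
- by apply: sat_ideal => //; apply: adjs_ideal.
- apply: adj_min; first by apply: sat_ideal => //; apply: adjs_ideal.
    by move=> z hz; apply: sub_sat => //; apply: sub_adjs.
  by apply: satS sy; apply: sub_adjs.
- by move=> z zx; apply: sub_sat => //; apply: mem_adjs.
Qed.

End RegularSystem.

End Saturation.

(** * Rings of fractions *)

Module Localization.
Local Open Scope quotient_scope.
Section Localization.
Variables (A : comPzRingType) (S : set A) (mS : mult_closed S).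

Definition frac := (A * {s : A | `[< S s >]})%type.
Definition den (x : frac) : A := val x.2.

Lemma denP x : S (den x). Proof. by apply/asboolP; rewrite /den; case: x.2. Qed.

Definition mk (a s : A) (Ss : S s) : frac := (a, exist _ s (asboolT Ss)).

Definition eqfrac : rel frac :=
  fun x y => `[< exists u, S u /\ u * (x.1 * den y) = u * (y.1 * den x) >].

Lemma eqfrac_equiv : equiv_class_of eqfrac.
Proof.
have S1 := mS.1; have SM := mS.2.
split.
- by move=> x; apply/asboolP; exists 1.
- by move=> x y; apply/asbool_equiv_eq; split=> -[u [Su e]]; exists u; rewrite e.
- move=> y x z /asboolP [u [Su eu]] /asboolP [v [Sv ev]]; apply/asboolP.
  exists (u * v * den y); split; first by exact: (SM _ _ (SM _ _ Su Sv) (denP _)).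
  transitivity (v * den z * (u * (x.1 * den y))); first by ring.
  rewrite eu; transitivity (u * den x * (v * (y.1 * den z))); first by ring.
  by rewrite ev; ring.
Qed.

Canonical eqfrac_canonical := EquivRelPack eqfrac_equiv.

Definition loc := {eq_quot eqfrac}.
HB.instance Definition _ := Choice.on loc.

Definition cls (x : frac) : loc := \pi_loc x.

Lemma clsP x y : cls x = cls y <-> exists u, S u /\ u * (x.1 * den y) = u * (y.1 * den x).
Proof.
split=> [/eqmodP/asboolP //|h]; apply/eqmodP; exact/asboolP.
Qed.

Lemma clsW (P : loc -> Prop) : (forall x, P (cls x)) -> forall a, P a.
Proof. by move=> h a; rewrite -[a]reprK; apply: h. Qed.

Lemma cls_repr x : exists u, S u /\ u * ((repr (cls x)).1 * den x) = u * (x.1 * den (repr (cls x))).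
Proof. by apply/clsP; rewrite /cls reprK. Qed.

Lemma SM2 x y : S (den x * den y). Proof. by apply: mS.2; apply: denP. Qed.

Definition addf (x y : frac) := mk (x.1 * den y + y.1 * den x) (SM2 x y).
Definition mulf (x y : frac) := mk (x.1 * y.1) (SM2 x y).
Definition oppf (x : frac) := mk (- x.1) (denP x).
Definition emb (a : A) := mk a mS.1.

Lemma denE : ((forall x y, den (addf x y) = (den x * den y)%R) * (forall x y, den (mulf x y) = (den x * den y)%R)
  * (forall x, den (oppf x) = den x) * (forall a, den (emb a) = 1%R) * (forall a s (Ss : S s), den (mk a Ss) = s)
  * (forall x y, (addf x y).1 = (x.1 * den y + y.1 * den x)%R) * (forall x y, (mulf x y).1 = (x.1 * y.1)%R)
  * (forall x, (oppf x).1 = (- x.1)%R) * (forall a, (emb a).1 = a) * (forall a s (Ss : S s), (mk a Ss).1 = a))%type.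
Proof. by []. Qed.

Definition add (a b : loc) := cls (addf (repr a) (repr b)).
Definition mul (a b : loc) := cls (mulf (repr a) (repr b)).
Definition opp (a : loc) := cls (oppf (repr a)).

Lemma addE x y : add (cls x) (cls y) = cls (addf x y).
Proof.
have [u [Su eu]] := cls_repr x; have [v [Sv ev]] := cls_repr y.
apply/clsP; exists (u * v); split; first by apply: mS.2.
set x' := repr (cls x) in eu *; set y' := repr (cls y) in ev *.
rewrite !denE.
transitivity ((u * (x'.1 * den x)) * (v * den y' * den y) + (v * (y'.1 * den y)) * (u * den x' * den x)).
  by ring.
by rewrite eu ev; ring.
Qed.
Lemma mulE x y : mul (cls x) (cls y) = cls (mulf x y).
Proof.
have [u [Su eu]] := cls_repr x; have [v [Sv ev]] := cls_repr y.
apply/clsP; exists (u * v); split; first by apply: mS.2.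
set x' := repr (cls x) in eu *; set y' := repr (cls y) in ev *.
rewrite !denE.
transitivity ((u * (x'.1 * den x)) * (v * (y'.1 * den y))); first by ring.
by rewrite eu ev; ring.
Qed.
Lemma oppE x : opp (cls x) = cls (oppf x).
Proof.
have [u [Su eu]] := cls_repr x; apply/clsP; exists u; split=> //.
set x' := repr (cls x) in eu *; rewrite !denE.
transitivity (- (u * (x'.1 * den x))); first by ring.
by rewrite eu; ring.
Qed.

Lemma addA : associative add.
Proof.
elim/clsW => x; elim/clsW => y; elim/clsW => z; rewrite !addE; apply/clsP.
by exists 1; split; [exact: mS.1 | rewrite !denE; ring].
Qed.
Lemma addC : commutative add.
Proof.
elim/clsW => x; elim/clsW => y; rewrite !addE; apply/clsP.
by exists 1; split; [exact: mS.1 | rewrite !denE; ring].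
Qed.
Lemma add0 : left_id (cls (emb 0)) add.
Proof.
elim/clsW => x; rewrite !addE; apply/clsP.
by exists 1; split; [exact: mS.1 | rewrite !denE; ring].
Qed.
Lemma addN : left_inverse (cls (emb 0)) opp add.
Proof.
elim/clsW => x; rewrite !oppE !addE; apply/clsP.
by exists 1; split; [exact: mS.1 | rewrite !denE; ring].
Qed.
HB.instance Definition _ := GRing.isZmodule.Build loc addA addC add0 addN.

Lemma mulA : associative mul.
Proof.
elim/clsW => x; elim/clsW => y; elim/clsW => z; rewrite !mulE; apply/clsP.
by exists 1; split; [exact: mS.1 | rewrite !denE; ring].
Qed.
Lemma mulC : commutative mul.
Proof.
elim/clsW => x; elim/clsW => y; rewrite !mulE; apply/clsP.
by exists 1; split; [exact: mS.1 | rewrite !denE; ring].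
Qed.
Lemma mul1 : left_id (cls (emb 1)) mul.
Proof.
elim/clsW => x; rewrite !mulE; apply/clsP.
by exists 1; split; [exact: mS.1 | rewrite !denE; ring].
Qed.
Lemma mulDl : left_distributive mul add.
Proof.
elim/clsW => x; elim/clsW => y; elim/clsW => z; rewrite !(addE, mulE); apply/clsP.
by exists 1; split; [exact: mS.1 | rewrite !denE; ring].
Qed.
HB.instance Definition _ := GRing.Zmodule_isComPzRing.Build loc mulA mulC mul1 mulDl.

Definition inj (a : A) : loc := cls (emb a).

Lemma inj_zmod : zmod_morphism inj.
Proof.
move=> a b; rewrite /inj -[cls (emb a) - _]/(add _ (opp _)) oppE addE; apply/clsP.
by exists 1; split; [exact: mS.1 | rewrite !denE; ring].
Qed.
Lemma inj_monoid : monoid_morphism inj.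
Proof.
split=> // a b; rewrite /inj -[_ * cls _]/(mul _ _) mulE; apply/clsP.
by exists 1; split; [exact: mS.1 | rewrite !denE; ring].
Qed.
HB.instance Definition _ := GRing.isZmodMorphism.Build A loc inj inj_zmod.
HB.instance Definition _ := GRing.isMonoidMorphism.Build A loc inj inj_monoid.

Lemma inj_is_localization : is_localization S (inj : {rmorphism A -> loc}).
Proof.
split.
- move=> s Ss; exists (cls (mk 1 Ss)); rewrite -[LHS]/(mul _ _) mulE; apply/clsP.
  by exists 1; split; [exact: mS.1 | rewrite !denE; ring].
- elim/clsW => x; exists x.1, (den x); split; first exact: denP.
  rewrite -[LHS]/(mul _ _) mulE; apply/clsP.
  by exists 1; split; [exact: mS.1 | rewrite !denE; ring].
- move=> x; rewrite -[0]/(cls (emb 0)) clsP; split=> [] [u [Su e]]; exists u; split=> //.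
    by move: e; rewrite !denE !mul0r mulr0 !mulr1.
  by rewrite !denE mul0r !mulr1 mulr0.
Qed.
End Localization.
End Localization.
HB.export Localization.

(** The predicate [regular_at] speaks of every model of the localization, so it yields nothing until
    one model is at hand. *)
Lemma localization_exists (A : comPzRingType) (S : set A) : mult_closed S ->
  exists (L : comPzRingType) (f : {rmorphism A -> L}), is_localization S f.
Proof.
by move=> mS; exists (Localization.loc mS), (Localization.inj mS); apply: Localization.inj_is_localization.
Qed.

(** * Regular systems of parameters *)

Section RegularSystemExists.
Variables (A L : comPzRingType) (P : set A) (f : {rmorphism A -> L}).
Hypotheses (pP : prime_ideal P) (locf : is_localization (~` P) f).

Definition locext (Q : set A) : set L := [set y | exists a s, [/\ Q a, ~ P s & f s * y = f a]].

Let unit_f s : ~ P s -> exists t, f s * t = 1.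
Proof. by case: locf => + _ _; apply. Qed.
Let frac_f y : exists a s, ~ P s /\ f s * y = f a.
Proof. by case: locf => _ + _; apply. Qed.
Let eq_f a b : f a = f b -> exists u, ~ P u /\ u * a = u * b.
Proof.
move=> e; case: locf => _ _ /(_ (a - b)) [+ _]; rewrite rmorphB e subrr.
by case=> // u [nu /eqP]; rewrite mulrBr subr_eq0 => /eqP ?; exists u.
Qed.

Lemma locext_comap Q a : is_ideal Q -> saturated P Q -> locext Q (f a) -> Q a.
Proof.
move=> iQ sQ [b [s [Qb ns]]]; rewrite -rmorphM => /eq_f [u [nu e]].
apply: (sQ (u * s)); first exact: primeNM.
by rewrite -mulrA e; apply: ideal_mull.
Qed.

Lemma sub_locext Q a : Q a -> locext Q (f a).
Proof. by move=> Qa; exists a, 1; rewrite rmorph1 mul1r; split=> //; apply: prime1. Qed.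

Lemma locext_ideal Q : is_ideal Q -> is_ideal (locext Q).
Proof.
move=> iQ; split.
- by rewrite -(rmorph0 f); apply: sub_locext; apply: ideal0.
- move=> y z [a [s [Qa ns e]]] [b [t [Qb nt e']]]; exists (t * a + s * b), (s * t).
  split; [by apply: idealD => //; apply: ideal_mull | exact: primeNM | ].
  rewrite rmorphD !rmorphM /= -e -e'; ring.
- move=> y z [a [s [Qa ns e]]]; have [b [t [nt e']]] := frac_f y.
  exists (b * a), (t * s); split; [exact: ideal_mull | exact: primeNM | ].
  by rewrite !rmorphM /= -e -e'; ring.
Qed.

Lemma locext_prime Q : prime_ideal Q -> Q `<=` P -> prime_ideal (locext Q).
Proof.
move=> pQ QP; have iQ := prime_ideal_ideal pQ; have sQ := saturated_prime pQ QP.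
split; first split.
- exact: locext_ideal.
- by rewrite -(rmorph1 f) => /(locext_comap iQ sQ); apply: prime1.
move=> y z [c [r [Qc nr e]]].
have [a [s [ns ea]]] := frac_f y; have [b [t [nt eb]]] := frac_f z.
suff : Q (a * b) by case/(primeM pQ) => ?; [left; exists a, s | right; exists b, t].
apply: (sQ r) => //; apply: locext_comap => //.
rewrite (_ : f _ = f (s * t * c)); last by rewrite !rmorphM /= -e -ea -eb; ring.
by apply: sub_locext; apply: ideal_mull.
Qed.

Lemma locext_lt Q Q' : prime_ideal Q -> Q `<` Q' -> Q' `<=` P -> locext Q `<` locext Q'.
Proof.
move=> pQ [QQ' nQQ'] Q'P; split; first by move=> y [a [s [/QQ' Qa ns e]]]; exists a, s.
move=> h; apply: nQQ' => a /sub_locext /h; apply: locext_comap; first exact: prime_ideal_ideal.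
by apply: saturated_prime => // x /QQ' /Q'P.
Qed.

Lemma unit_locext y : ~ locext P y -> exists t, y * t = 1.
Proof.
move=> ny; have [a [s [ns e]]] := frac_f y.
have [t et] : exists t, f a * t = 1 by apply: unit_f => Pa; apply: ny; exists a, s.
by exists (f s * t); rewrite mulrA [y * _]mulrC e.
Qed.

Lemma sub_locextP I : is_ideal I -> ~ I 1 -> I `<=` locext P.
Proof.
move=> iI nI1 y Iy; apply: contrapT => /unit_locext [t e]; apply: nI1.
by rewrite -e; exact: (ideal_mulr t iI Iy).
Qed.

(** Generators of the maximal ideal of [L] are replaced by numerators, from which they differ by
    units, and a longest chain of [L] is contracted to [A]; later arguments can then do without [L].
    The last clause bounds the height of [P] and starts the induction in [flat_at_all]. *)
Lemma regular_local_system : regular_local_ring L -> exists (xs : seq A) (Q : nat -> set A),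
  [/\ prime_chain (size xs) Q, Q (size xs) = P, forall x, x \in xs -> P x,
      P `<=` sat P (adjs [set 0] xs) &
      forall n Q', prime_chain n Q' -> Q' n = P -> (n <= size xs)%N].
Proof.
have iP := prime_ideal_ideal pP.
have pM : prime_ideal (locext P) by exact: locext_prime.
move=> [_ [M [d [[_ Mu] [[Q0 cQ0] Qd] [x Mx]]]]].
have ME : M = locext P.
  apply/esym/Mu; split; first by case: pM.
  by move=> I [iI nI] hI; apply/seteqP; split=> //; apply: sub_locextP.
have [xs [sxs xsP xsx]] : exists xs : seq A, [/\ size xs = size (val x), forall a, a \in xs -> P a &
   forall y, y \in val x -> exists a s, [/\ a \in xs, ~ P s & f s * y = f a]].
  have : forall y, y \in val x -> locext P y.
    by move=> y yx; rewrite -ME Mx; apply: sub_ideal_gen.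
  elim: (val x) => [_|y r IH h]; first by exists [::].
  have [xs [sxs xsP hxs]] := IH (fun z zr => h z (mem_behead (s := y :: r) zr)).
  have [a [s [Pa ns e]]] := h y (mem_head y r).
  exists (a :: xs); split; first by rewrite /= sxs.
    by move=> b; rewrite inE => /orP [/eqP ->|/xsP].
  move=> z; rewrite inE => /orP [/eqP ->|/hxs [b [t [bxs nt e']]]].
    by exists a, s; rewrite mem_head.
  by exists b, t; rewrite inE bxs orbT.
rewrite size_tuple in sxs.
have sub_P Q : prime_ideal Q -> Q `<=` locext P.
  by move=> pQ; apply: sub_locextP; [apply: prime_ideal_ideal | apply: prime1].
(* A longest chain ends in the maximal ideal, which could otherwise be appended to it. *)
have Q0d : Q0 d = locext P.
  have Q0dP := sub_P _ (cQ0.1 d (leqnn _)).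
  apply: contrapT => ne; have := Qd d.+1 (fun i => if (i <= d)%N then Q0 i else locext P).
  rewrite ltnn => h; suff : false by [].
  apply: h; apply: prime_chain_rcons => //; split=> // PQ; apply: ne.
  by apply/seteqP.
exists xs, (fun i => f @^-1` (Q0 i)); rewrite sxs; split.
- split=> i hi.
    have pQ := cQ0.1 i hi; have iQ := prime_ideal_ideal pQ.
    split; last by move=> a b /=; rewrite rmorphM; apply: primeM.
    split; last by rewrite /= rmorph1; apply: prime1.
    split=> /=; first by rewrite rmorph0; apply: ideal0.
      by move=> a b; rewrite rmorphD; apply: idealD.
    by move=> a b; rewrite rmorphM; apply: ideal_mull.
  have [Qi nQi] := cQ0.2 i hi; split; first by move=> a; apply: Qi.
  move=> h; apply: nQi => y Qy; have [a [s [ns e]]] := frac_f y.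
  have Qa : Q0 i (f a).
    by apply: h; rewrite /= -e; apply: ideal_mull => //; apply: prime_ideal_ideal; apply: cQ0.1.
  have [t et] := unit_f ns.
  have -> : y = t * f a by rewrite -e mulrA [t * _]mulrC et mul1r.
  by apply: ideal_mull => //; apply: prime_ideal_ideal; apply: cQ0.1; apply: ltnW.
- rewrite Q0d; apply/seteqP; split; last by move=> a /sub_locext.
  by move=> a; apply: locext_comap => //; apply: saturated_prime.
- by [].
- have i0 : is_ideal (adjs [set 0] xs).
    apply: adjs_ideal; split=> //=; first by move=> ? ? -> ->; rewrite addr0.
    by move=> ? ? ->; rewrite mulr0.
  have sub : ideal_gen [set` val x] `<=` locext (adjs [set 0] xs).
    apply: ideal_gen_min; first exact: locext_ideal.
    move=> y /= /xsx [a [s [axs ns e]]]; exists a, s; split=> //; apply: mem_adjs => //.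
    split=> //=; first by move=> ? ? -> ->; rewrite addr0.
    by move=> ? ? ->; rewrite mulr0.
  move=> a Pa; have : locext (adjs [set 0] xs) (f a).
    by apply: sub; rewrite -Mx ME; apply: sub_locext.
  move=> [b [s [Ib ns]]]; rewrite -rmorphM => /eq_f [u [nu e]].
  by exists (u * s); split; [exact: primeNM | rewrite -mulrA e; apply: ideal_mull].
- move=> n Q cQ QnP; apply: (Qd n (fun i => locext (Q i))).
  have QP i : (i <= n)%N -> Q i `<=` P.
    by move=> hi; rewrite -QnP; apply: (prime_chain_le cQ); rewrite hi leqnn.
  split=> i hi; first by apply: locext_prime (cQ.1 i hi) (QP i hi).
  by apply: locext_lt (cQ.2 i hi) _; [apply: cQ.1; apply: ltnW | apply: QP].
Qed.
End RegularSystemExists.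

Lemma regular_ring_system (A : comPzRingType) (P : set A) : regular_ring A -> prime_ideal P ->
  exists (xs : seq A) (Q : nat -> set A),
  [/\ prime_chain (size xs) Q, Q (size xs) = P, forall x, x \in xs -> P x,
      P `<=` sat P (adjs [set 0] xs) &
      forall n Q', prime_chain n Q' -> Q' n = P -> (n <= size xs)%N].
Proof.
move=> [_ regA] pP; have [L [f locf]] := localization_exists (compl_mult pP).
exact: (regular_local_system pP locf (regA P pP L f locf)).
Qed.

Section RegularSystems.
Variable A : comPzRingType.
Implicit Types (P : set A).

Definition span d (x : 'I_d -> A) (S : {set 'I_d}) : set A :=
  [set y | exists c : 'I_d -> A, y = \sum_(i in S) c i * x i].

(** The last two conditions range over all subsets [S], so that parameters can be added and dropped
    in any order: locally at [P], each [x i] is a nonzerodivisor modulo any set of the others. *)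
Definition regular_system P d (x : 'I_d -> A) : Prop :=
  [/\ forall i, P (x i), P `<=` sat P (span x (finset.setTfor 'I_d)),
      forall S, prime_ideal (sat P (span x S)) &
      forall (S : {set 'I_d}) i, i \notin S -> ~ sat P (span x S) (x i)].

Lemma span_ideal d (x : 'I_d -> A) S : is_ideal (span x S).
Proof.
split.
- by exists (fun=> 0); rewrite big1 // => i _; rewrite mul0r.
- move=> _ _ [c ->] [c' ->]; exists (fun i => c i + c' i); rewrite -big_split /=.
  by apply: eq_bigr => i _; rewrite mulrDl.
- move=> a _ [c ->]; exists (fun i => a * c i); rewrite mulr_sumr.
  by apply: eq_bigr => i _; rewrite mulrA.
Qed.

Lemma mem_span d (x : 'I_d -> A) (S : {set 'I_d}) i : i \in S -> span x S (x i).
Proof.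
move=> iS; exists (fun j => (j == i)%:R); rewrite (bigD1 i) //= eqxx mul1r big1 ?addr0 //.
by move=> j /andP[_ /negPf ->]; rewrite mul0r.
Qed.

Lemma span_min d (x : 'I_d -> A) (S : {set 'I_d}) I : is_ideal I ->
  (forall i, i \in S -> I (x i)) -> span x S `<=` I.
Proof. by move=> iI h _ [c ->]; apply: ideal_sum => // i /h; apply: ideal_mull. Qed.

Lemma span_setD1 d (x : 'I_d -> A) (S : {set 'I_d}) i y : i \in S ->
  span x S y <-> exists a r, span x (S :\ i) r /\ y = a * x i + r.
Proof.
move=> iS; split.
  by move=> [c ->]; rewrite (big_setD1 i) //=; exists (c i), (\sum_(j in S :\ i) c j * x j); split=> //; exists c.
move=> [a [_ [[c ->] ->]]]; exists (fun j => if j == i then a else c j).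
rewrite [RHS](big_setD1 i) //= eqxx; congr (_ + _); apply: eq_bigr => j.
by rewrite !inE => /andP[/negPf ->].
Qed.

Lemma ideal_zero : is_ideal ([set 0] : set A).
Proof.
split=> //=; first by move=> ? ? -> ->; rewrite addr0.
by move=> ? ? ->; rewrite mulr0.
Qed.

Lemma adjs_span d (x : 'I_d -> A) (S : {set 'I_d}) :
  adjs [set 0] [seq x i | i <- enum S] = span x S.
Proof.
have i0 := ideal_zero; apply/seteqP; split.
  apply: adjs_min; first exact: span_ideal.
    by move=> _ ->; apply: ideal0; apply: span_ideal.
  by move=> _ /mapP [i + ->]; rewrite mem_enum; apply: mem_span.
apply: span_min; first exact: adjs_ideal.
by move=> i iS; apply: mem_adjs => //; apply/mapP; exists i; rewrite ?mem_enum.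
Qed.

(** Each subset is listed first and its complement after it, because [regular_system_prime] and
    [regular_system_notin] treat initial segments. *)
Lemma regular_system_exists P : noetherian A -> regular_ring A -> prime_ideal P ->
  exists d (x : 'I_d -> A), regular_system P x /\
    forall n Q, prime_chain n Q -> Q n = P -> (n <= d)%N.
Proof.
move=> noeth regA pP.
have [xs [Q [cQ QP xsP genP bound]]] := regular_ring_system regA pP.
pose x (i : 'I_(size xs)) := nth 0 xs i.
exists (size xs), x; split=> //.
have sz (S : {set 'I_(size xs)}) :
    (size (map x (enum S)) + size (map x (enum (~: S))))%N = size xs.
  by rewrite !size_map -!cardE cardsC card_ord.
have pe (S : {set 'I_(size xs)}) :
    perm_eq (map x (enum S) ++ map x (enum (~: S))) xs.
  rewrite -map_cat -[X in perm_eq _ X](mkseq_nth 0 xs) /mkseq -val_enum_ord -map_comp.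
  apply: perm_map; apply: uniq_perm; rewrite ?enum_uniq //.
    rewrite cat_uniq !enum_uniq /= andbT; apply/hasPn => i.
    by rewrite !mem_enum inE.
  by move=> i; rewrite mem_cat !mem_enum !inE orbN.
have zP (S : {set 'I_(size xs)}) z : z \in map x (enum S) ++ map x (enum (~: S)) -> P z.
  by rewrite (perm_mem (pe S)); apply: xsP.
have gP (S : {set 'I_(size xs)}) : P `<=` sat P (adjs [set 0] (map x (enum S) ++ map x (enum (~: S)))).
  by rewrite (adjs_perm ideal_zero (pe S)).
split.
- by move=> i; apply/xsP/mem_nth.
- move=> y Py; rewrite -adjs_span; have := gP (finset.setTfor _) y Py.
  by rewrite finset.setCT enum_set0 /= cats0.
- by move=> S; rewrite -adjs_span; apply: (regular_system_prime noeth (Q := Q) pP _ _ (@zP S) (gP S)); rewrite ?sz.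
- move=> S i iS; rewrite -adjs_span.
  apply: (regular_system_notin noeth (Q := Q) pP _ _ (@zP S) (gP S)); rewrite ?sz //.
  by apply/mapP; exists i; rewrite ?mem_enum ?inE.
Qed.

Section Powers.
Variables (P : set A) (d : nat) (x : 'I_d -> A).
Hypotheses (pP : prime_ideal P) (rs : regular_system P x).

Definition pspan (e : 'I_d -> nat) := span (fun i => x i ^+ e i).

Lemma pspan_ideal e S : is_ideal (pspan e S). Proof. exact: span_ideal. Qed.

Lemma pspan_setD1 e (S : {set 'I_d}) i y : i \in S ->
  pspan e S y <-> exists a r, pspan e (S :\ i) r /\ y = a * x i ^+ e i + r.
Proof. exact: span_setD1. Qed.

Lemma eq_pspan e e' (S : {set 'I_d}) : {in S, e =1 e'} -> pspan e S = pspan e' S.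
Proof.
move=> ee; apply/seteqP; split=> _ [c ->]; exists c; apply: eq_bigr => i iS.
  by rewrite ee.
by rewrite ee.
Qed.

(** Induction on the exponents. Where [e i] is [q.+1] with [q] positive, the case of exponent [q]
    makes [c] a multiple [a * x i ^+ q] modulo the other powers. Cancelling [x i ^+ q], which is
    allowed with one parameter less, leaves a relation between [z] and [a] modulo [x i], so that [a]
    is in turn a multiple of [x i]. *)
Lemma sat_pspan_colon e S z c : ~ sat P (span x S) z ->
  sat P (pspan e S) (z * c) -> sat P (pspan e S) c.
Proof.
have [m] := ubnP (\sum_(i in S) (e i).+1)%N.
elim: m e S z c => // m IH e S z c; rewrite ltnS => le nz szc.
have iI := pspan_ideal.
have [xP _ pS nS] := rs.
have [/existsP [i /andP[iS /eqP ei]]|/existsPn h0] := boolP [exists i, (i \in S) && (e i == 0)%N].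
  apply: sub_sat => //; rewrite -[c]mulr1; apply: ideal_mull => //.
  by have := @mem_span _ (fun i => x i ^+ e i) S i iS; rewrite /= ei expr0.
have [/existsP [i /andP[iS ei]]|/existsPn h1] := boolP [exists i, (i \in S) && (1 < e i)%N]; last first.
  have e1 : pspan e S = span x S.
    have : {in S, e =1 fun=> 1%N}.
      by move=> i iS; have := h0 i; have := h1 i; rewrite iS /=; lia.
    by move/eq_pspan ->; apply/seteqP; split=> _ [k ->]; exists k; apply: eq_bigr => i _; rewrite expr1.
  by move: szc; rewrite e1 => /(primeM (pS S)) [].
pose upd k := fun j => if j == i then k else e j.
have updS k : pspan (upd k) (S :\ i) = pspan e (S :\ i).
  by apply: eq_pspan => j; rewrite !inE /upd => /andP[/negPf ->].
have updE k y : pspan (upd k) S y <-> exists a r, pspan e (S :\ i) r /\ y = a * x i ^+ k + r.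
  by rewrite (pspan_setD1 _ _ iS) updS /upd eqxx.
have eE y : pspan e S y <-> exists a r, pspan e (S :\ i) r /\ y = a * x i ^+ e i + r.
  exact: pspan_setD1.
have lt_upd k : (k < e i)%N -> (\sum_(j in S) (upd k j).+1 < m)%N.
  move=> ke; have D f : (\sum_(j in S) f j = f i + \sum_(j in S | j != i) f j)%N by rewrite (bigD1 i).
  move: le; rewrite !D [upd k i]/upd eqxx.
  have -> : (\sum_(j in S | j != i) (upd k j).+1 = \sum_(j in S | j != i) (e j).+1)%N.
    by apply: eq_bigr => j /andP[_ /negPf ji]; rewrite /upd ji.
  lia.
have ltD : (\sum_(j in S :\ i) (e j).+1 < m)%N.
  by move: le; rewrite (big_setD1 i iS) /=; lia.
have eiE : e i = (e i).-1.+1 by rewrite prednK // ltnW.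
have m0 : (0 < (e i).-1)%N by rewrite -ltnS -eiE.
set q := (e i).-1 in eiE m0.
have [t [nt /updE [a [r [hr tc]]]]] : sat P (pspan (upd q) S) c.
  apply: (IH _ _ z) => //; first by apply: lt_upd; rewrite eiE.
  have [t [nt /eE [a [r [hr E]]]]] := szc; exists t; split=> //.
  by apply/updE; exists (a * x i), r; split=> //; rewrite E eiE exprS; ring.
have [s [ns /eE [b [r' [hr' E]]]]] := szc.
have h : sat P (pspan e (S :\ i)) (x i ^+ q * (s * z * a - t * b * x i)).
  exists 1; split; first exact: prime1.
  rewrite (_ : _ * _ = t * r' - s * z * r).
    by apply: idealB => //; apply: ideal_mull.
  have -> : r' = s * (z * c) - b * x i ^+ e i by rewrite E; ring.
  have -> : r = t * c - a * x i ^+ q by rewrite tc; ring.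
  by rewrite eiE exprS; ring.
have [s' [ns' h']] : sat P (pspan e (S :\ i)) (s * z * a - t * b * x i).
  apply: (IH _ _ (x i ^+ q)) => //; apply: primeNX; first exact: pS.
  by apply: nS; rewrite !inE eqxx.
have [s2 [ns2 /updE [b' [r2 [hr2 E2]]]]] : sat P (pspan (upd 1%N) S) a.
  apply: (IH _ _ z) => //; first by apply: lt_upd; rewrite eiE ltnS.
  exists (s' * s); split; first exact: primeNM.
  apply/updE; exists (s' * t * b), (s' * (s * z * a - t * b * x i)); split=> //.
  by rewrite expr1; ring.
exists (s2 * t); split; first exact: primeNM.
apply/eE; exists b', (r2 * x i ^+ q + s2 * r); split.
  by apply: idealD => //; [apply: ideal_mulr | apply: ideal_mull].
rewrite -mulrA tc mulrDr mulrA E2 expr1 eiE exprS; ring.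
Qed.

Lemma sat_pspan_colonX e (S : {set 'I_d}) i k c : i \notin S ->
  sat P (pspan e S) (x i ^+ k * c) -> sat P (pspan e S) c.
Proof.
have [_ _ pS nS] := rs.
by move=> iS; apply: sat_pspan_colon; apply: primeNX => //; apply: nS.
Qed.
End Powers.
End RegularSystems.

(** * Submodules and matrices over a noetherian ring *)

Definition allmx (T : Type) (U : set T) m n (M : 'M[T]_(m, n)) := forall i j, U (M i j).

Definition submodule (A B : comPzRingType) (g : A -> B) (U : set B) : Prop :=
  [/\ U 0, forall x y, U x -> U y -> U (x + y) & forall a x, U x -> U (g a * x)].

Section NoetherianModules.
Variable A : comPzRingType.

Lemma sat_common (P I : set A) (T : finType) (F : T -> A) : prime_ideal P -> is_ideal I ->
  (forall i, sat P I (F i)) -> exists t, ~ P t /\ forall i, I (t * F i).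
Proof.
move=> pP iI h.
have /choice [s hs] : forall i, exists s, ~ P s /\ I (s * F i) by move=> i; apply: h.
exists (\prod_i s i); split; first by apply: primeN_prod => // i; case: (hs i).
by move=> i; rewrite (bigD1 i) //= mulrAC; apply: ideal_mulr => //; case: (hs i).
Qed.

Lemma allmx_ideal_mul (I : set A) m n p (a : 'M[A]_(m, n)) (b : 'M[A]_(n, p)) :
  is_ideal I -> allmx I a -> allmx I (a *m b).
Proof.
by move=> iI h i j; rewrite mxE; apply: ideal_sum => // k _; apply: ideal_mulr.
Qed.

(** The first coordinates form an ideal; finitely many lifts of its generators deal with them, and
    the elements with first coordinate zero form a submodule of a smaller space. The generators come
    as columns of one matrix, the form in which syzygies enter below. *)
Lemma noetherian_submodule n (W : set 'cV[A]_n) : noetherian A ->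
  W 0 -> (forall u v, W u -> W v -> W (u + v)) -> (forall a u, W u -> W (a *: u)) ->
  exists k (z : 'M[A]_(n, k)), (forall c, W (z *m c)) /\ forall b, W b -> exists c, b = z *m c.
Proof.
move=> noeth; elim: n W => [|n IH] W W0 WD WZ.
  exists 0%N, 0; split=> [c|b _]; first by rewrite mul0mx.
  by exists 0; apply/matrixP => -[].
move: W W0 WD WZ; rewrite -[n.+1]/(1 + n)%N => W W0 WD WZ.
pose I : set A := [set a | exists u : 'cV_(1 + n), W u /\ u 0 0 = a].
have iI : is_ideal I.
  split.
  - by exists 0; rewrite mxE.
  - by move=> _ _ [u [Wu <-]] [v [Wv <-]]; exists (u + v); rewrite mxE; split=> //; apply: WD.
  - by move=> a _ [u [Wu <-]]; exists (a *: u); rewrite mxE; split=> //; apply: WZ.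
have [s Is] := noeth I iI.
have /choice [u hu] : forall i : 'I_(size s), exists u : 'cV[A]_(1 + n), W u /\ u 0 0 = s`_i.
  move=> i; have : I s`_i by rewrite Is; apply: sub_ideal_gen; apply: mem_nth.
  by [].
have WB v w : W v -> W w -> W (v - w).
  by move=> Wv Ww; apply: WD => //; rewrite -scaleN1r; apply: WZ.
pose W' : set 'cV[A]_n := [set v | W (col_mx (0 : 'cV_1) v)].
have [|||k [z [Wz hz]]] := IH W'.
- by rewrite /W' /= col_mx0.
- by move=> v w; rewrite /W' /= => Wv Ww; rewrite -[0]addr0 -add_col_mx; apply: WD.
- by move=> a v; rewrite /W' /= => Wv; rewrite -(scaler0 _ a) -scale_col_mx; apply: WZ.
pose z1 : 'M[A]_(1 + n, size s) := \matrix_(i, j) u j i 0.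
have Wz1 c : W (z1 *m c).
  rewrite (_ : z1 *m c = \sum_j c j 0 *: u j).
    by elim/big_ind: _ => // j _; apply: WZ; case: (hu j).
  apply/colP => i; rewrite mxE summxE; apply: eq_bigr => j _.
  by rewrite !mxE mulrC.
exists (size s + k)%N, (row_mx z1 (col_mx 0 z)); split.
  move=> c; rewrite -[c]vsubmxK mul_row_col; apply: WD => //.
  by rewrite mul_col_mx mul0mx; apply: Wz.
move=> b Wb; have : I ((b : 'cV_(1 + n)) 0 0) by exists b.
rewrite {1}Is => /ideal_genP [m [c [y [ys bE]]]].
have /choice [f hf] : forall j : 'I_m, exists i : 'I_(size s), s`_i = y j.
  move=> j; have yj := ys j; have lt : (index (y j) s < size s)%N by rewrite index_mem.
  by exists (Ordinal lt); rewrite nth_index.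
pose c1 : 'cV[A]_(size s) := \col_i \sum_(j | f j == i) c j.
have e0 : (z1 *m c1) 0 0 = b 0 0.
  rewrite mxE bE (partition_big f predT) //=; apply: eq_bigr => i _.
  rewrite !mxE mulr_sumr; apply: eq_bigr => j /eqP <-.
  by case: (hu (f j)) => _ ->; rewrite hf mulrC.
have u0 : usubmx (b - z1 *m c1) = 0.
  apply/matrixP => i j; rewrite !ord1 [LHS]mxE [RHS]mxE (_ : lshift n 0 = 0); last exact: val_inj.
  by rewrite mxE [X in _ + X]mxE e0 subrr.
have bz : b - z1 *m c1 = col_mx 0 (dsubmx (b - z1 *m c1)) by rewrite -u0 vsubmxK.
have [c2 hc2] : exists c2, dsubmx (b - z1 *m c1) = z *m c2.
  by apply: hz; rewrite /W' /= -bz; apply: WB.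
exists (col_mx c1 c2); rewrite mul_row_col mul_col_mx mul0mx -hc2 -bz.
by rewrite addrC subrK.
Qed.
End NoetherianModules.

Lemma mulmx_col (A : comPzRingType) m n p (a : 'M[A]_(m, n)) (b : 'M[A]_(n, p)) j :
  a *m col j b = col j (a *m b).
Proof. by apply/colP => i; rewrite !mxE; apply: eq_bigr => k _; rewrite mxE. Qed.

(** * Equational flatness over regular rings *)

Section Flatness.
Variables (A B : comPzRingType) (g : {rmorphism A -> B}).
Implicit Types (P I : set A) (N U : set B).

Local Notation "a ^g" := (map_mx g a) (at level 2, format "a ^g").

Lemma submodule0 U : submodule g U -> U 0. Proof. by case. Qed.
Lemma submoduleD U x y : submodule g U -> U x -> U y -> U (x + y).
Proof. by case=> _ h _; apply: h. Qed.
Lemma submoduleZ U a x : submodule g U -> U x -> U (g a * x).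
Proof. by case=> _ _ h; apply: h. Qed.
Lemma submoduleN U x : submodule g U -> U x -> U (- x).
Proof. by move=> sU Ux; rewrite -mulN1r -(rmorph1 g) -rmorphN; apply: submoduleZ. Qed.
Lemma submoduleB U x y : submodule g U -> U x -> U y -> U (x - y).
Proof. by move=> sU Ux Uy; apply: submoduleD => //; apply: submoduleN. Qed.
Lemma submodule_sum U (J : Type) (r : seq J) (Pr : pred J) (F : J -> B) :
  submodule g U -> (forall i, Pr i -> U (F i)) -> U (\sum_(i <- r | Pr i) F i).
Proof.
move=> iI h; elim/big_ind: _ => //; first exact: submodule0.
by move=> *; apply: submoduleD.
Qed.

Lemma allmxD U m n (M M' : 'M[B]_(m, n)) : submodule g U -> allmx U M -> allmx U M' -> allmx U (M + M').
Proof. by move=> sU h h' i j; rewrite mxE; apply: submoduleD. Qed.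
Lemma allmxN U m n (M : 'M[B]_(m, n)) : submodule g U -> allmx U M -> allmx U (- M).
Proof. by move=> sU h i j; rewrite mxE; apply: submoduleN. Qed.
Lemma allmxB U m n (M M' : 'M[B]_(m, n)) : submodule g U -> allmx U M -> allmx U M' -> allmx U (M - M').
Proof. by move=> sU h h'; apply: allmxD => //; apply: allmxN. Qed.
Lemma allmxZ U m n a (M : 'M[B]_(m, n)) : submodule g U -> allmx U M -> allmx U (g a *: M).
Proof. by move=> sU h i j; rewrite mxE; apply: submoduleZ. Qed.
Lemma allmxM U m n p (a : 'M[A]_(m, n)) (M : 'M[B]_(n, p)) : submodule g U ->
  allmx U M -> allmx U (a^g *m M).
Proof.
by move=> sU h i j; rewrite mxE; apply: submodule_sum => // k _; rewrite mxE; apply: submoduleZ.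
Qed.
Lemma allmx0 U m n : submodule g U -> allmx U (0 : 'M[B]_(m, n)).
Proof. by move=> sU i j; rewrite mxE; apply: submodule0. Qed.
Lemma allmx_col U m1 m2 n (M : 'M[B]_(m1, n)) (M' : 'M[B]_(m2, n)) :
  allmx U M -> allmx U M' -> allmx U (col_mx M M').
Proof. by move=> h h' i j; rewrite mxE; case: split. Qed.

(* The equational criterion of flatness of [N] at [P], for relations modulo [(I, U)], where [U]
   plays the role of [I N]. *)
Definition flat_mod P N I U := forall n (a : 'rV[A]_n) (y : 'cV[B]_n),
  allmx N y -> allmx U (a^g *m y) ->
  exists t m (b : 'M[A]_(n, m)) (w : 'cV[B]_m),
    [/\ ~ P t, allmx N w, allmx U (g t *: y - b^g *m w) & allmx I (a *m b)].

Definition flat_at P N := flat_mod P N [set 0] [set 0].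

(** The lower rows are solved first, which expresses [y] through [w]; the top row is then a single
    relation for [w]. *)
Lemma flat_mod_system P N I U k n (a : 'M[A]_(k, n)) (y : 'cV[B]_n) :
  prime_ideal P -> is_ideal I -> submodule g U -> flat_mod P N I U ->
  allmx N y -> allmx U (a^g *m y) ->
  exists t m (b : 'M[A]_(n, m)) (w : 'cV[B]_m),
    [/\ ~ P t, allmx N w, allmx U (g t *: y - b^g *m w) & allmx I (a *m b)].
Proof.
move=> pP iI sU fl Ny.
elim: k a => [|k IH] a Uay.
  exists 1, n, 1%:M, y; split=> //; first exact: prime1.
    by rewrite rmorph1 scale1r map_mx1 mul1mx subrr; apply: allmx0.
  by case.
have Ua' : allmx U ((dsubmx (a : 'M_(1 + k, n)))^g *m y).
  move=> i j; have := Uay (rshift 1 i) j; rewrite [X in U X -> _]mxE [X in _ -> U X]mxE.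
  by congr U; apply: eq_bigr => l _; rewrite !mxE.
have [t [m [b [w [nt Nw Uw Ib]]]]] := IH _ Ua'.
set a0 := usubmx (a : 'M_(1 + k, n)).
have Ua0 : allmx U (a0^g *m y).
  move=> i j; have := Uay (lshift k i) j; rewrite [X in U X -> _]mxE [X in _ -> U X]mxE.
  by congr U; apply: eq_bigr => l _; rewrite !mxE.
have Ua0w : allmx U ((a0 *m b)^g *m w).
  have -> : (a0 *m b)^g *m w = g t *: (a0^g *m y) - a0^g *m (g t *: y - b^g *m w).
    by rewrite map_mxM mulmxBr -scalemxAr mulmxA opprB addrC subrK.
  by apply: allmxB => //; [apply: allmxZ | apply: allmxM].
have [t' [m' [b' [w' [nt' Nw' Uw' Ib']]]]] := fl _ _ _ Nw Ua0w.
exists (t' * t), m', (b *m b'), w'; split=> //; first exact: primeNM.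
  rewrite (_ : _ - _ = g t' *: (g t *: y - b^g *m w) + b^g *m (g t' *: w - b'^g *m w')).
    by apply: allmxD => //; [apply: allmxZ | apply: allmxM].
  rewrite scalerBr scalerA rmorphM map_mxM mulmxBr -scalemxAr mulmxA.
  by rewrite addrA subrK.
move=> i j; rewrite -(@vsubmxK _ 1 k n a) mulmxA.
rewrite (_ : col_mx _ _ *m b *m b' = col_mx (a0 *m b *m b') (dsubmx (a : 'M_(1 + k, n)) *m b *m b')).
  rewrite mxE; case: split => l; first exact: Ib'.
  exact: allmx_ideal_mul.
by rewrite -!mul_col_mx.
Qed.

Section OneSystem.
Variables (N : set B) (d : nat) (x : 'I_d -> A).
Hypothesis sN : submodule g N.

Definition mspan (S : {set 'I_d}) : set B :=
  [set y | exists n : 'I_d -> B, (forall i, N (n i)) /\ y = \sum_(i in S) g (x i) * n i].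

Lemma mspan_submodule S : submodule g (mspan S).
Proof.
split.
- exists (fun=> 0); split; first by move=> _; apply: submodule0.
  by rewrite big1 // => i _; rewrite mulr0.
- move=> _ _ [n [Nn ->]] [n' [Nn' ->]]; exists (fun i => n i + n' i); split.
    by move=> i; apply: submoduleD.
  by rewrite -big_split /=; apply: eq_bigr => i _; rewrite mulrDr.
- move=> a _ [n [Nn ->]]; exists (fun i => g a * n i); split.
    by move=> i; apply: submoduleZ.
  by rewrite mulr_sumr; apply: eq_bigr => i _; rewrite mulrCA.
Qed.

Lemma mem_mspan (S : {set 'I_d}) i y : i \in S -> N y -> mspan S (g (x i) * y).
Proof.
move=> iS Ny; exists (fun j => if j == i then y else 0); split.
  by move=> j; case: ifP => // _; apply: submodule0.
rewrite (bigD1 i) //= eqxx big1 ?addr0 // => j /andP[_ /negPf ->].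
by rewrite mulr0.
Qed.

Lemma mspan_min (S : {set 'I_d}) U : submodule g U ->
  (forall i n, i \in S -> N n -> U (g (x i) * n)) -> mspan S `<=` U.
Proof. by move=> sU h _ [c [Nc ->]]; apply: submodule_sum => // i iS; apply: h. Qed.

Lemma mspan_setD1 (S : {set 'I_d}) i y : i \in S ->
  mspan S y <-> exists n r, [/\ N n, mspan (S :\ i) r & y = g (x i) * n + r].
Proof.
move=> iS; split.
  move=> [c [Nc ->]]; rewrite (big_setD1 i) //=.
  by exists (c i), (\sum_(j in S :\ i) g (x j) * c j); split=> //; exists c.
move=> [n [r [Nn [c [Nc ->]] ->]]]; exists (fun j => if j == i then n else c j).
split; first by move=> j; case: ifP.
rewrite [RHS](big_setD1 i) //= eqxx; congr (_ + _); apply: eq_bigr => j.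
by rewrite !inE => /andP[/negPf ->].
Qed.

Lemma mspan_scale (S : {set 'I_d}) a n : span x S a -> N n -> mspan S (g a * n).
Proof.
move=> [c ->] Nn; rewrite rmorph_sum mulr_suml; apply: submodule_sum => [|i iS].
  exact: mspan_submodule.
by rewrite rmorphM -mulrA; apply: submoduleZ (mspan_submodule S) _; apply: mem_mspan.
Qed.

Lemma allmx_mspan_scale (S : {set 'I_d}) m n p (a : 'M[A]_(m, n)) (y : 'M[B]_(n, p)) :
  allmx (span x S) a -> allmx N y -> allmx (mspan S) (a^g *m y).
Proof.
move=> h Ny i j; rewrite mxE; apply: submodule_sum (mspan_submodule S) _ => k _.
by rewrite mxE; apply: mspan_scale.
Qed.

(** A relation modulo [span x S] becomes exact once the coefficients [- x j] are appended; the
    solution is cut back to the coordinates of [y]. *)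
Lemma flat_mod_change P (S : {set 'I_d}) : flat_at P N -> flat_mod P N (span x S) (mspan S).
Proof.
move=> fl n a y Ny Uay.
have /choice [c hc] : forall i : 'I_1, exists c : 'I_d -> B, (forall i, N (c i)) /\
    (a^g *m y) i 0 = \sum_(j in S) g (x j) * c j by move=> i; apply: Uay.
pose xr : 'rV[A]_d := \row_j (if j \in S then - x j else 0).
pose cv : 'cV[B]_d := \col_j c 0 j.
have := fl _ (row_mx a xr) (col_mx y cv).
case.
- apply: allmx_col => // i j; rewrite mxE; by case: (hc 0).
- move=> i j; rewrite !ord1 map_row_mx mul_row_col mxE; case: (hc 0) => _ ->.
  rewrite [X in _ + X]mxE big_mkcond -big_split /= big1 // => l _.
  by rewrite !mxE; case: ifP; rewrite ?rmorphN ?rmorph0 ?mul0r ?addr0 ?mulNr ?subrr.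
move=> t [m [b [w [nt Nw eq0 ab0]]]].
have e0 : g t *: col_mx y cv = b^g *m w.
  by apply/eqP; rewrite -subr_eq0; apply/eqP/matrixP => i j; rewrite [RHS]mxE; apply: eq0.
exists t, m, (usubmx b), w; split=> //.
  move: e0; rewrite -{1}[b]vsubmxK map_col_mx mul_col_mx scale_col_mx => /eq_col_mx [-> _].
  by rewrite subrr; apply: allmx0 (mspan_submodule S).
move=> i j; rewrite !ord1; have := ab0 0 j.
rewrite -{1}[b]vsubmxK mul_row_col mxE => /eqP; rewrite addrC addr_eq0 => /eqP e.
have -> : (a *m usubmx b) 0 j = - (xr *m dsubmx b) 0 j by rewrite e opprK.
rewrite mxE -sumrN; exists (fun l => (dsubmx b) l j).
rewrite [RHS]big_mkcond; apply: eq_bigr => l _.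
by rewrite [xr _ _]mxE; case: ifP => _; rewrite ?mul0r ?oppr0 // mulNr opprK mulrC.
Qed.

(** Linear algebra over the residue field: a coefficient invertible at [P] lets the relation be
    solved for its variable, and if there is none a scalar matrix solves it. *)
Lemma flat_mod_full P : prime_ideal P -> P `<=` sat P (span x (finset.setTfor _)) ->
  flat_mod P N (span x (finset.setTfor _)) (mspan (finset.setTfor _)).
Proof.
move=> pP genP n a y Ny Uay.
have [[i nai]|all_P] := pselect (exists i, ~ P (a 0 i)).
  exists (a 0 i), n, ((a 0 i)%:M - delta_mx i 0 *m a), y; split=> //.
    rewrite map_mxB map_scalar_mx mulmxBl mul_scalar_mx opprB addrC subrK map_mxM -mulmxA.
    by apply: allmxM (mspan_submodule _) _.
  have -> : a *m ((a 0 i)%:M - delta_mx i 0 *m a) = 0.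
    rewrite mulmxBr mul_mx_scalar mulmxA.
    have -> : a *m delta_mx i 0 = (a 0 i)%:M.
      by rewrite -colE; apply/matrixP => k l; rewrite !ord1 !mxE eqxx mulr1n.
    by rewrite mul_scalar_mx subrr.
  by move=> k l; rewrite mxE; apply: ideal0; apply: span_ideal.
have Pa j : sat P (span x (finset.setTfor _)) (a 0 j).
  by apply: genP; apply: contrapT => h; apply: all_P; exists j.
have [s [ns hs]] := sat_common pP (span_ideal x _) Pa.
exists s, n, (s%:M), y; split=> //.
  by rewrite map_scalar_mx mul_scalar_mx subrr; apply: allmx0 (mspan_submodule _).
by move=> i j; rewrite mul_mx_scalar !ord1 mxE.
Qed.

(** The local criterion of flatness for one nonzerodivisor [x i]. With [z] the matrix of all
    syzygies of [a] modulo [I], let [K] consist of the [c] for which [c] times [y] is a combination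
    of the columns of [z] modulo [U]. Flatness at primes without [x i] puts some [t * x i ^+ k] into
    [K]; flatness modulo [x i] lowers [k] down to 0. *)
Lemma flat_mod_step P (S : {set 'I_d}) i : noetherian A -> prime_ideal P -> i \notin S ->
  flat_mod P N (span x (i |: S)) (mspan (i |: S)) ->
  (forall P', prime_ideal P' -> P' `<=` P -> ~ P' (x i) -> flat_mod P' N (span x S) (mspan S)) ->
  (forall y, N y -> mspan S (g (x i) * y) -> exists t, ~ P t /\ mspan S (g t * y)) ->
  (forall c, sat P (span x S) (x i * c) -> sat P (span x S) c) ->
  flat_mod P N (span x S) (mspan S).
Proof.
move=> noeth pP niS flS flP' regN regA n a y Ny Uay.
set U := mspan S; set I := span x S.
have sU : submodule g U by exact: mspan_submodule.
have iI : is_ideal I by exact: span_ideal.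
have iiS : i \in i |: S by rewrite !inE eqxx.
have SD1 : (i |: S) :\ i = S by rewrite setU1K.
have [|||k [z [Iz hz]]] := @noetherian_submodule A n [set b : 'cV_n | allmx I (a *m b)] noeth.
- by move=> k l /=; rewrite mulmx0 mxE; apply: ideal0.
- by move=> b b' hb hb' k l /=; rewrite mulmxDr mxE; apply: idealD.
- by move=> c b hb k l /=; rewrite -scalemxAr mxE; apply: ideal_mull.
have {}hz m (b : 'M_(n, m)) : allmx I (a *m b) -> exists c, b = z *m c.
  move=> hb; have /choice [c hc] : forall j, exists c : 'cV_k, col j b = z *m c.
    move=> j; apply: hz => u v; rewrite mulmx_col mxE; exact: hb.
  exists (\matrix_(u, v) c v u 0); apply/matrixP => u v.
  have /matrixP/(_ u 0) := hc v; rewrite mxE => ->; rewrite !mxE.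
  by apply: eq_bigr => l _; rewrite !mxE.
have {}Iz m (c : 'M_(k, m)) : allmx I (a *m (z *m c)).
  by move=> u v; have := Iz (col v c) u 0; rewrite /= !mulmx_col [X in I X -> _]mxE.
pose K : set A := [set c | exists w : 'cV_k, allmx N w /\ allmx U (g c *: y - z^g *m w)].
have iK : is_ideal K.
  split.
  - exists 0; split; first exact: allmx0.
    by rewrite rmorph0 scale0r mulmx0 subrr; apply: allmx0.
  - move=> c c' [w [Nw Uw]] [w' [Nw' Uw']]; exists (w + w'); split; first exact: allmxD.
    rewrite (_ : _ - _ = (g c *: y - z^g *m w) + (g c' *: y - z^g *m w')); first exact: allmxD.
    by rewrite rmorphD scalerDl mulmxDr opprD addrACA.
  - move=> c c' [w [Nw Uw]]; exists (g c *: w); split; first exact: allmxZ.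
    rewrite (_ : _ - _ = g c *: (g c' *: y - z^g *m w)); first exact: allmxZ.
    by rewrite rmorphM scalerBr scalerA scalemxAr.
have [c0 [k0 [nc0 Kc0]]] : exists t k, ~ P t /\ K (t * x i ^+ k).
  apply: contrapT => no; have [|Q [pQ KQ QP nQx]] := exists_prime_notin (y := x i) pP iK.
    by move=> t l nt Kt; apply: no; exists t, l.
  have [t [m [b [w [nt Nw Uw Ib]]]]] := flP' Q pQ QP nQx n a y Ny Uay.
  apply: nt; apply: KQ; have [c bE] := hz _ _ Ib; exists (c^g *m w).
  by split; [apply: allmxM | rewrite mulmxA -map_mxM -bE].
(* Modulo [x i] the product of [z] and [w] vanishes. Flatness there writes [w], up to a unit, as [b]
   times [v] plus [x i] times [um], with [z *m b] equal to [x i] times some [gm] modulo [I].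
   Cancelling [x i] in [A] makes [gm] a matrix of syzygies of [a], and cancelling it in [N] gives
   the relation of exponent [l]. *)
have step t l : ~ P t -> K (t * x i ^+ l.+1) -> exists t', ~ P t' /\ K (t' * x i ^+ l).
  move=> nt [w [Nw Uw]].
  pose y' := g (t * x i ^+ l) *: y.
  have Ny' : allmx N y' by apply: allmxZ.
  have Uzw : allmx (mspan (i |: S)) (z^g *m w).
    rewrite (_ : _ *m _ = g (x i) *: y' - (g (t * x i ^+ l.+1) *: y - z^g *m w)); last first.
      rewrite opprB addrC /y' scalerA -rmorphM (_ : x i * _ = t * x i ^+ l.+1) ?subrK //.
      by rewrite exprS; ring.
    apply: allmxB; first exact: mspan_submodule.
      by move=> u v; rewrite mxE; apply: mem_mspan.
    by move=> u v; apply/(mspan_setD1 _ iiS); exists 0, ((g (t * x i ^+ l.+1) *: y - z^g *m w) u v);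
       rewrite SD1 mulr0 add0r; split; [exact: (submodule0 sN) | exact: Uw | by []].
  have [t1 [m [b [v [nt1 Nv Uv Ib]]]]] :=
    flat_mod_system pP (span_ideal x _) (mspan_submodule _) flS Nw Uzw.
  have /choice [u hu] : forall j, exists u, N u /\ U ((g t1 *: w - b^g *m v) j 0 - g (x i) * u).
    move=> j; have /(mspan_setD1 _ iiS) [u [r [Nu hr ->]]] := Uv j 0.
    by rewrite SD1 in hr; exists u; split=> //; rewrite addrC addKr.
  have [um [Num Uum]] : exists um : 'cV_k, allmx N um /\
      allmx U (g t1 *: w - b^g *m v - g (x i) *: um).
    exists (\col_j u j); split.
      by move=> j l'; rewrite mxE; case: (hu j).
    move=> j l'; rewrite !ord1.
    rewrite (_ : (_ - _ : 'M_(_, _)) j 0 = (g t1 *: w - b^g *m v) j 0 - g (x i) * u j); last by rewrite !mxE.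
    by case: (hu j).
  have /choice [gam hgam] : forall jl : 'I_n * 'I_m, exists c, I ((z *m b) jl.1 jl.2 - x i * c).
    move=> [j l']; have /(span_setD1 _ _ iiS) [c [r [hr ->]]] := Ib j l'.
    by rewrite SD1 in hr; exists c; rewrite mulrC /= addrC addKr.
  have [gm Igm] : exists gm : 'M_(n, m), allmx I (z *m b - x i *: gm).
    exists (\matrix_(j, l') gam (j, l')) => j l'.
    rewrite (_ : (_ - _ : 'M_(_, _)) j l' = (z *m b) j l' - x i * gam (j, l')); last by rewrite !mxE.
    exact: (hgam (j, l')).
  have [t2 [nt2 Ut2]] : exists t2, ~ P t2 /\
      allmx U (g t2 *: (g t1 *: y' - gm^g *m v - z^g *m um)).
    set e := g t1 *: y' - _ - _.
    have Ne : allmx N e.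
      by apply: allmxB => //; [apply: allmxB => //; [apply: allmxZ | apply: allmxM] | apply: allmxM].
    have Ue : allmx U (g (x i) *: e).
      have -> : g (x i) *: e = g t1 *: (g (t * x i ^+ l.+1) *: y - z^g *m w)
           + z^g *m (g t1 *: w - b^g *m v - g (x i) *: um) + (z *m b - x i *: gm)^g *m v.
        have tele (V : zmodType) (c1 c2 c3 c4 c5 : V) : c1 - c5 - c4 = (c1 - c2) + (c2 - c3 - c4) + (c3 - c5).
          by rewrite !addrA subrK (addrAC _ (- c4)) subrK addrAC.
        rewrite /e /y' map_mxB map_mxZ map_mxM mulmxBl !mulmxBr !scalerBr !scalerA -!rmorphM.
        rewrite -!scalemxAr -!scalemxAl !mulmxA exprS.
        rewrite (_ : t1 * (t * (x i * x i ^+ l)) = x i * (t1 * (t * x i ^+ l))); last by ring.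
        by rewrite mulrA; apply: tele.
      apply: allmxD => //; last by apply: allmx_mspan_scale.
      by apply: allmxD => //; [apply: allmxZ | apply: allmxM].
    have /choice [s hs] : forall j, exists s, ~ P s /\ U (g s * e j 0).
      by move=> j; apply: regN => //; have := Ue j 0; rewrite mxE.
    exists (\prod_j s j); split; first by apply: primeN_prod => // j; case: (hs j).
    move=> j l'; rewrite !ord1 mxE (bigD1 j) //= rmorphM -mulrA mulrCA; apply: submoduleZ => //.
    by case: (hs j).
  have [t3 [nt3 It3]] : exists t3, ~ P t3 /\ allmx I (a *m (t3 *: gm)).
    have h j : sat P I ((a *m gm) 0 j).
      apply: regA; apply: sub_sat => //.
      have -> : x i * (a *m gm) 0 j = (a *m (z *m b)) 0 j - (a *m (z *m b - x i *: gm)) 0 j.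
        rewrite mulmxBr -scalemxAr; move: (a *m _) (a *m _) => M1 M2.
        by rewrite !mxE opprB addrC subrK.
      apply: idealB => //; first exact: Iz.
      rewrite mxE; apply: ideal_sum => // j' _; apply: ideal_mull => //; exact: Igm.
    have [t3 [nt3 ht3]] := sat_common pP iI h.
    by exists t3; split=> // j l'; rewrite !ord1 -scalemxAr mxE.
  have [c gmE] := hz _ _ It3.
  exists (t3 * t2 * t1 * t); split; first by do 3?[apply: primeNM => //].
  exists (g t2 *: (c^g *m v) + g (t3 * t2) *: um); split.
    by apply: allmxD => //; apply: allmxZ => //; apply: allmxM.
  rewrite (_ : _ - _ = g t3 *: (g t2 *: (g t1 *: y' - gm^g *m v - z^g *m um))); first exact: allmxZ.
  rewrite mulmxDr -!scalemxAr mulmxA -map_mxM -gmE map_mxZ -scalemxAl /y' !scalerBr !scalerA -!rmorphM.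
  rewrite opprD addrA; congr (g _ *: _ - g _ *: _ - _); ring.
have {}Kk : forall l t, ~ P t -> K (t * x i ^+ l) -> exists t', ~ P t' /\ K t'.
  elim=> [|l IH] t nt; first by rewrite expr0 mulr1 => ?; exists t.
  by move=> /(step _ _ nt) [t' [nt' /(IH _ nt')]].
have [t [nt [w [Nw Uw]]]] := Kk _ _ nc0 Kc0.
exists t, k, z, w; split=> //.
by rewrite -[z]mulmx1; apply: Iz.
Qed.

(** Descending induction on [S], from the full system, modulo which A_P is a field, to the empty
    one. *)
Lemma flat_criterion P : noetherian A -> prime_ideal P -> regular_system P x ->
  (forall P', prime_ideal P' -> P' `<` P -> flat_at P' N) ->
  (forall (S : {set 'I_d}) i y, i \notin S -> N y -> mspan S (g (x i) * y) ->
     exists t, ~ P t /\ mspan S (g t * y)) ->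
  flat_at P N.
Proof.
move=> noeth pP rs flP' regN.
have [xP genP pS nS] := rs.
have fl (S : {set 'I_d}) : flat_mod P N (span x S) (mspan S).
  have [k] := ubnP #|~: S|; elim: k S => // k IH S; rewrite ltnS => le.
  have [E|/set0Pn [i]] := eqVneq (~: S) (finset.set0).
    have -> : S = finset.setTfor _ by rewrite -[S]finset.setCK E finset.setC0.
    exact: flat_mod_full.
  rewrite inE => niS; apply: (@flat_mod_step _ _ i) => //.
  - apply: IH; apply: leq_trans le; apply: proper_card; apply/properP; split.
      by rewrite finset.setCS; apply: finset.subsetUr.
    by exists i; rewrite !inE ?eqxx.
  - move=> P' pP' P'P nP'x; apply: flat_mod_change; apply: flP' => //.
    by split=> // PP'; apply: nP'x; apply: PP'.
  - by move=> y; apply: regN.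
  - by move=> c /(primeM (pS S)) [/(nS _ _ niS)|].
rewrite /flat_at.
have -> : ([set 0] : set A) = span x finset.set0.
  by apply/seteqP; split=> [_ ->|_ [c ->]]; rewrite ?big_set0 //; exists (fun=> 0); rewrite big_set0.
have := fl finset.set0.
congr (flat_mod _ _ _ _); apply/seteqP; split=> [_ [c [_ ->]]|_ ->].
  by rewrite big_set0.
by exists (fun=> 0); rewrite big_set0; split=> // _; apply: submodule0.
Qed.

End OneSystem.
End Flatness.

(** * Flatness at all primes, and its effect on colons and intersections *)

Section GlobalFlatness.
Variables (A B : comPzRingType) (g : {rmorphism A -> B}) (N : set B).
Hypotheses (noeth : noetherian A) (sN : submodule g N).
Implicit Types (P I J : set A).

Local Notation "a ^g" := (map_mx g a) (at level 2, format "a ^g").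

(** Induction on the height of [P]. Flatness at the smaller primes is handed to the hypothesis on
    [N] as well, because the regularity of parameters on an integral closure is proved from it. *)
Lemma flat_at_all : regular_ring A ->
  (forall P d (x : 'I_d -> A), prime_ideal P -> regular_system P x ->
    (forall P', prime_ideal P' -> P' `<` P -> flat_at g P' N) ->
    forall (S : {set 'I_d}) i y, i \notin S -> N y -> mspan g N x S (g (x i) * y) ->
      exists t, ~ P t /\ mspan g N x S (g t * y)) ->
  forall P, prime_ideal P -> flat_at g P N.
Proof.
move=> regA hN.
have fl k : forall P, prime_ideal P ->
    (forall n Q, prime_chain n Q -> Q n = P -> (n < k)%N) -> flat_at g P N.
  elim: k => [P pP /(_ 0%N (fun=> P))|k IH P pP bound].
    by rewrite ltn0 => h; suff : false by []; apply: h.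
  have [d [x [rs _]]] := regular_system_exists noeth regA pP.
  have flP' P' : prime_ideal P' -> P' `<` P -> flat_at g P' N.
    move=> pP' P'P; apply: IH => // n Q cQ QE.
    have := bound n.+1 (fun i => if (i <= n)%N then Q i else P).
    rewrite ltnn ltnS; apply=> //; apply: prime_chain_rcons => //; by rewrite QE.
  by apply: (flat_criterion sN noeth pP rs) => // S i y; apply: hN.
move=> P pP; have [d [x [_ bound]]] := regular_system_exists noeth regA pP.
by apply: (fl d.+1).
Qed.

Definition flat := forall n (a : 'rV[A]_n) (y : 'cV[B]_n), allmx N y -> a^g *m y = 0 ->
  exists m (b : 'M[A]_(n, m)) (w : 'cV[B]_m), [/\ allmx N w, y = b^g *m w & a *m b = 0].

(** The multiples of [y] that have a solution define an ideal, sums being solved by juxtaposed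
    matrices, and this ideal lies in no prime. *)
Lemma flat_of_flat_at : (forall P, prime_ideal P -> flat_at g P N) -> flat.
Proof.
move=> fl n a y Ny ay0.
pose K : set A := [set c | exists m (b : 'M[A]_(n, m)) (w : 'cV[B]_m),
  [/\ allmx N w, g c *: y = b^g *m w & a *m b = 0]].
have iK : is_ideal K.
  split.
  - exists 0%N, 0, 0; split; [by case | | exact: mulmx0].
    by rewrite rmorph0 scale0r mulmx0.
  - move=> c c' [m [b [w [Nw e ab]]]] [m' [b' [w' [Nw' e' ab']]]].
    exists (m + m')%N, (row_mx b b'), (col_mx w w'); split; first exact: allmx_col.
      by rewrite map_row_mx mul_row_col -e -e' rmorphD scalerDl.
    by rewrite mul_mx_row ab ab' row_mx0.
  - move=> c c' [m [b [w [Nw e ab]]]]; exists m, b, (g c *: w); split=> //.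
      exact: allmxZ.
    by rewrite rmorphM -scalemxAr -e scalerA.
suff [m [b [w [Nw e ab]]]] : K 1 by exists m, b, w; rewrite -e rmorph1 scale1r.
apply: contrapT => nK1.
have [||x Kx x1|Q [pQ KQ _]] := @exists_prime_disjoint A [set 1] K.
- by split=> //= s t -> ->; rewrite mulr1.
- exact: iK.
- by apply: nK1; rewrite -[1]x1.
have [||t [m [b [w [nt Nw e ab]]]]] := fl Q pQ n a y.
- by [].
- by rewrite ay0 => i j; rewrite mxE.
apply: nt; apply: KQ; exists m, b, w; split=> //.
  by apply/eqP; rewrite -subr_eq0; apply/eqP/matrixP => i j; rewrite [RHS]mxE; apply: e.
by apply/matrixP => i j; rewrite [RHS]mxE; apply: ab.
Qed.

(* the submodule [I N] *)
Definition extN I : set B := [set y | exists n (c : 'I_n -> A) (v : 'I_n -> B),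
  [/\ forall i, I (c i), forall i, N (v i) & y = \sum_(i < n) g (c i) * v i]].

Lemma extN_mx I n (c : 'rV[A]_n) (v : 'cV[B]_n) : allmx I c -> allmx N v ->
  extN I ((c^g *m v) 0 0).
Proof.
move=> Ic Nv; exists n, (fun i => c 0 i), (fun i => v i 0); split=> //.
by rewrite mxE; apply: eq_bigr => i _; rewrite mxE.
Qed.

Lemma extN_mxP I y : extN I y ->
  exists n (c : 'rV[A]_n) (v : 'cV[B]_n), [/\ allmx I c, allmx N v & y%:M = c^g *m v].
Proof.
move=> [n [c [v [Ic Nv yE]]]]; exists n, (\row_i c i), (\col_i v i); split.
- by move=> i j; rewrite mxE.
- by move=> i j; rewrite mxE.
apply/matrixP => i j; rewrite !ord1 !mxE eqxx mulr1n yE.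
by apply: eq_bigr => k _; rewrite !mxE.
Qed.

(** Flatness is applied to the relation whose coefficients are [- s] and the coefficients of
    [g s * y]; the first row of the solution lies in the colon ideal. *)
Lemma extN_colon I s y : flat -> is_ideal I -> N y -> extN I (g s * y) ->
  extN [set c | I (c * s)] y.
Proof.
move=> fl iI Ny /extN_mxP [n [c [v [Ic Nv e]]]].
have [||m [b [w [Nw yE ab]]]] := fl _ (row_mx (- s%:M : 'M_1) c) (col_mx (y%:M : 'M_1) v).
- apply: allmx_col => // i j; rewrite mxE !ord1 eqxx; exact: Ny.
- rewrite map_row_mx mul_row_col -e map_mxN map_scalar_mx mulNmx -scalar_mxM.
  by rewrite addNr.
rewrite -[b]vsubmxK map_col_mx mul_col_mx in yE; case/eq_col_mx: yE => yE _.
have -> : y = ((usubmx b)^g *m w) 0 0 by rewrite -yE mxE eqxx.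
apply: extN_mx => // i j; rewrite !ord1 /=.
have : (s%:M *m usubmx b) 0 j = (c *m dsubmx b) 0 j.
  rewrite -[b]vsubmxK mul_row_col mulNmx in ab.
  by move/eqP: ab; rewrite addrC subr_eq0 => /eqP ->.
rewrite mul_scalar_mx mxE mulrC => ->; rewrite mxE; apply: ideal_sum => // k _.
by apply: ideal_mulr.
Qed.

(** The difference of the two expressions of [y] is a relation; its solution gives a row
    [c *m usubmx b] with entries in both ideals. *)
Lemma extN_capI I J y : flat -> is_ideal I -> is_ideal J -> extN I y -> extN J y ->
  extN (I `&` J) y.
Proof.
move=> fl iI iJ /extN_mxP [n [c [v [Ic Nv e]]]] /extN_mxP [n' [c' [v' [Ic' Nv' e']]]].
have [||m [b [w [Nw yE ab]]]] := fl _ (row_mx c (- c')) (col_mx v v').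
- exact: allmx_col.
- by rewrite map_row_mx mul_row_col map_mxN mulNmx -e -e' subrr.
rewrite -[b]vsubmxK map_col_mx mul_col_mx in yE; case/eq_col_mx: yE => yE _.
have E : c *m usubmx b = c' *m dsubmx b.
  rewrite -[b]vsubmxK mul_row_col mulNmx in ab.
  by move/eqP: ab; rewrite subr_eq0 => /eqP ->.
have -> : y = ((c *m usubmx b)^g *m w) 0 0.
  by rewrite map_mxM -mulmxA -yE -e mxE eqxx.
apply: extN_mx => // i j; split.
  by rewrite mxE; apply: ideal_sum => // k _; apply: ideal_mulr.
by rewrite E mxE; apply: ideal_sum => // k _; apply: ideal_mulr.
Qed.

End GlobalFlatness.

(** * Frobenius powers and the flatness of Frobenius *)

Section FrobeniusPowers.
Variables (p : nat) (A : comNzRingType).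
Hypothesis charA : p \in [pchar A].
Implicit Types (I J : set A).

Let p_pr : prime p := pcharf_prime charA.
Let p_gt0 : (0 < p)%N := prime_gt0 p_pr.

Lemma expr_pD n (x y : A) : (x + y) ^+ (p ^ n)%N = x ^+ (p ^ n)%N + y ^+ (p ^ n)%N.
Proof.
apply: exprDn_pchar; rewrite pnatX (eq_pnat _ (pcharf_eq charA)) pnat_id //.
Qed.
Lemma expr_p_sum n (T : Type) (r : seq T) (F : T -> A) :
  (\sum_(i <- r) F i) ^+ (p ^ n)%N = \sum_(i <- r) F i ^+ (p ^ n)%N.
Proof.
elim: r => [|i r IH]; last by rewrite !big_cons expr_pD IH.
by rewrite !big_nil expr0n expn_eq0 (gtn_eqF p_gt0).
Qed.

Lemma frobenius_power_ideal n I : is_ideal (frobenius_power p n I).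
Proof. exact: ideal_gen_ideal. Qed.

Lemma mem_frobenius_power n I x : I x -> frobenius_power p n I (x ^+ (p ^ n)%N).
Proof. by move=> Ix; apply: sub_ideal_gen; exists x. Qed.

Lemma frobenius_powerS n I J : I `<=` J -> frobenius_power p n I `<=` frobenius_power p n J.
Proof. by move=> IJ; apply: ideal_genS => _ [x /IJ Jx <-]; exists x. Qed.

Lemma frobenius_power0 I : is_ideal I -> frobenius_power p 0 I = I.
Proof.
move=> iI; apply/seteqP; split=> [|x Ix]; last by rewrite -[x]expr1 -(expn0 p); apply: sub_ideal_gen; exists x.
by apply: ideal_gen_min => // _ [x Ix <-].
Qed.

Lemma frobenius_power_sub n I : is_ideal I -> frobenius_power p n I `<=` I.
Proof.
move=> iI; apply: ideal_gen_min => // _ [x Ix <-].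
apply: (idealX (n := 1%N)) => //; by rewrite ?expr1 ?expn_gt0 ?p_gt0.
Qed.

Lemma frobenius_power_gen n (X : set A) :
  frobenius_power p n (ideal_gen X) = ideal_gen ((fun x => x ^+ (p ^ n)%N) @` X).
Proof.
apply/seteqP; split; last first.
  by apply: ideal_genS => _ [x Xx <-]; exists x => //; apply: sub_ideal_gen.
have iJ := ideal_gen_ideal ((fun x => x ^+ (p ^ n)%N) @` X).
apply: ideal_gen_min => // _ [_ /ideal_genP [k [c [x [Xx ->]]]] <-].
rewrite expr_p_sum; apply: ideal_sum (iJ) _ => i _; rewrite exprMn; apply: (ideal_mull _ iJ).
by apply: sub_ideal_gen; exists (x i).
Qed.

Lemma frobenius_powerD m n I :
  frobenius_power p n (frobenius_power p m I) = frobenius_power p (m + n) I.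
Proof.
rewrite {2}/frobenius_power frobenius_power_gen; congr ideal_gen.
apply/seteqP; split.
  by move=> _ [_ [x Ix <-] <-]; exists x; rewrite // -exprM -expnD.
by move=> _ [x Ix <-]; exists (x ^+ (p ^ m)%N); [exists x | rewrite -exprM -expnD].
Qed.

(** A Frobenius power is an extension along Frobenius, so [extN_colon] and [extN_capI] apply to
    it. *)
Lemma frobenius_power1E I : frobenius_power p 1 I = extN (pFrobenius_aut charA) setT I.
Proof.
apply/seteqP; split=> y.
  rewrite /frobenius_power => /ideal_genP [n [c [x [Xx ->]]]].
  have /choice [z hz] : forall i, exists z, I z /\ z ^+ p = x i.
    by move=> i; have [z Iz <-] := Xx i; exists z; rewrite expn1.
  exists n, z, c; split=> // [i|]; first by case: (hz i).
  by apply: eq_bigr => i _; case: (hz i) => _ <-; rewrite /= pFrobenius_autE mulrC.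
move=> [n [c [v [Ic _ ->]]]]; have iF := frobenius_power_ideal 1 I.
apply: ideal_sum (iF) _ => i _; apply: (ideal_mulr _ iF).
by rewrite /= pFrobenius_autE -[p in _ ^+ p]expn1; apply: mem_frobenius_power.
Qed.

(** Along Frobenius the parameters act through their [p]-th powers, which [sat_pspan_colonX] shows
    to be regular. The unit [t] found there acts as [t ^+ p], a multiple of [t]. *)
Lemma frobenius_flat : regular_ring A -> flat (pFrobenius_aut charA) setT.
Proof.
move=> regA; have noeth : noetherian A by case: regA.
have sN : submodule (pFrobenius_aut charA) setT by split.
apply: flat_of_flat_at => //; apply: flat_at_all => // P d x pP rs _ S i y iS _.
have E U : mspan (pFrobenius_aut charA) setT x U = pspan x (fun=> p) U.
  apply/seteqP; split=> z.
    by move=> [c [_ ->]]; exists c; apply: eq_bigr => j _; rewrite /= pFrobenius_autE mulrC.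
  move=> [c ->]; exists c; split=> //; apply: eq_bigr => j _.
  by rewrite /= pFrobenius_autE mulrC.
rewrite E /= pFrobenius_autE => h.
have [t [nt ht]] : sat P (pspan x (fun=> p) S) y.
  by apply: (sat_pspan_colonX pP rs (k := p) iS); apply: sub_sat.
exists t; split=> //; rewrite /= pFrobenius_autE.
rewrite (_ : t ^+ p = t ^+ p.-1 * t); last by rewrite -exprSr prednK.
by rewrite -mulrA; apply: (ideal_mull _ (pspan_ideal x _ S)).
Qed.

Hypothesis regA : regular_ring A.
Let noeth : noetherian A := regA.1.
Let sN : submodule (pFrobenius_aut charA) (setT : set A).
Proof. by split. Qed.

Lemma frobenius_power_colon n I s c : is_ideal I ->
  frobenius_power p n I (c * s ^+ (p ^ n)%N) -> frobenius_power p n (colon I s) c.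
Proof.
move=> iI; elim: n c s I iI => [|n IH] c s I iI.
  by rewrite !frobenius_power0 ?expn0 ?expr1 //; apply: colon_ideal.
rewrite -[n.+1]addn1 -!frobenius_powerD expnD expn1 exprM => h.
suff : frobenius_power p 1 (colon (frobenius_power p n I) (s ^+ (p ^ n)%N)) c.
  by apply: frobenius_powerS => x; apply: IH.
rewrite frobenius_power1E; apply: extN_colon => //; first exact: frobenius_flat.
  exact: frobenius_power_ideal.
by rewrite -frobenius_power1E /= pFrobenius_autE mulrC.
Qed.

Lemma frobenius_power_capI n I J : is_ideal I -> is_ideal J ->
  frobenius_power p n I `&` frobenius_power p n J = frobenius_power p n (I `&` J).
Proof.
move=> iI iJ; apply/seteqP; split; last first.
  by move=> x h; split; apply: frobenius_powerS h => y [].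
elim: n I J iI iJ => [|n IH] I J iI iJ x.
  by rewrite !frobenius_power0 //; apply: ideal_setI.
rewrite -[n.+1]addn1 -!frobenius_powerD => -[hI hJ].
suff : frobenius_power p 1 (frobenius_power p n I `&` frobenius_power p n J) x.
  by apply: frobenius_powerS; apply: IH.
rewrite frobenius_power1E; apply: extN_capI; rewrite -?frobenius_power1E //.
- exact: frobenius_flat.
- exact: frobenius_power_ideal.
- exact: frobenius_power_ideal.
Qed.

End FrobeniusPowers.

(** * Flatness of the absolute integral closure *)

Section PlusFlatLocal.
Variables (A : comNzRingType) (E : closedFieldType) (h : {rmorphism A -> E}) (P : set A).
Variables (d : nat) (x : 'I_d -> A).
Hypotheses (noeth : noetherian A) (pP : prime_ideal P) (rs : regular_system P x).
Hypotheses (hP : forall t, ~ P t -> h t != 0) (hx : forall i, h (x i) != 0).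

Local Notation "a ^h" := (map_mx h a) (at level 2, format "a ^h").

Definition integral_closure : set E := [set z | integralOver h z].
Local Notation N := integral_closure.

Lemma integral_closure_submodule : submodule h N.
Proof.
split; first exact: integral0.
  by move=> u v; apply: integral_add.
by move=> a u; apply: integral_mul; apply: integral_id.
Qed.
Let sN := integral_closure_submodule.

Lemma integral_sumr (T : Type) (r : seq T) (Pr : pred T) (F : T -> E) :
  (forall i, Pr i -> integralOver h (F i)) -> integralOver h (\sum_(i <- r | Pr i) F i).
Proof. by move=> hF; apply: (submodule_sum _ sN). Qed.

Lemma integralX z k : integralOver h z -> integralOver h (z ^+ k).
Proof.
move=> Nz; elim: k => [|k IH]; first by rewrite expr0; apply: integral1.
by rewrite exprS; apply: integral_mul.
Qed.

(* the localization at [P] of the integral closure *)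
Definition locN : set E := [set y | exists t, ~ P t /\ N (h t * y)].

Definition locspan (I : finType) (e : I -> E) : set E :=
  [set y | exists t (c : I -> A), ~ P t /\ h t * y = \sum_i h (c i) * e i].

(** Noetherian arguments fail in [locN] and are run in these submodules, which [fg_join] makes a
    directed family. *)
Definition fg (D : set E) := exists (I : finType) (e : I -> E), (forall i, N (e i)) /\ D = locspan e.

Definition local_submodule (D : set E) := submodule h D /\ forall t y, ~ P t -> D (h t * y) -> D y.

Lemma local_submodule_div D t y : local_submodule D -> ~ P t -> D y -> D (y / h t).
Proof. by move=> [_ sD] nt Dy; apply: (sD t) => //; rewrite mulrCA divff ?mulr1 // hP. Qed.

Lemma locspan_local (I : finType) (e : I -> E) : local_submodule (locspan e).
Proof.
split; first split.
- exists 1, (fun=> 0); split; first exact: prime1.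
  by rewrite mulr0 big1 // => i _; rewrite rmorph0 mul0r.
- move=> y z [t [c [nt ey]]] [s [c' [ns ez]]].
  exists (t * s), (fun i => s * c i + t * c' i); split; first exact: primeNM.
  transitivity (h s * (h t * y) + h t * (h s * z)); first by rewrite rmorphM; ring.
  rewrite ey ez !mulr_sumr -big_split /=; apply: eq_bigr => i _.
  by rewrite rmorphD !rmorphM; ring.
- move=> a y [t [c [nt ey]]]; exists t, (fun i => a * c i); split=> //.
  by rewrite mulrCA ey mulr_sumr; apply: eq_bigr => i _; rewrite rmorphM mulrA.
- move=> t y nt [s [c [ns ey]]]; exists (s * t), c; split; first exact: primeNM.
  by rewrite rmorphM -mulrA.
Qed.

Lemma fg_local D : fg D -> local_submodule D.
Proof. by move=> [I [e [_ ->]]]; apply: locspan_local. Qed.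

Lemma mem_locspan (I : finType) (e : I -> E) i : locspan e (e i).
Proof.
exists 1, (fun j => (j == i)%:R); split; first exact: prime1.
rewrite rmorph1 mul1r (bigD1 i) //= eqxx rmorph1 mul1r big1 ?addr0 // => j /negPf ->.
by rewrite rmorph0 mul0r.
Qed.

Lemma locspan_min (I : finType) (e : I -> E) D : local_submodule D -> (forall i, D (e i)) ->
  locspan e `<=` D.
Proof.
move=> [sD divD] De y [t [c [nt ey]]]; apply: (divD t) => //; rewrite ey.
by apply: (submodule_sum _ sD) => i _; apply: (submoduleZ _ sD).
Qed.

Lemma locN_local : local_submodule locN.
Proof.
split; first split.
- by exists 1; rewrite mulr0; split; [exact: prime1 | exact: (submodule0 sN)].
- move=> y z [t [nt Ny]] [s [ns Nz]]; exists (t * s); split; first exact: primeNM.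
  rewrite (_ : _ * _ = h s * (h t * y) + h t * (h s * z)); last by rewrite rmorphM; ring.
  by apply: (submoduleD sN); apply: (submoduleZ _ sN).
- by move=> a y [t [nt Ny]]; exists t; split=> //; rewrite mulrCA; apply: (submoduleZ _ sN).
- move=> t y nt [s [ns Ny]]; exists (s * t); split; first exact: primeNM.
  by rewrite rmorphM -mulrA.
Qed.

Lemma sub_locN y : N y -> locN y.
Proof. by move=> Ny; exists 1; rewrite rmorph1 mul1r; split=> //; apply: prime1. Qed.

Lemma fg_sub_locN D : fg D -> D `<=` locN.
Proof.
move=> [I [e [Ne ->]]]; apply: locspan_min; first exact: locN_local.
by move=> i; apply: sub_locN.
Qed.

Lemma fg_join2 D D' : fg D -> fg D' -> exists D2, [/\ fg D2, D `<=` D2 & D' `<=` D2].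
Proof.
move=> [I [e [Ne ->]]] [I' [e' [Ne' ->]]].
pose e2 (i : I + I') := match i with inl j => e j | inr j => e' j end.
exists (locspan e2); split.
- by exists (I + I')%type, e2; split=> // -[].
- apply: locspan_min; first exact: locspan_local.
  by move=> i; apply: (mem_locspan e2 (inl i)).
- apply: locspan_min; first exact: locspan_local.
  by move=> i; apply: (mem_locspan e2 (inr i)).
Qed.

Lemma fg_join (T : finType) (D : T -> set E) : (forall i, fg (D i)) ->
  exists D', fg D' /\ forall i, D i `<=` D'.
Proof.
move=> fD; suff [D' [fD' hD']] : exists D', fg D' /\ forall i, i \in enum T -> D i `<=` D'.
  by exists D'; split=> // i; apply: hD'; rewrite mem_enum.
elim: (enum T) => [|i r [D' [fD' hD']]].
  by exists (locspan (fun _ : unit => 0)); split=> //; exists unit, (fun=> 0); split=> // _; apply: (submodule0 sN).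
have [D2 [fD2 h1 h2]] := fg_join2 fD' (fD i); exists D2; split=> // j.
rewrite inE => /orP [/eqP -> //|/hD' h3]; exact: subset_trans h1.
Qed.

Lemma fg_mem (T : finType) (D : set E) (F : T -> E) : fg D -> (forall i, locN (F i)) ->
  exists D', [/\ fg D', D `<=` D' & forall i, D' (F i)].
Proof.
move=> fD /choice [t ht].
pose e i := h (t i) * F i.
have fe : fg (locspan e) by exists T, e; split=> // i; case: (ht i).
have [D2 [f2 DD2 eD2]] := fg_join2 fD fe.
exists D2; split=> // i; have [_ div2] := fg_local f2.
by apply: (div2 (t i)); [case: (ht i) | apply: eD2; apply: mem_locspan].
Qed.

Definition MS (D : set E) (e : 'I_d -> nat) := mspan h D (fun i => x i ^+ e i).

Lemma MS_sub D D' e S : D `<=` D' -> MS D e S `<=` MS D' e S.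
Proof. by move=> DD' _ [n [Nn ->]]; exists n; split=> // i; apply: DD'. Qed.

Lemma eq_MS D e e' (S : {set 'I_d}) : {in S, e =1 e'} -> MS D e S `<=` MS D e' S.
Proof.
by move=> ee _ [n [Nn ->]]; exists n; split=> //; apply: eq_bigr => i iS; rewrite ee.
Qed.

Lemma MS_submodule D e S : submodule h D -> submodule h (MS D e S).
Proof. by move=> sD; apply: (mspan_submodule (fun i => x i ^+ e i) sD S). Qed.

Lemma MS_div D e S t y : local_submodule D -> ~ P t -> MS D e S (h t * y) -> MS D e S y.
Proof.
move=> lD nt [n [Dn ey]]; exists (fun i => n i / h t); split.
  by move=> i; apply: local_submodule_div.
have t0 := hP nt; apply: (mulfI t0); rewrite ey mulr_sumr; apply: eq_bigr => i _.
by rewrite mulrCA [X in _ = _ * X]mulrCA divff // mulr1.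
Qed.

Lemma MS_min D e (S : {set 'I_d}) U : submodule h U ->
  (forall i n, i \in S -> D n -> U (h (x i ^+ e i) * n)) -> MS D e S `<=` U.
Proof. exact: mspan_min. Qed.

(** The generators are adjoined one at a time, the monic equation of [z] bounding the powers needed.
    A ring is wanted because [colon_uniform_all] takes Frobenius powers of elements without leaving
    a fixed finitely generated module. *)
Lemma fg_subring D : fg D -> exists D', [/\ fg D', D `<=` D', D' 1 &
  forall y z, D' y -> D' z -> D' (y * z)].
Proof.
have adjoin D0 z : fg D0 -> D0 1 -> (forall y w, D0 y -> D0 w -> D0 (y * w)) -> N z ->
    exists D', [/\ fg D', D0 `<=` D', D' z & forall y w, D' y -> D' w -> D' (y * w)].
  move=> fD0 D01 D0M Nz; have lD0 := fg_local fD0; have sD0 := lD0.1.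
  have [q mq rq] := Nz; set m := (size q).-1.
  have [I [e [Ne D0E]]] := fD0.
  pose V : set E := [set y | exists c : 'I_m -> E, (forall i, D0 (c i)) /\ y = \sum_i c i * z ^+ i].
  have sz : size q = m.+1 by rewrite /m prednK // lt0n size_poly_eq0 monic_neq0.
  have zm : z ^+ m = \sum_(i < m) - h (q`_i) * z ^+ i.
    move: rq; rewrite /root horner_coef size_map_poly_id0; last first.
      by rewrite (monicP mq) rmorph1 oner_neq0.
    rewrite sz big_ord_recr /= !coef_map /= -[q`_m]/(q`_(size q).-1) -lead_coefE (monicP mq).
    rewrite rmorph1 mul1r addrC addr_eq0 => /eqP ->; rewrite -sumrN; apply: eq_bigr => i _.
    by rewrite coef_map mulNr.
  have VD y w : V y -> V w -> V (y + w).
    move=> [c [Dc ->]] [c' [Dc' ->]]; exists (fun i => c i + c' i); split.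
      by move=> i; apply: (submoduleD sD0).
    by rewrite -big_split; apply: eq_bigr => i _; rewrite mulrDl.
  have V0 : V 0.
    by exists (fun=> 0); split; [move=> _; exact: (submodule0 sD0) | rewrite big1 // => i _; rewrite mul0r].
  have Vsum (T : finType) (F : T -> E) : (forall i, V (F i)) -> V (\sum_i F i).
    by move=> VF; elim/big_ind: _.
  have VM y w : D0 y -> V w -> V (y * w).
    move=> Dy [c [Dc ->]]; exists (fun i => y * c i); split; first by move=> i; apply: D0M.
    by rewrite mulr_sumr; apply: eq_bigr => i _; rewrite mulrA.
  have Vzi i y : (i < m)%N -> D0 y -> V (y * z ^+ i).
    move=> im Dy; exists (fun j => if j == Ordinal im then y else 0); split.
      by move=> j; case: ifP => // _; exact: (submodule0 sD0).
    rewrite (bigD1 (Ordinal im)) //= eqxx big1 ?addr0 // => j /negPf ->.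
    by rewrite mul0r.
  have Vz w : V w -> V (z * w).
    move=> [c [Dc ->]]; rewrite mulr_sumr; apply: (Vsum) => i.
    rewrite mulrCA -exprS; have := ltn_ord i; rewrite leq_eqVlt => /orP [/eqP ->|im]; last exact: Vzi.
    rewrite zm mulr_sumr; apply: (Vsum) => j; rewrite mulrA; apply: Vzi => //.
    by rewrite -rmorphN mulrC; apply: (submoduleZ _ sD0).
  have Vzn n w : V w -> V (z ^+ n * w).
    by elim: n => [|n IH] Vw; rewrite ?mul1r // exprS -mulrA; apply: Vz; apply: IH.
  have VV y w : V y -> V w -> V (y * w).
    move=> [c [Dc ->]] Vw; rewrite mulr_suml; apply: Vsum => i; rewrite -mulrA.
    by apply: VM => //; apply: Vzn.
  have D0m : (0 < m)%N -> D0 `<=` V.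
    by move=> m0 y Dy; rewrite -[y]mulr1 -(expr0 z); apply: Vzi.
  have [m0|m0] := posnP m.
    have /eqP : (1 : E) = 0 by move: zm; rewrite m0 big_ord0 expr0.
    by rewrite oner_eq0.
  pose e2 (ij : I * 'I_m) := e ij.1 * z ^+ ij.2.
  have VE : V = locspan e2.
    apply/seteqP; split.
      move=> _ [c [Dc ->]]; apply: (submodule_sum _ (locspan_local e2).1) => i _.
      have := Dc i; rewrite D0E => -[t [f [nt ec]]].
      have [_ div2] := locspan_local e2; apply: (div2 t) => //; rewrite mulrA ec mulr_suml.
      apply: (submodule_sum _ (locspan_local e2).1) => j _; rewrite -mulrA.
      by apply: (submoduleZ _ (locspan_local e2).1); apply: (mem_locspan e2 (j, i)).
    apply: locspan_min => [|[i j]]; last first.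
      by apply: Vzi => //; rewrite D0E; apply: mem_locspan.
    split; first by split=> // a y; apply: VM; rewrite -[h a]mulr1; apply: (submoduleZ _ sD0).
    move=> t y nt [c [Dc ey]]; exists (fun i => c i / h t); split.
      by move=> i; apply: local_submodule_div.
    apply: (mulfI (hP nt)); rewrite ey mulr_sumr; apply: eq_bigr => i _.
    by rewrite mulrA mulrCA divff ?mulr1 // hP.
  exists V; split=> //.
  - exists (I * 'I_m)%type, e2; split=> // -[i j].
    by apply: integral_mul; [apply: Ne | apply: integralX].
  - exact: D0m.
  - by rewrite -[z]mulr1; apply: Vz; apply: D0m.
move=> [I [e [Ne ->]]].
suff [D' [fD' D'1 D'e D'M]] : exists D', [/\ fg D', D' 1, forall i, i \in enum I -> D' (e i) &
    forall y z, D' y -> D' z -> D' (y * z)].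
  exists D'; split=> //; apply: locspan_min => [|i]; first exact: fg_local.
  by apply: D'e; rewrite mem_enum.
elim: (enum I) => [|i r [D' [fD' D'1 D'e D'M]]].
  exists (locspan (fun _ : unit => 1)); split=> //; first by exists unit, (fun=> 1); split=> // _; apply: integral1.
    exact: (mem_locspan (fun _ : unit => 1) tt).
  move=> y z [t [c [nt ey]]] [s [f [ns ez]]]; exists (t * s), (fun u => c u * f u); split.
    exact: primeNM.
  have u1 (F : unit -> E) : \sum_i F i = F tt by rewrite (bigD1 tt) //= big1 ?addr0 // => -[].
  rewrite u1 mulr1 in ey; rewrite u1 mulr1 in ez; rewrite u1 mulr1 rmorphM mulrACA ey ez.
  by rewrite rmorphM.
have [D2 [fD2 DD2 D2z D2M]] := adjoin D' (e i) fD' D'1 D'M (Ne i).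
exists D2; split=> //; first exact: DD2.
by move=> j; rewrite inE => /orP [/eqP ->|/D'e /DD2].
Qed.

Hypothesis flP' : forall P', prime_ideal P' -> P' `<` P -> flat_at h P' N.

(* As [N] is flat at the primes below [P], multiplication by [x_i ^+ k] on a finitely generated
   submodule factors through a free module. *)
Lemma factor_free n (e : 'cV[E]_n) : allmx N e -> exists k, forall i, exists t m (b : 'M[A]_(n, m)) (w : 'cV[E]_m),
  [/\ ~ P t, allmx N w, h (t * x i ^+ k) *: e = b^h *m w &
      forall c : 'rV[A]_n, c^h *m e = 0 -> c *m b = 0].
Proof.
move=> Ne.
(* The columns of [z] generate all relations among the entries of [e], so a matrix killed by [r] is
   killed by every relation. *)
have [|||l [z [Rz hz]]] := @noetherian_submodule A n [set c : 'cV_n | (c^T)^h *m e = 0] noeth.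
- by rewrite /= trmx0 map_mx0 mul0mx.
- by move=> u v /= hu hv; rewrite linearD map_mxD mulmxDl hu hv addr0.
- by move=> a u /= hu; rewrite linearZ /= map_mxZ -scalemxAl hu scaler0.
pose r := z^T.
have re : r^h *m e = 0.
  apply/row_matrixP => i; rewrite row_mul -map_row row0.
  have := Rz (delta_mx i 0); rewrite /= -colE => <-; congr (_ *m _).
  by rewrite /r tr_col.
have hr (c : 'rV_n) : c^h *m e = 0 -> exists c', c = c' *m r.
  move=> ce; have [|c' hc'] := hz c^T; first by rewrite /= trmxK.
  by exists c'^T; rewrite -[c]trmxK hc' trmx_mul.
pose K : set A := [set s | exists m (b : 'M[A]_(n, m)) (w : 'cV[E]_m),
  [/\ allmx N w, h s *: e = b^h *m w & r *m b = 0]].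
have iK : is_ideal K.
  split.
  - exists 0%N, 0, 0; split; [by case | | exact: mulmx0].
    by rewrite rmorph0 scale0r mulmx0.
  - move=> c c' [m [b [w [Nw ew ab]]]] [m' [b' [w' [Nw' ew' ab']]]].
    exists (m + m')%N, (row_mx b b'), (col_mx w w'); split; first exact: allmx_col.
      by rewrite map_row_mx mul_row_col -ew -ew' rmorphD scalerDl.
    by rewrite mul_mx_row ab ab' row_mx0.
  - move=> c c' [m [b [w [Nw ew ab]]]]; exists m, b, (h c *: w); split=> //.
      exact: (allmxZ _ sN).
    by rewrite rmorphM -scalemxAr -ew scalerA.
have /choice [kt hkt] : forall i, exists kt : nat * A, ~ P kt.2 /\ K (kt.2 * x i ^+ kt.1).
  move=> i; apply: contrapT => no.
  have [|Q [pQ KQ QP nQx]] := exists_prime_notin (y := x i) pP iK.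
    by move=> t k nt Kt; apply: no; exists (k, t).
  have QP' : Q `<` P by split=> // PQ; apply: nQx; apply: PQ; case: rs.
  have s0 : submodule h [set 0].
    by split=> //= [u v -> ->|a u ->]; rewrite ?addr0 ?mulr0.
  have [|t [m [b [w [nt Nw ew rb]]]]] := flat_mod_system pQ (@ideal_zero A) s0 (flP' pQ QP') Ne (a := r).
    by rewrite re => i' j; rewrite mxE.
  apply: nt; apply: KQ; exists m, b, w; split=> //.
    by apply/eqP; rewrite -subr_eq0; apply/eqP/matrixP => i' j; rewrite [RHS]mxE; apply: ew.
  by apply/matrixP => i' j; rewrite [RHS]mxE; apply: rb.
(* The sum of the exponents serves all parameters at once. *)
exists (\sum_i (kt i).1)%N => i; have [nt Kt] := hkt i.
have [m [b [w [Nw ew rb]]]] : K ((kt i).2 * x i ^+ (\sum_i (kt i).1)%N).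
  by rewrite (bigD1 i) //= exprD mulrA; apply: ideal_mulr.
exists (kt i).2, m, b, w; split=> // c /hr [c' ->].
by rewrite -mulmxA rb mulmx0.
Qed.

Lemma fg_ord D : fg D -> exists n (e : 'cV[E]_n), allmx N e /\
  forall y, D y <-> exists t (c : 'rV[A]_n), ~ P t /\ (h t * y)%:M = c^h *m e.
Proof.
move=> [I [e [Ne ->]]]; exists #|I|, (\col_i e (enum_val i)).
split; first by move=> i j; rewrite mxE.
move=> y; split=> [[t [c [nt ey]]]|[t [c [nt ey]]]].
  exists t, (\row_i c (enum_val i)); split=> //; apply/matrixP => i j.
  rewrite !ord1 !mxE eqxx mulr1n ey (reindex_onto enum_val enum_rank) /=; last first.
    by move=> k _; rewrite enum_rankK.
  by apply: eq_big => [k|k _]; rewrite ?enum_valK ?eqxx // !mxE.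
exists t, (fun i => c 0 (enum_rank i)); split=> //.
move/matrixP: ey => /(_ 0 0); rewrite !mxE eqxx mulr1n => ->.
rewrite (reindex_onto enum_rank enum_val) /=; last by move=> k _; rewrite enum_valK.
by apply: eq_big => [k|k _]; rewrite ?enum_rankK ?eqxx // !mxE enum_rankK.
Qed.

(** The factorization through a free module turns the relation for [y] into relations between rows
    over [A], where powers of parameters are regular. There [x j ^+ m] can be cancelled, and what
    remains is the factor [x i ^+ k], with [k] depending on [D] alone. *)
Lemma bounded_annihilation D : fg D -> exists k D', [/\ fg D', D `<=` D' &
  forall (S : {set 'I_d}) j e m y, j \notin S -> D y -> MS D e S (h (x j ^+ m) * y) ->
    forall i, MS D' e S (h (x i ^+ k) * y)].
Proof.
move=> fD; have [n [ev [Nev DE]]] := fg_ord fD.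
have [k hk] := factor_free Nev; exists k.
pose pk := (A * {m : nat & ('M[A]_(n, m) * 'cV[E]_m)%type})%type.
have /choice [q hq] : forall i, exists q : pk, [/\ ~ P q.1, allmx N (tagged q.2).2,
    h (q.1 * x i ^+ k) *: ev = (tagged q.2).1^h *m (tagged q.2).2 &
    forall c : 'rV[A]_n, c^h *m ev = 0 -> c *m (tagged q.2).1 = 0].
  move=> i; have [t [m [b [w [nt Nw ew cb]]]]] := hk i.
  by exists (t, existT _ m (b, w)).
have [D1 [fD1 hD1]] := @fg_join 'I_d (fun i => locspan (fun j => (tagged (q i).2).2 j 0))
  (fun i => ex_intro _ _ (ex_intro _ _ (conj (fun j => let: And4 _ Nw _ _ := hq i in Nw j 0) erefl))).
have [D2 [fD2 D12 DD2]] := fg_join2 fD1 fD.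
exists D2; split=> // S j e m y jS Dy [f [Df ey]] i.
have lD2 := fg_local fD2.
have [nT Nw ew cb] := hq i.
set b := (tagged (q i).2).1 in ew cb; set w := (tagged (q i).2).2 in Nw ew cb.
have Dw l : D2 (w l 0) by apply: D12; apply: (hD1 i); apply: (mem_locspan (fun j => w j 0)).
have [t [c [nt yE]]] := (DE y).1 Dy.
have /choice [s hs] : forall l, exists s : A * 'rV[A]_n, ~ P s.1 /\ (h s.1 * f l)%:M = s.2^h *m ev.
  by move=> l; have [u [c' [nu e']]] := (DE (f l)).1 (Df l); exists (u, c').
pose T := t * \prod_l (s l).1.
have nTT : ~ P T by apply: primeNM => //; apply: primeN_prod => // l; case: (hs l).
have [cy yE'] : exists cy : 'rV[A]_n, (h T * y)%:M = cy^h *m ev.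
  exists ((\prod_l (s l).1) *: c); rewrite map_mxZ -scalemxAl -yE /T rmorphM.
  by rewrite scale_scalar_mx; congr (_%:M); ring.
have /choice [cf fE] : forall l, exists cf : 'rV[A]_n, (h T * f l)%:M = cf^h *m ev.
  move=> l; have [_ e'] := hs l; exists ((t * \prod_(l' | l' != l) (s l').1) *: (s l).2).
  rewrite map_mxZ -scalemxAl -e' scale_scalar_mx /T (bigD1 l) //=; congr (_%:M).
  by rewrite !rmorphM; ring.
(* This is the given relation with denominators cleared. It vanishes on [ev], hence its product with
   [b] is zero. *)
pose rho := x j ^+ m *: cy - \sum_(l in S) x l ^+ e l *: cf l.
have rho0 : rho^h *m ev = 0.
  rewrite map_mxB map_mxZ mulmxBl -scalemxAl -yE' scale_scalar_mx.
  rewrite (_ : h (x j ^+ m) * (h T * y) = h T * \sum_(l in S) h (x l ^+ e l) * f l); last first.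
    by rewrite -ey; ring.
  rewrite raddf_sum /= mulmx_suml; apply/eqP; rewrite subr_eq0 mulr_sumr raddf_sum /=; apply/eqP.
  apply: eq_bigr => l _; rewrite map_mxZ -scalemxAl -fE scale_scalar_mx.
  by congr (_%:M); ring.
have E1 : x j ^+ m *: (cy *m b) = \sum_(l in S) x l ^+ e l *: (cf l *m b).
  have := cb _ rho0; rewrite mulmxBl -scalemxAl mulmx_suml => /eqP.
  by rewrite subr_eq0 => /eqP ->; apply: eq_bigr => l _; rewrite scalemxAl.
have sat_cy l : sat P (pspan x e S) ((cy *m b) 0 l).
  apply: (sat_pspan_colonX pP rs (k := m) jS); apply: sub_sat => //.
  exists (fun l' => (cf l' *m b) 0 l).
  have := congr1 (fun M : 'rV_ _ => M 0 l) E1; rewrite mxE summxE => ->.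
  by apply: eq_bigr => l' _; rewrite mxE mulrC.
have [u [nu hu]] := sat_common pP (pspan_ideal x e S) sat_cy.
have nUT : ~ P (u * (T * (q i).1)) by do 2?[apply: primeNM => //].
apply: (MS_div lD2 nUT).
have -> : h (u * (T * (q i).1)) * (h (x i ^+ k) * y) = \sum_l h (u * (cy *m b) 0 l) * w l 0.
  transitivity ((h u *: (h ((q i).1 * x i ^+ k) *: (h T * y)%:M) : 'M_1) 0 0).
    by rewrite !mxE eqxx mulr1n !rmorphM; ring.
  rewrite yE' scalemxAr ew mulmxA -map_mxM scalemxAl -map_mxZ mxE.
  by apply: eq_bigr => l _; rewrite !mxE.
apply: (submodule_sum _ (MS_submodule _ _ lD2.1)) => l _.
exact: (mspan_scale lD2.1 (hu l) (Dw l)).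
Qed.

(** The module [D'] is chosen before the exponents [e] and [m]: in the induction on [S] the
    exponents are unbounded while the modules must stay finitely generated. *)
Definition colon_uniform (S : {set 'I_d}) j := forall D, fg D ->
  exists D', [/\ fg D', D `<=` D' &
    forall e m y, D y -> MS D e S (h (x j ^+ m) * y) -> MS D' e S y].

Lemma MS_setD1 D e (S : {set 'I_d}) i y : i \in S ->
  MS D e S y <-> exists n r, [/\ D n, MS D e (S :\ i) r & y = h (x i ^+ e i) * n + r].
Proof. exact: mspan_setD1. Qed.

Lemma MS_setS D e (S S' : {set 'I_d}) : submodule h D -> (S \subset S')%bool -> MS D e S `<=` MS D e S'.
Proof.
move=> sD /fintype.subsetP SS'; apply: MS_min; first exact: MS_submodule.
by move=> i n iS Dn; apply: (mem_mspan (fun i => x i ^+ e i) sD (SS' i iS) Dn).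
Qed.

Definition upd (e : 'I_d -> nat) l k := fun i => if i == l then k else e i.

(** Subtracting the term [h (x l ^+ b) * n] from [y] leaves a colon relation modulo the other
    parameters. *)
Lemma colon_one (S : {set 'I_d}) l D : l \in S -> colon_uniform (S :\ l) l -> fg D ->
  exists D', [/\ fg D', D `<=` D' & forall e a b y, e l = (a + b)%N -> D y ->
    MS D e S (h (x l ^+ a) * y) -> MS D' (upd e l b) S y].
Proof.
move=> lS U fD; have [D' [fD' DD' hD']] := U D fD.
exists D'; split=> // e a b y el Dy /(MS_setD1 _ _ _ lS) [n [r [Dn hr ey]]].
have sD := (fg_local fD).1.
have Dv : D (y - h (x l ^+ b) * n) by apply: (submoduleB sD) => //; apply: (submoduleZ _ sD).
apply/(MS_setD1 _ _ _ lS); exists n, (y - h (x l ^+ b) * n).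
rewrite {2}/upd eqxx; split; [exact: DD' | | by rewrite addrC subrK].
apply: (@eq_MS _ e); first by move=> i; rewrite !inE /upd => /andP[/negPf ->].
apply: (hD' e a) => //; rewrite (_ : _ * _ = r) //.
by rewrite mulrBr ey el exprD rmorphM; ring.
Qed.

(** It undoes the raising of exponents to a common [M], one parameter of [T] at a time. *)
Lemma colon_list (S : {set 'I_d}) T : (forall l, l \in S -> colon_uniform (S :\ l) l) ->
  uniq T -> {subset T <= S} -> forall D, fg D ->
  exists D', [/\ fg D', D `<=` D' & forall e M y, (forall l, (e l <= M)%N) -> D y ->
    MS D (fun i => if i \in T then M else e i) S ((\prod_(l <- T) h (x l ^+ (M - e l))) * y) ->
    MS D' e S y].
Proof.
move=> U; elim: T => [|l T IH] /=.
  by move=> _ _ D fD; exists D; split=> // e M y _ _; rewrite big_nil mul1r.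
move=> /andP[lT uT] TS D fD.
have lS : l \in S by apply: TS; rewrite mem_head.
have [D1 [fD1 DD1 hD1]] := colon_one lS (U l lS) fD.
have [|D2 [fD2 D12 hD2]] := IH uT _ D1 fD1.
  by move=> i iT; apply: TS; rewrite inE iT orbT.
exists D2; split=> //; first exact: subset_trans D12.
move=> e M y eM Dy; rewrite big_cons -mulrA => hy; apply: (hD2 e M) => //; first exact: DD1.
set w := _ * y in hy *.
have Dw : D w.
  by rewrite /w -rmorph_prod; apply: (submoduleZ _ (fg_local fD).1).
have := hD1 _ (M - e l)%N (e l) w _ Dw hy; rewrite mem_head subnK // => /(_ erefl).
apply: eq_MS => i _; rewrite /upd inE; case: eqP => // ->.
by rewrite (negPf lT).
Qed.

Definition Xprod (T : seq 'I_d) m : E := \prod_(l <- T) h (x l ^+ m).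

Lemma Xprod_cons l T m : Xprod (l :: T) m = h (x l ^+ m) * Xprod T m.
Proof. by rewrite /Xprod big_cons. Qed.

Lemma MS_Xprod D (T : seq 'I_d) k M S v : (k <= M)%N -> submodule h D ->
  MS D (fun i => if i \in T then k else M) S v -> MS D (fun=> M) S (Xprod T (M - k) * v).
Proof.
move=> kM sD; have sM e S' := @MS_submodule D e S' sD.
move=> [n [Dn ->]]; rewrite mulr_sumr; apply: (submodule_sum _ (sM _ _)) => i iS.
case: ifP => iT; last first.
  rewrite mulrCA; apply: (mem_mspan (fun i => x i ^+ M) sD iS).
  by rewrite /Xprod -rmorph_prod; apply: (submoduleZ _ sD).
rewrite /Xprod (perm_big _ (perm_to_rem iT)) big_cons /= mulrA.
rewrite (_ : _ * _ * _ = h (x i ^+ M) * (\prod_(j <- rem i T) h (x j ^+ (M - k)) * n i)).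
  apply: (mem_mspan (fun i => x i ^+ M) sD iS).
  by rewrite -rmorph_prod; apply: (submoduleZ _ sD).
have -> : x i ^+ M = x i ^+ (M - k) * x i ^+ k by rewrite -exprD subnK.
by rewrite rmorphM; ring.
Qed.

(** For a regular sequence, what is killed by all [x l ^+ k] modulo the [M]-th powers is a multiple
    of the [(M - k)]-th power of the product of the parameters. The product is split off parameter
    by parameter, enlarging the module each time, and [z] ends in a module independent of [M]. *)
Lemma factor_steps (S : {set 'I_d}) k D0 T : (forall l, l \in S -> colon_uniform (S :\ l) l) ->
  fg D0 -> uniq T -> {subset T <= S} ->
  exists D', [/\ fg D', D0 `<=` D' & forall M y, (k <= M)%N -> D0 y ->
    (forall l, MS D0 (fun=> M) S (h (x l ^+ k) * y)) ->
    exists z, [/\ D' z, MS D' (fun=> M) S (y - Xprod T (M - k) * z) &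
      forall l, MS D' (fun i => if i \in T then k else M) S (h (x l ^+ k) * z)]].
Proof.
move=> U fD0; elim: T => [|l T IH] /=.
  move=> _ _; exists D0; split=> // M y kM Dy hy; exists y; split=> //.
  rewrite /Xprod big_nil mul1r subrr; apply: (submodule0 (g := h)).
  by apply: MS_submodule; exact: (fg_local fD0).1.
move=> /andP[lT uT] TS.
have lS : l \in S by apply: TS; rewrite mem_head.
have [|D1 [fD1 D01 hD1]] := IH uT.
  by move=> i iT; apply: TS; rewrite inE iT orbT.
have [D2 [fD2 D12 hD2]] := U l lS D1 fD1.
have [D3 [fD3 D23 hD3]] := colon_one lS (U l lS) fD2.
have s1 := (fg_local fD1).1; have s2 := (fg_local fD2).1; have s3 := (fg_local fD3).1.
exists D3; split=> //; first by move=> u /D01 /D12 /D23.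
move=> M y kM Dy hy; have [z [Dz Ez hz]] := hD1 M y kM Dy hy.
have := hz l; move/(MS_setD1 _ _ _ lS) => [w [r [Dw hr ez]]].
rewrite (negPf lT) in ez.
(* Regularity of [x l] puts [v] into the ideal of the other parameters, and [w] takes the place of
   [z]. *)
pose v := z - h (x l ^+ (M - k)) * w.
have D1v : D1 v by apply: (submoduleB s1) => //; apply: (submoduleZ _ s1).
have hv : MS D2 (fun i => if i \in T then k else M) (S :\ l) v.
  apply: (hD2 _ k) => //; rewrite (_ : _ * v = r) // /v mulrBr ez.
  have -> : x l ^+ M = x l ^+ (M - k) * x l ^+ k by rewrite -exprD subnK.
  by rewrite rmorphM; ring.
have {}hv := MS_setS s2 (subD1set S l) hv.
exists w; split; first by apply/D23/D12.
  rewrite (_ : _ - _ = (y - Xprod T (M - k) * z) + Xprod T (M - k) * v); last first.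
    by rewrite /v Xprod_cons; ring.
  apply: (submoduleD (MS_submodule _ _ s3)).
    by apply: MS_sub Ez; apply: subset_trans D23.
  by apply: MS_sub D23 _ _; apply: MS_Xprod.
move=> j; apply: (@eq_MS _ (upd (fun i => if i \in T then k else M) l k)).
  by move=> i iS; rewrite /upd inE; case: eqP.
apply: (hD3 _ (M - k)%N); first by rewrite (negPf lT) subnK.
  by apply: (submoduleZ _ s2); apply: D12.
rewrite (_ : _ * _ = h (x j ^+ k) * z - h (x j ^+ k) * v); last by rewrite /v; ring.
apply: (submoduleB (MS_submodule _ _ s2)).
  exact: MS_sub (hz j).
exact: (submoduleZ _ (MS_submodule _ _ s2)).
Qed.

(** The submodules spanned by the first [s] coefficient vectors become stationary. The coefficients
    [c i] have only the denominator of [z s], which lies outside [P]. *)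
Lemma fg_recurrence D (z : nat -> E) : fg D -> (forall s, D (z s)) ->
  exists s (c : 'I_s -> E), (forall i, locN (c i)) /\ z s = \sum_i c i * z i.
Proof.
move=> fD Dz; have [n [ev [_ DE]]] := fg_ord fD.
have /choice [t ht] : forall s, exists t : A * 'rV[A]_n, ~ P t.1 /\ (h t.1 * z s)%:M = t.2^h *m ev.
  by move=> s; have [u [c [nu e]]] := (DE _).1 (Dz s); exists (u, c).
pose inW s (c : 'cV[A]_n) := exists a : 'I_s -> A, c = \sum_i a i *: (t i).2^T.
have inWS s s' c : (s <= s')%N -> inW s c -> inW s' c.
  move=> /subnKC <- [a ->]; exists (fun i => match split i with inl j => a j | inr _ => 0 end).
  rewrite big_split_ord /= [X in _ = _ + X]big1 ?addr0 => [|i _].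
    by apply: eq_bigr => i _; rewrite (unsplitK (inl i)).
  by rewrite (unsplitK (inr i)) scale0r.
have inW0 s : inW s 0.
  by exists (fun=> 0); rewrite big1 // => i _; rewrite scale0r.
have inWD s c c' : inW s c -> inW s c' -> inW s (c + c').
  move=> [a ->] [b ->]; exists (fun i => a i + b i); rewrite -big_split.
  by apply: eq_bigr => i _; rewrite scalerDl.
have inWZ s a c : inW s c -> inW s (a *: c).
  move=> [b ->]; exists (fun i => a * b i); rewrite scaler_sumr.
  by apply: eq_bigr => i _; rewrite scalerA.
have [|||k [g [Wg hg]]] := @noetherian_submodule A n [set c | exists s, inW s c] noeth.
- by exists 0%N.
- move=> c c' [s hc] [s' hc']; exists (maxn s s').
  by apply: inWD; [apply: inWS hc; apply: leq_maxl | apply: inWS hc'; apply: leq_maxr].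
- by move=> a c [s hc]; exists s; apply: inWZ.
have /choice [sz hsz] : forall j : 'I_k, exists s, inW s (col j g).
  by move=> j; have := Wg (delta_mx j 0); rewrite -colE.
pose s := (\max_j sz j)%N.
have hcol j : inW s (col j g) by apply: inWS (hsz j); apply: leq_bigmax.
have [al hal] : exists al, (t s).2^T = g *m al.
  apply: hg; exists s.+1, (fun i => (i == ord_max)%:R).
  rewrite (bigD1 ord_max) //= eqxx scale1r big1 ?addr0 // => i /negPf ->.
  by rewrite scale0r.
have [a ea] : inW s (t s).2^T.
  rewrite hal (_ : g *m al = \sum_j al j 0 *: col j g).
    by elim/big_ind: _ => // [c c'|j _]; [apply: inWD | apply: inWZ].
  apply/colP => i; rewrite mxE summxE; apply: eq_bigr => j _.
  by rewrite !mxE mulrC.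
have [nts es] := ht s.
exists s, (fun i => h (a i * (t i).1) / h (t s).1); split.
  move=> i; exists (t s).1; split=> //; rewrite mulrCA divff ?hP // mulr1.
  exact: integral_id.
apply: (mulfI (hP nts)); have ez i : h (t i).1 * z i = ((t i).2^h *m ev) 0 0.
  by have [_ <-] := ht i; rewrite mxE eqxx.
rewrite ez -[(t s).2]trmxK ea mulr_sumr raddf_sum /= map_mx_sum mulmx_suml summxE.
apply: eq_bigr => i _; rewrite linearZ /= trmxK map_mxZ -scalemxAl mxE -ez.
by rewrite rmorphM mulrA [in RHS]mulrA mulrCA divff ?mulr1 ?hP // mulrA.
Qed.

Section SparsePolynomial.
Variables (Q s : nat) (c : 'I_s -> E) (q : 'I_s -> nat) (v : E).
Hypotheses (Q0 : (0 < Q)%N) (qQ : forall i, (q i < Q)%N).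

Definition sparse_poly : {poly E} := 'X^Q - (\sum_i c i *: 'X^(q i) + v%:P).

Lemma size_sparse_tail : (size (\sum_i c i *: 'X^(q i) + v%:P : {poly E})%R <= Q)%N.
Proof.
apply: leq_trans (size_polyD _ _) _; rewrite geq_max; apply/andP; split.
  apply: leq_trans (size_sum _ _ _) _; apply/bigmax_leqP => i _.
  by apply: leq_trans (size_scale_leq _ _) _; rewrite size_polyXn.
by apply: leq_trans (size_polyC_leq1 _) _.
Qed.

Lemma sparse_poly_monic : sparse_poly \is monic.
Proof.
rewrite monicE lead_coefDl ?lead_coefXn // size_polyXn size_polyN ltnS.
exact: size_sparse_tail.
Qed.

Lemma size_sparse_poly : size sparse_poly = Q.+1.
Proof. by rewrite size_polyDl ?size_polyXn // size_polyN ltnS size_sparse_tail. Qed.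

Lemma root_sparse_poly u : root sparse_poly u = (u ^+ Q == \sum_i c i * u ^+ q i + v).
Proof.
rewrite /root /sparse_poly hornerD hornerN hornerD hornerC hornerXn horner_sum subr_eq0; congr (_ == _ + _).
by apply: eq_bigr => i _; rewrite hornerZ hornerXn.
Qed.

Lemma sparse_solution : exists u, u ^+ Q = \sum_i c i * u ^+ q i + v.
Proof.
have /closed_rootP [u] : size sparse_poly != 1%N by rewrite size_sparse_poly eqSS -lt0n.
by rewrite root_sparse_poly => /eqP; exists u.
Qed.

Lemma integral_sparse u : (forall i, N (c i)) -> N v -> root sparse_poly u -> N u.
Proof.
move=> Nc Nv ru; apply: integral_root_monic sparse_poly_monic ru _.
move=> _ /(nthP 0) [l _ <-]; rewrite coefB coefXn coefD coefC.
apply: (submoduleB sN); first by case: eqP => _; [exact: integral1 | exact: integral0].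
apply: (submoduleD sN); last by case: eqP => _; [exact: Nv | exact: integral0].
rewrite coef_sum; apply: integral_sumr => i _; rewrite coefZ coefXn.
by case: eqP => _; rewrite ?mulr1 ?mulr0; [exact: Nc | exact: integral0].
Qed.
End SparsePolynomial.

(** Multiplying [u] by a common denominator [h T] multiplies the coefficients by [h T ^+ (Q - q i)],
    a positive power because [q i < Q], and so makes them integral. *)
Lemma integral_solution Q s (c : 'I_s -> E) (q : 'I_s -> nat) v u : (0 < Q)%N ->
  (forall i, (q i < Q)%N) -> (forall i, locN (c i)) -> locN v ->
  u ^+ Q = \sum_i c i * u ^+ q i + v -> locN u.
Proof.
move=> Q0 qQ /choice [t ht] [tv [ntv Nv]] uE.
pose T := tv * \prod_i t i.
have nT : ~ P T by apply: primeNM => //; apply: primeN_prod => // i; case: (ht i).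
have NT i : N (h T * c i).
  rewrite /T (bigD1 i) //= (_ : h _ * _ = h (tv * \prod_(j | j != i) t j) * (h (t i) * c i)).
    by apply: (submoduleZ _ sN); case: (ht i).
  by rewrite !rmorphM; ring.
have NTv : N (h T * v).
  by rewrite /T mulrC rmorphM mulrA -[v * _]mulrC mulrC; apply: (submoduleZ _ sN).
have hTN (n : nat) (z : E) : N (h T * z) -> (0 < n)%N -> N (h T ^+ n * z).
  by case: n => // n Nz _; rewrite exprSr -mulrA -rmorphXn; apply: (submoduleZ _ sN).
exists T; split=> //.
apply: (@integral_sparse Q s (fun i => h T ^+ (Q - q i) * c i) q (h T ^+ Q * v)) => //.
- by move=> i; apply: hTN => //; rewrite subn_gt0.
- exact: hTN.
rewrite root_sparse_poly exprMn uE mulrDr mulr_sumr; apply/eqP; congr (_ + _).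
apply: eq_bigr => i _; have -> : h T ^+ Q = h T ^+ (Q - q i) * h T ^+ q i.
  by rewrite -exprD subnK // ltnW.
by rewrite exprMn; ring.
Qed.

Variable p : nat.
Hypothesis charE : p \in [pchar E].
Let p_gt0 : (0 < p)%N := prime_gt0 (pcharf_prime charE).
Let p_gt1 : (1 < p)%N := prime_gt1 (pcharf_prime charE).

Lemma Xprod_neq0 T m : Xprod T m != 0.
Proof.
by rewrite prodf_seq_neq0; apply/allP => l _; rewrite rmorphXn expf_neq0.
Qed.

Lemma XprodX T m n : Xprod T m ^+ n = Xprod T (m * n).
Proof. by rewrite /Xprod -prodrXl; apply: eq_bigr => l _; rewrite -rmorphXn exprM. Qed.
Lemma XprodD T m n : Xprod T (m + n) = Xprod T m * Xprod T n.
Proof. by rewrite /Xprod -big_split; apply: eq_bigr => l _; rewrite exprD rmorphM. Qed.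

(* By noetherianity [y] satisfies, modulo [Q]-th powers, a monic additive equation; it can be solved
   exactly in the integrally closed ring [locN]. *)
Lemma equational (S : {set 'I_d}) D k M (y : E) (z : nat -> E) : S != finset.set0 -> fg D ->
  (k <= M)%N -> (forall s, D (z s)) ->
  (forall s, MS D (fun=> (M * p ^ s)%N) S (y ^+ (p ^ s) - Xprod (enum S) (M * p ^ s - k) * z s)) ->
  MS locN (fun=> M) S y.
Proof.
move=> S0 fD kM Dz hz.
have lN := locN_local; have slN := lN.1.
have [s [c [Nc zs]]] := fg_recurrence fD Dz.
set Q := (p ^ s)%N; have Q0 : (0 < Q)%N by rewrite expn_gt0 p_gt0.
pose q (j : 'I_s) := (p ^ j)%N.
have qQ j : (q j < Q)%N by rewrite ltn_exp2l // p_gt1.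
pose X := Xprod (enum S).
have MSN m e : MS D e S m -> MS locN e S m by apply: MS_sub; apply: fg_sub_locN.
(* The recurrence for [z] becomes an equation for [y]: the factor at [y ^+ q j] raises the exponents
   of all parameters from [M * q j] to [M * Q]. *)
pose C j := c j * X (M * (Q - q j))%N.
have [v [Nv yQ]] : MS locN (fun=> (M * Q)%N) S (y ^+ Q - \sum_j C j * y ^+ q j).
  rewrite (_ : _ - _ = (y ^+ Q - X (M * Q - k)%N * z s)
    - \sum_j C j * (y ^+ q j - X (M * q j - k)%N * z j)); last first.
    rewrite zs mulr_sumr.
    have -> : \sum_j C j * (y ^+ q j - X (M * q j - k)%N * z j) =
        \sum_j C j * y ^+ q j - \sum_j X (M * Q - k)%N * (c j * z j).
      rewrite -sumrB; apply: eq_bigr => j _; rewrite mulrBr; congr (_ - _).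
      rewrite /C (_ : (M * Q - k)%N = (M * (Q - q j) + (M * q j - k))%N); last first.
        have kq : (k <= M * q j)%N.
          by apply: leq_trans kM _; rewrite leq_pmulr // expn_gt0 p_gt0.
        by rewrite addnBA // -mulnDr subnK // ltnW.
      by rewrite /X XprodD; ring.
    by ring.
  apply: (submoduleB (MS_submodule _ _ slN)); first exact/MSN/hz.
  apply: (submodule_sum _ (MS_submodule _ _ slN)) => j _.
  have := MSN _ _ (hz j); rewrite -/(q j) -/X; set w := y ^+ q j - _.
  move=> [n [Nn ->]]; rewrite mulr_sumr; apply: (submodule_sum _ (MS_submodule _ _ slN)) => i iS.
  have iS' : i \in enum S by rewrite mem_enum.
  rewrite /C /X /Xprod (perm_big _ (perm_to_rem iS')) big_cons /=.
  rewrite (_ : _ * _ = h (x i ^+ (M * Q)) * (c j * \prod_(l <- rem i (enum S)) h (x l ^+ (M * (Q - q j))) * n i)).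
    apply: (mem_mspan _ slN) => //; rewrite -rmorph_prod -mulrA mulrCA; apply: (submoduleZ _ slN).
    have [tn [ntn Ntn]] := Nn i; have [tc [ntc Ntc]] := Nc j.
    exists (tc * tn); split; first exact: primeNM.
    rewrite (_ : _ * _ = (h tc * c j) * (h tn * n i)); last by rewrite rmorphM; ring.
    exact: integral_mul.
  have -> : x i ^+ (M * Q) = x i ^+ (M * (Q - q j)) * x i ^+ (M * q j).
    by rewrite -exprD -mulnDr subnK // ltnW.
  by rewrite rmorphM; ring.
pose u l := h (x l) ^+ M.
have u0 l : u l != 0 by rewrite expf_neq0.
pose U := X M.
have U0 : U != 0 by exact: Xprod_neq0.
have CE j : C j = c j * U ^+ (Q - q j) by rewrite /C /U /X XprodX.
have NC (l : 'I_d) (j : 'I_s) : l \in S -> locN (c j * (U / u l) ^+ (Q - q j)).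
  move=> lS; have lS' : l \in enum S by rewrite mem_enum.
  rewrite /U /X /Xprod (perm_big _ (perm_to_rem lS')) big_cons /= /u rmorphXn mulrC.
  rewrite [_ / _]mulrAC divff ?expf_neq0 // mul1r -rmorph_prod -rmorphXn.
  by apply: (submoduleZ _ slN).
(* The product [u l * tau l] solves the equation of [y] with the single inhomogeneous term
   [u l ^+ Q * v l]. After division by [u l ^+ Q] the coefficients are still in [locN], since [u l]
   divides [U]. *)
have /choice [tau htau] : forall l, exists tau, l \in S -> locN tau /\
    tau ^+ Q = \sum_j (c j * (U / u l) ^+ (Q - q j)) * tau ^+ q j + v l.
  move=> l; have [tau e] := sparse_solution (fun j => c j * (U / u l) ^+ (Q - q j)) (v l) Q0 qQ.
  exists tau => lS; split=> //; apply: (integral_solution Q0 qQ _ (Nv l) e) => j; exact: NC.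
(* All exponents are powers of [p], so the equation is additive and [w] solves the homogeneous one;
   [w / U] then solves it with the coefficients [c j], hence lies in [locN]. *)
pose w := y - \sum_(l in S) u l * tau l.
have expQ n : {morph (fun a : E => a ^+ (p ^ n)) : a b / a - b}.
  move=> a b /=; have := expr_pD charE n (a - b) b; rewrite subrK => ->.
  by rewrite addrK.
have expS n (f : 'I_d -> E) : (\sum_(l in S) f l) ^+ (p ^ n) = \sum_(l in S) f l ^+ (p ^ n).
  rewrite big_mkcond (expr_p_sum charE) [RHS]big_mkcond; apply: eq_bigr => l _; case: ifP => // _.
  by rewrite expr0n expn_eq0 (gtn_eqF p_gt0).
have wQ : w ^+ Q = \sum_j C j * w ^+ q j.
  rewrite /w /Q expQ expS -/Q.
  have -> : y ^+ Q = \sum_j C j * y ^+ q j + \sum_(l in S) u l ^+ Q * v l.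
    move/eqP: yQ; rewrite subr_eq => /eqP ->; rewrite addrC; congr (_ + _).
    apply: eq_bigr => l _.
    by rewrite /u rmorphXn -exprM.
  have -> : \sum_j C j * (y - \sum_(l in S) u l * tau l) ^+ q j =
     \sum_j C j * y ^+ q j - \sum_(l in S) \sum_j C j * (u l * tau l) ^+ q j.
    rewrite exchange_big /= -sumrB; apply: eq_bigr => j _.
    by rewrite /q expQ expS mulrBr mulr_sumr.
  rewrite -addrA; congr (_ + _); apply/eqP; rewrite -sumrB -sumrN; apply/eqP.
  apply: eq_bigr => l lS; rewrite exprMn; have [_ ->] := htau l lS.
  rewrite mulrDr opprD addrCA subrr addr0; congr (- _); rewrite mulr_sumr.
  apply: eq_bigr => j _; rewrite CE [(u l * tau l) ^+ _]exprMn expr_div_n.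
  have -> : u l ^+ Q = u l ^+ (Q - q j) * u l ^+ q j by rewrite -exprD subnK // ltnW.
  have uq : u l ^+ (Q - q j) != 0 by rewrite expf_neq0.
  by field.
have Nnu : locN (w / U).
  apply: (@integral_solution Q s c q 0 _ Q0 qQ Nc (submodule0 slN)).
  rewrite addr0 expr_div_n wQ mulr_suml; apply: eq_bigr => j _; rewrite CE expr_div_n.
  have -> : U ^+ Q = U ^+ (Q - q j) * U ^+ q j by rewrite -exprD subnK // ltnW.
  have U1 : U ^+ (Q - q j) != 0 by rewrite expf_neq0.
  have U2 : U ^+ q j != 0 by rewrite expf_neq0.
  by field; rewrite U1 U2.
have -> : y = \sum_(l in S) u l * tau l + U * (w / U).
  by rewrite mulrCA divff // mulr1 /w addrC subrK.
apply: (submoduleD (MS_submodule _ _ slN)).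
  exists (fun l => if l \in S then tau l else 0); split.
    by move=> l; case: ifP => [/htau [] //|_]; apply: (submodule0 slN).
  by apply: eq_bigr => l ->; rewrite /u rmorphXn.
have /finset.set0Pn [l lS] := S0; have lS' : l \in enum S by rewrite mem_enum.
rewrite {1}/U /X /Xprod (perm_big _ (perm_to_rem lS')) big_cons /= -mulrA.
apply: (mem_mspan (fun i => x i ^+ M) slN lS).
by rewrite -rmorph_prod; apply: (submoduleZ _ slN).
Qed.

Lemma fg_mem_local (T : finType) (F : T -> E) : (forall i, locN (F i)) ->
  exists D, fg D /\ forall i, D (F i).
Proof.
move=> NF; have f0 : fg (locspan (fun _ : unit => 0)).
  by exists unit, (fun=> 0); split=> // _; apply: (submodule0 sN).
by have [D [fD _ DF]] := fg_mem f0 NF; exists D.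
Qed.

(** Induction on the size of [S]. By [bounded_annihilation] and [factor_steps] a relation of any
    exponent [M] is described by some [z] in a module [D2] that does not depend on [M], and the [z]
    that occur form a finitely generated [W]. For a generator of [W], the Frobenius powers of its
    relation are relations again, so [equational] trivializes it and puts [z] into the module of the
    [k]-th powers. Then every [z] lies there. *)
Lemma colon_uniform_all (S : {set 'I_d}) j : j \notin S -> colon_uniform S j.
Proof.
have [n] := ubnP #|S|; elim: n S j => // n IH S j; rewrite ltnS => leS jS D0 fD0.
have [->|S0] := eqVneq S finset.set0.
  exists D0; split=> // e m y D0y [f [_]]; rewrite big_set0 => /eqP.
  rewrite mulf_eq0 rmorphXn expf_eq0 (negPf (hx j)) andbF /= => /eqP ->.
  exact: submodule0 (MS_submodule _ _ (fg_local fD0).1).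
have U l : l \in S -> colon_uniform (S :\ l) l.
  move=> lS; apply: IH; last by rewrite !inE eqxx.
  by apply: leq_trans leS; rewrite [X in (_ < X)%N](cardsD1 l) lS.
have [D [fD D0D D1 DM]] := fg_subring fD0.
have [k [Da [fDa DDa ann]]] := bounded_annihilation fD.
have uS : uniq (enum S) by exact: enum_uniq.
have sS : {subset enum S <= S} by move=> i; rewrite mem_enum.
have [D2 [fD2 Da2 steps]] := factor_steps k U fDa uS sS.
have lD := fg_local fD; have lD2 := fg_local fD2; have sD2 := lD2.1.
pose rel y M := [/\ (k <= M)%N, D y & MS D (fun=> M) S (h (x j ^+ M) * y)].
have relD y M : rel y M -> exists z, D2 z /\ MS D2 (fun=> M) S (y - Xprod (enum S) (M - k) * z).
  move=> [kM Dy hy]; have [|z [Dz hz _]] := steps M y kM (DDa _ Dy).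
    exact: ann jS Dy hy.
  by exists z.
have [n2 [ev [_ D2E]]] := fg_ord fD2.
pose W : set 'cV[A]_n2 := [set c | exists y M z, [/\ rel y M,
  MS D2 (fun=> M) S (y - Xprod (enum S) (M - k) * z) & z%:M = (c^T)^h *m ev]].
have raise e M' y (D' : set E) : submodule h D' -> (forall l, l \in S -> M' = (e l + (M' - e l))%N) ->
    MS D' e S y -> MS D' (fun=> M') S (\prod_(l <- enum S) h (x l ^+ (M' - e l)) * y).
  move=> sD' hM [f [Df ->]]; rewrite mulr_sumr.
  apply: (submodule_sum _ (MS_submodule _ _ sD')) => i iS.
  have iS' : i \in enum S by rewrite mem_enum.
  rewrite (perm_big _ (perm_to_rem iS')) big_cons /=.
  rewrite (_ : _ * _ = h (x i ^+ M') * (\prod_(l <- rem i (enum S)) h (x l ^+ (M' - e l)) * f i)).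
    apply: (mem_mspan (fun i => x i ^+ M') sD' iS).
    by rewrite -rmorph_prod; apply: (submoduleZ _ sD').
  have -> : x i ^+ M' = x i ^+ e i * x i ^+ (M' - e i) by rewrite -exprD -hM.
  by rewrite rmorphM; ring.
have raiseX M M' y (D' : set E) : submodule h D' -> (M <= M')%N ->
    MS D' (fun=> M) S y -> MS D' (fun=> M') S (Xprod (enum S) (M' - M) * y).
  by move=> sD' MM'; apply: raise => // l _; rewrite subnKC.
(* Raising the exponent leaves [z] unchanged; relations of different exponents can therefore be
   added, and [W] is a submodule. *)
have raise_rel y M M' z : (M <= M')%N -> rel y M -> MS D2 (fun=> M) S (y - Xprod (enum S) (M - k) * z) ->
    rel (Xprod (enum S) (M' - M) * y) M' /\
    MS D2 (fun=> M') S (Xprod (enum S) (M' - M) * y - Xprod (enum S) (M' - k) * z).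
  move=> MM' [kM Dy hy] hz; split; last first.
    have := raiseX _ _ _ _ sD2 MM' hz; rewrite mulrBr mulrA -XprodD.
    by rewrite addnBA // subnK.
  split; first exact: leq_trans MM'.
    by rewrite /Xprod -rmorph_prod; apply: (submoduleZ _ lD.1).
  have := raiseX _ _ _ _ lD.1 MM' hy.
  move/(submoduleZ (x j ^+ (M' - M)) (MS_submodule _ _ lD.1)).
  have -> : x j ^+ M' = x j ^+ (M' - M) * x j ^+ M by rewrite -exprD subnK.
  by congr (MS _ _ _ _); rewrite rmorphM; ring.
have [|||r [g [Wg hg]]] := @noetherian_submodule A n2 W noeth.
- exists 0, k, 0; rewrite trmx0 map_mx0 mul0mx mulr0 subrr; split.
  + split=> //; first exact: (submodule0 lD.1).
    by rewrite mulr0; apply: (submodule0 (MS_submodule _ _ lD.1)).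
  + exact: (submodule0 (MS_submodule _ _ sD2)).
  + by rewrite raddf0.
- move=> c c' [y [M [z [ry hz cz]]]] [y' [M' [z' [ry' hz' cz']]]].
  have [ry1 hz1] := raise_rel _ _ _ _ (leq_maxl M M') ry hz.
  have [ry2 hz2] := raise_rel _ _ _ _ (leq_maxr M M') ry' hz'.
  move: ry1 hz1 ry2 hz2; set m := maxn M M'; set y1 := _ * y; set y2 := _ * y' => ry1 hz1 ry2 hz2.
  exists (y1 + y2), m, (z + z'); split.
  + case: ry1 ry2 => km Dy1 hy1 [_ Dy2 hy2]; split=> //; first exact: (submoduleD lD.1).
    by rewrite mulrDr; apply: (submoduleD (MS_submodule _ _ lD.1)).
  + rewrite (_ : _ - _ = (y1 - Xprod (enum S) (m - k) * z) + (y2 - Xprod (enum S) (m - k) * z')); last by ring.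
    exact: (submoduleD (MS_submodule _ _ sD2)).
  + by rewrite raddfD /= cz cz' linearD /= map_mxD mulmxDl.
- move=> a c [y [M [z [[kM Dy hy] hz cz]]]]; exists (h a * y), M, (h a * z); split.
  + split=> //; first exact: (submoduleZ _ lD.1).
    by rewrite mulrCA; apply: (submoduleZ _ (MS_submodule _ _ lD.1)).
  + rewrite mulrCA -mulrBr; exact: (submoduleZ _ (MS_submodule _ _ sD2)).
  + by rewrite linearZ /= map_mxZ -scalemxAl -cz scale_scalar_mx.
have /choice [gen hgen] : forall a : 'I_r, exists q : E * nat * E,
    [/\ rel q.1.1 q.1.2, MS D2 (fun=> q.1.2) S (q.1.1 - Xprod (enum S) (q.1.2 - k) * q.2) &
       q.2%:M = ((col a g)^T)^h *m ev].
  move=> a; have [y [M [z hh]]] := Wg (delta_mx a 0); exists (y, M, z).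
  by rewrite /= colE.
have killed a : exists Da', [/\ fg Da', D2 `<=` Da' & MS Da' (fun=> k) S (gen a).2].
  have [[kM Dy hy] hz zE] := hgen a; set y := (gen a).1.1 in Dy hy hz; set M := (gen a).1.2 in kM hy hz.
  set z := (gen a).2 in hz zE *.
  have Dz : D2 z.
    apply/D2E; exists 1, (col a g)^T; split; first exact: prime1.
    by rewrite rmorph1 mul1r.
  have rel_pow s : rel (y ^+ (p ^ s)) (M * p ^ s)%N.
    have p0 : (0 < p ^ s)%N by rewrite expn_gt0 p_gt0.
    have DX w l : D w -> D (w ^+ l).
      by move=> Dw; elim: l => [|l IHl]; rewrite ?expr0 ?exprS //; apply: DM.
    split; [by apply: leq_trans kM _; rewrite leq_pmulr | exact: DX |].
    rewrite exprM rmorphXn -exprMn; case: hy => f [Df ->].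
    rewrite big_mkcond (expr_p_sum charE); apply: (submodule_sum _ (MS_submodule _ _ lD.1)) => i _.
    case: ifP => iS; last by rewrite expr0n (gtn_eqF p0); apply: (submodule0 (MS_submodule _ _ lD.1)).
    rewrite exprMn -rmorphXn -exprM.
    by apply: (mem_mspan (fun i => x i ^+ (M * p ^ s)) lD.1 iS); apply: DX.
  have /choice [zs hzs] := fun s => relD _ _ (rel_pow s).
  have hyN : MS locN (fun=> M) S y.
    by apply: (equational S0 fD2 kM (z := zs)) => s; case: (hzs s).
  have slN := locN_local.1.
  have : MS locN (fun=> M) S (Xprod (enum S) (M - k) * z).
    rewrite (_ : _ * z = y - (y - Xprod (enum S) (M - k) * z)); last by ring.
    apply: (submoduleB (MS_submodule _ _ slN)) => //; apply: MS_sub hz.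
    exact: fg_sub_locN.
  move=> [f [Nf ef]]; have [D3 [fD3 D23 D3f]] := fg_mem fD2 Nf.
  (* Cancelling the product of the [x l ^+ (M - k)] takes the membership of [z] from exponent [M]
     down to [k]. *)
  have [D4 [fD4 D34 hD4]] := colon_list U uS sS fD3.
  exists D4; split=> //; first exact: subset_trans D34.
  apply: (hD4 _ M) => //; first exact: D23.
  apply: (@eq_MS _ (fun=> M)); first by move=> i iS; rewrite mem_enum iS.
  by exists f; split.
have [D3' [fD3' hD3']] : exists D', fg D' /\ forall a : 'I_r, MS D' (fun=> k) S (gen a).2.
  move: killed => /choice [Dk hk].
  have [D' [fD' hD']] := fg_join (fun a => let: And3 f _ _ := hk a in f).
  by exists D'; split=> // a; apply: MS_sub (hD' a) _ _; case: (hk a).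
have [D3 [fD3 D33 D23]] := fg_join2 fD3' fD2.
have lD3 := fg_local fD3; have sD3 := lD3.1; have sM3 e := @MS_submodule D3 e S sD3.
have unif y M : rel y M -> MS D3 (fun=> M) S y.
  move=> ry; have [z [Dz hz]] := relD _ _ ry.
  have [t [c [nt cE]]] := (D2E z).1 Dz.
  have Wc : W c^T.
    case: ry => kM Dy hy; exists (h t * y), M, (h t * z); split.
    + split=> //; first exact: (submoduleZ _ lD.1).
      by rewrite mulrCA; apply: (submoduleZ _ (MS_submodule _ _ lD.1)).
    + by rewrite mulrCA -mulrBr; apply: (submoduleZ _ (MS_submodule _ _ sD2)).
    + by rewrite trmxK.
  have [al hal] := hg _ Wc.
  have tz : h t * z = \sum_a h (al a 0) * (gen a).2.
    transitivity (((h t * z)%:M : 'M[E]_1) 0 0); first by rewrite mxE eqxx mulr1n.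
    rewrite cE -[c]trmxK hal (_ : g *m al = \sum_a al a 0 *: col a g); last first.
      by apply/colP => i; rewrite mxE summxE; apply: eq_bigr => a _; rewrite !mxE mulrC.
    rewrite raddf_sum /= map_mx_sum mulmx_suml summxE; apply: eq_bigr => a _.
    by rewrite linearZ /= map_mxZ -scalemxAl; case: (hgen a) => _ _ <-; rewrite !mxE eqxx mulr1n.
  have kz : MS D3 (fun=> k) S z.
    apply: (MS_div lD3 nt); rewrite tz; apply: (submodule_sum _ (sM3 _)) => a _.
    by apply: (submoduleZ _ (sM3 _)); apply: MS_sub D33 _ _; apply: hD3'.
  rewrite -(subrK (Xprod (enum S) (M - k) * z) y); apply: (submoduleD (sM3 _)).
    exact: MS_sub hz.
  by case: ry => kM _ _; apply: raiseX.
have [D4 [fD4 D34 hD4]] := colon_list U uS sS fD3.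
exists D4; split=> //; first by move=> u /D0D /DDa /Da2 /D23 /D34.
move=> e m y D0y hy.
(* [M] bounds [k], [m] and every [e l], so the given relation can be raised to one of the form
   [rel]. *)
pose M := (k + m + \sum_l e l)%N.
have eM l : (e l <= M)%N.
  by rewrite /M (bigD1 l) //= addnCA leq_addr.
have Dy := D0D _ D0y.
apply: (hD4 e M) => //; first by apply/D23/Da2/DDa.
apply: (@eq_MS _ (fun=> M)); first by move=> i iS; rewrite mem_enum iS.
apply: unif; split.
- by rewrite /M -addnA leq_addr.
- by rewrite -rmorph_prod; apply: (submoduleZ _ lD.1).
have := raise e M _ D lD.1 (fun l _ => esym (subnKC (eM l))) (MS_sub D0D hy).
move/(submoduleZ (x j ^+ (M - m)) (MS_submodule _ _ lD.1)).
have -> : x j ^+ M = x j ^+ (M - m) * x j ^+ m.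
  by rewrite -exprD subnK // /M addnAC leq_addl.
by congr (MS _ _ _ _); rewrite rmorphM; ring.
Qed.

Lemma integral_closure_regular (S : {set 'I_d}) i y : i \notin S -> N y ->
  mspan h N x S (h (x i) * y) -> exists t, ~ P t /\ mspan h N x S (h t * y).
Proof.
move=> iS Ny [f [Nf ef]].
have [|D [fD DF]] := @fg_mem_local (option 'I_d) (fun o => if o is Some l then f l else y).
  by case=> [l|]; apply: sub_locN.
have [D' [fD' DD' hD']] := colon_uniform_all iS fD.
have [] := hD' (fun=> 1%N) 1%N y (DF None).
  by exists f; split=> [l|]; [exact: (DF (Some l)) | rewrite expr1 ef; apply: eq_bigr => l _; rewrite expr1].
move=> f' [Df' ey]; have /choice [t ht] : forall l, locN (f' l).
  by move=> l; apply: (fg_sub_locN fD').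
exists (\prod_l t l); split; first by apply: primeN_prod => // l; case: (ht l).
exists (fun l => h (\prod_l t l) * f' l); split.
  move=> l; rewrite (bigD1 l) //= rmorphM -mulrA mulrCA; apply: (submoduleZ _ sN).
  by case: (ht l).
by rewrite ey mulr_sumr; apply: eq_bigr => l _; rewrite expr1 mulrCA.
Qed.

End PlusFlatLocal.

(** At a prime that does not contain the kernel, some [t] outside it acts as zero. Otherwise the
    saturation of 0, a prime since A_P is a domain, lies in the kernel and equals it by minimality,
    so no parameter maps to zero. *)
Lemma integral_closure_flat (A : comNzRingType) (E : closedFieldType) (h : {rmorphism A -> E}) (p : nat) :
  p \in [pchar E] -> regular_ring A -> minimal_prime [set a | h a = 0] ->
  flat h (integral_closure h).
Proof.
move=> charE regA [pq minq]; have noeth : noetherian A by case: regA.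
have sN := integral_closure_submodule h.
apply: flat_of_flat_at => //; apply: flat_at_all => // P d x pP rs flP' S i y iS Ny hy.
have [qP|] := pselect (forall t, ~ P t -> h t != 0); last first.
  move=> /existsNP [t /not_implyP [nt /negP]]; rewrite negbK => /eqP ht.
  by exists t; split=> //; rewrite ht mul0r; apply: submodule0 (mspan_submodule _ sN _).
have [xP _ pS nS] := rs.
have qE : sat P (span x finset.set0) = [set a | h a = 0].
  apply: minq => // a [t [nt [c]]]; rewrite big_set0 => e.
  have /eqP := congr1 h e; rewrite rmorph0 rmorphM mulf_eq0 (negPf (qP _ nt)) /=.
  by move/eqP.
have hx l : h (x l) != 0.
  apply/eqP => hl; apply: (nS finset.set0 l); first by rewrite inE.
  by rewrite qE.
exact: (integral_closure_regular noeth pP rs qP hx flP' charE iS Ny hy).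
Qed.

(** * Quotient domains and algebraic closures *)

Module QuotientDomain.
Local Open Scope quotient_scope.
Section QuotientDomain.
Variables (R : comNzRingType) (P : set R) (pP : prime_ideal P).

Definition memb of prime_ideal P : R -> bool := fun x => `[< P x >].
Local Notation mem := (memb pP).

Lemma mem_idealr_closed : idealr_closed mem.
Proof.
have iP := prime_ideal_ideal pP; split.
- by apply/asboolP; apply: ideal0.
- by apply/asboolPn; apply: prime1.
- move=> a x y /asboolP Px /asboolP Py; apply/asboolP; apply: idealD => //; exact: ideal_mull.
Qed.
Definition ideal : idealr R := HB.pack mem (isIdealr.Build R mem mem_idealr_closed).

Definition quot := {ideal_quot ideal}.
HB.instance Definition _ := GRing.ComNzRing.on quot.

Definition pi : {rmorphism R -> quot} := \pi_quot.

Lemma pi_surj y : exists x, pi x = y.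
Proof. by exists (repr y); rewrite /pi /= reprK. Qed.

Lemma pi_eq0 x : pi x = 0 <-> P x.
Proof.
rewrite -(rmorph0 pi); split=> [/eqP|Px].
  by rewrite /pi /= -Quotient.idealrBE subr0 => /asboolP.
by apply/eqP; rewrite /pi /= -Quotient.idealrBE subr0; apply/asboolP.
Qed.

Definition qunit : {pred quot} := fun x => `[< exists y, y * x = 1 >].
Definition qinv (x : quot) : quot :=
  if pselect (exists y, y * x = 1) is left h then xget 0 [set y | y * x = 1] else x.

Lemma qmulVx : {in qunit, left_inverse 1 qinv *%R}.
Proof.
move=> x /asboolP [y yx]; rewrite /qinv; case: pselect => [_|]; last by case; exists y.
exact: (xgetPex 0 (ex_intro (fun z => z * x = 1) y yx)).
Qed.
Lemma qunitPl x y : y * x = 1 -> qunit x.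
Proof. by move=> yx; apply/asboolP; exists y. Qed.
Lemma qinv_out : {in [predC qunit], qinv =1 id}.
Proof. by move=> x /asboolPn nu; rewrite /qinv; case: pselect. Qed.

HB.instance Definition _ := GRing.ComNzRing_hasMulInverse.Build quot qmulVx qunitPl qinv_out.

Lemma quot_integral (x y : quot) : x * y = 0 -> (x == 0) || (y == 0).
Proof.
have [a <-] := pi_surj x; have [b <-] := pi_surj y.
rewrite -rmorphM => /pi_eq0 /(primeM pP) [] h; apply/orP; [left|right]; exact/eqP/pi_eq0.
Qed.
HB.instance Definition _ := GRing.ComUnitRing_isIntegral.Build quot quot_integral.
End QuotientDomain.
End QuotientDomain.
HB.export QuotientDomain.

Lemma quotient_domain_exists (R : comNzRingType) (P : set R) : prime_ideal P ->
  exists (D : idomainType) (pi : {rmorphism R -> D}), is_quotient P pi.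
Proof.
move=> pP; exists (QuotientDomain.quot pP), (QuotientDomain.pi pP); split.
  exact: QuotientDomain.pi_surj.
exact: QuotientDomain.pi_eq0.
Qed.

Lemma quotient_lift (R D T : comNzRingType) (P : set R) (pi : {rmorphism R -> D})
    (f : {rmorphism R -> T}) : is_quotient P pi -> (forall x, P x -> f x = 0) ->
  exists f' : {rmorphism D -> T}, forall x, f' (pi x) = f x.
Proof.
move=> [surj ker] fP; have /choice [s hs] := surj.
have fE x y : pi x = pi y -> f x = f y.
  move=> e; apply/eqP; rewrite -subr_eq0 -rmorphB; apply/eqP/fP/ker.
  by rewrite rmorphB e subrr.
pose F y := f (s y).
have FB : zmod_morphism F.
  by move=> x y; rewrite /F -rmorphB; apply: fE; rewrite rmorphB !hs.
have FM : monoid_morphism F.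
  split; first by rewrite /F -(rmorph1 f); apply: fE; rewrite hs rmorph1.
  by move=> x y; rewrite /F -rmorphM; apply: fE; rewrite rmorphM !hs.
pose F' : {rmorphism D -> T} := HB.pack F (GRing.isZmodMorphism.Build D T F FB)
  (GRing.isMonoidMorphism.Build D T F FM).
by exists F' => x; apply: fE; rewrite hs.
Qed.

Lemma fracP (D : idomainType) (x : {fraction D}) : exists n d : D, d != 0 /\ x = tofrac n / tofrac d.
Proof.
elim/quotW: x => x; exists \n_x, \d_x; have d0 := denom_ratioP x; split=> //.
have td : tofrac \d_x != 0 by rewrite tofrac_eq0.
apply: (mulIf td); rewrite divfK //.
rewrite -[_ * _]/(FracField.mul _ _); unlock tofrac.
rewrite -[LHS]FracField.pi_mul; apply/eqmodP.
by rewrite /= FracField.equivfE /FracField.mulf !numden_Ratio ?oner_neq0 ?mulr1 // mulrC.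
Qed.

Lemma subr_frac (F : fieldType) (a b c d : F) : b != 0 -> d != 0 ->
  a / b - c / d = (a * d - c * b) / (b * d).
Proof. by move=> b0 d0; field; rewrite b0 d0. Qed.

Lemma fraction_lift (D : idomainType) (E : fieldType) (u : {rmorphism D -> E}) : injective u ->
  exists U : {rmorphism {fraction D} -> E}, forall x, U (tofrac x) = u x.
Proof.
move=> inj; have u0 d : d != 0 -> u d != 0.
  by move=> d0; rewrite -(rmorph0 u) (inj_eq inj).
have /choice [nd hnd] : forall x : {fraction D}, exists nd : D * D, nd.2 != 0 /\ x = tofrac nd.1 / tofrac nd.2.
  by move=> x; have [n [d h]] := fracP x; exists (n, d).
pose F x := u (nd x).1 / u (nd x).2.
have FE x n d : d != 0 -> x = tofrac n / tofrac d -> F x = u n / u d.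
  move=> d0 xE; have [d0' xE'] := hnd x; rewrite /F; move: (nd x) d0' xE' => [n' d'] /= d0' xE'.
  apply/eqP; rewrite eqr_div ?u0 // -!rmorphM (inj_eq inj) -tofrac_eq !tofracM.
  by rewrite -eqr_div ?tofrac_eq0 // -xE -xE'.
have FB : zmod_morphism F.
  move=> x y; have [n [d [d0 xE]]] := fracP x; have [n' [d' [d0' yE]]] := fracP y.
  rewrite (FE x n d) // (FE y n' d') // (FE _ (n * d' - n' * d) (d * d')) ?mulf_neq0 //.
    by rewrite rmorphB !rmorphM subr_frac ?u0.
  have ud : tofrac d != 0 by rewrite tofrac_eq0.
  have ud' : tofrac d' != 0 by rewrite tofrac_eq0.
  by rewrite xE yE tofracB !tofracM subr_frac.
have FM : monoid_morphism F.
  split.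
    by rewrite (FE 1 1 1) ?oner_neq0 // ?rmorph1 ?tofrac1 ?divr1.
  move=> x y; have [n [d [d0 xE]]] := fracP x; have [n' [d' [d0' yE]]] := fracP y.
  rewrite (FE x n d) // (FE y n' d') // (FE _ (n * n') (d * d')) ?mulf_neq0 //.
    by rewrite !rmorphM invfM mulrACA.
  by rewrite xE yE !tofracM invfM mulrACA.
pose F' : {rmorphism {fraction D} -> E} := HB.pack F (GRing.isZmodMorphism.Build _ _ F FB)
  (GRing.isMonoidMorphism.Build _ _ F FM).
exists F' => x; rewrite [LHS](FE _ x 1) ?oner_neq0 // ?rmorph1 ?tofrac1 ?divr1 //.
Qed.

Lemma field_of_prime (R : comNzRingType) (P : set R) : prime_ideal P ->
  exists (F : fieldType) (f : {rmorphism R -> F}), forall x, f x = 0 <-> P x.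
Proof.
move=> pP; have [D [pi [_ ker]]] := quotient_domain_exists pP.
exists {fraction D}, (@tofrac D \o pi) => x /=; rewrite -ker.
by split=> [/eqP|->]; rewrite ?tofrac_eq0 ?tofrac0 // => /eqP.
Qed.

Lemma exists_prime_over (R : comPzRingType) (J : set R) : is_ideal J -> ~ J 1 ->
  exists P, prime_ideal P /\ J `<=` P.
Proof.
move=> iJ nJ1; have [||x Jx x1|P [pP JP _]] := @exists_prime_disjoint R [set 1] J.
- by split=> //= s t -> ->; rewrite mulr1.
- exact: iJ.
- by apply: nJ1; rewrite -[1]x1.
by exists P.
Qed.

(** * Existence of algebraic closures *)

Lemma root_extension (K : fieldType) (p : {poly K}) : size p != 1%N ->
  exists (L : fieldType) (j : {rmorphism K -> L}) (r : L), root (map_poly j p) r.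
Proof.
move=> sp; pose J : set {poly K} := [set q | p %| q].
have [||Q [pQ JQ]] := @exists_prime_over _ J.
- split; rewrite /J /=; first exact: dvdp0.
    by move=> a b; apply: dvdp_add.
  by move=> a b; apply: dvdp_mull.
- by rewrite /J /= dvdp1; apply/negP.
have [F [f hf]] := field_of_prime pQ.
exists F, (f \o polyC), (f 'X); apply/rootP.
have -> : (map_poly (f \o polyC) p).[f 'X] = f p.
  by rewrite map_poly_comp horner_map -[p in RHS]comp_polyXr.
by apply/hf/JQ; rewrite /J /= dvdpp.
Qed.

Definition splits_in (K L : fieldType) (j : {rmorphism K -> L}) (p : {poly K}) :=
  exists rs : seq L, map_poly j p = \prod_(r <- rs) ('X - r%:P).

Lemma splitting_extension n (K : fieldType) (p : {poly K}) : p \is monic -> size p = n.+1 ->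
  exists (L : fieldType) (j : {rmorphism K -> L}), splits_in j p.
Proof.
elim: n K p => [|n IH] K p mp sp.
  exists K, idfun, [::]; rewrite big_nil map_poly_id //.
  have /eqP/size_poly1P [c c0 pE] := sp.
  by move: mp; rewrite pE monicE lead_coefC => /eqP ->.
have [|L [j [r rr]]] := @root_extension K p; first by rewrite sp.
have mjp : map_poly j p \is monic by rewrite map_monic.
have /factor_theorem [q qE] := rr.
have mq : q \is monic by move: mjp; rewrite qE monicMr ?monicXsubC.
have sq : size q = n.+1.
  have : size (map_poly j p) = n.+2 by rewrite size_map_poly.
  by rewrite qE size_Mmonic ?monicXsubC ?monic_neq0 // size_XsubC addn2 => -[].
have [L' [j' [rs jq]]] := IH L q mq sq.
exists L', (j' \o j), (j' r :: rs); rewrite map_poly_comp qE rmorphM /= jq big_cons mulrC.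
by rewrite rmorphB /= map_polyX map_polyC.
Qed.

Lemma splits_in_comp (K L M : fieldType) (j : {rmorphism K -> L}) (k : {rmorphism L -> M}) p :
  splits_in j p -> splits_in (k \o j) p.
Proof.
move=> [rs e]; exists (map k rs); rewrite map_poly_comp e rmorph_prod big_map.
by apply: eq_bigr => r _; rewrite rmorphB /= map_polyX map_polyC.
Qed.

Lemma splitting_extension_seq (K : fieldType) (ps : seq {poly K}) :
  exists (L : fieldType) (j : {rmorphism K -> L}),
    forall p, p \in ps -> p \is monic -> splits_in j p.
Proof.
elim: ps => [|p ps [L [j hj]]]; first by exists K, idfun.
have [mp|nmp] := boolP (p \is monic); last first.
  exists L, j => q; rewrite inE => /orP [/eqP ->|]; last exact: hj.
  by rewrite (negPf nmp).
have [||L' [k hk]] := @splitting_extension (size p).-1 L (map_poly j p).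
- by rewrite map_monic.
- by rewrite size_map_poly prednK // size_poly_gt0 monic_neq0.
exists L', (k \o j) => q; rewrite inE => /orP [/eqP ->|qps] mq.
  by have [rs e] := hk; exists rs; rewrite map_poly_comp.
by apply: splits_in_comp; apply: hj.
Qed.

Module ProductRing.
Section ProductRing.
Variables (I : Type) (i0 : I) (L : I -> comNzRingType).
(** The argument of type [I] certifies that there is a factor, whence [1] differs from [0] in the
    product. *)
Definition prod of I := forall i, L i.
Local Notation T := (prod i0).
HB.instance Definition _ := gen_eqMixin T.
HB.instance Definition _ := gen_choiceMixin T.

Let ext (f g : T) : (forall i, f i = g i) -> f = g.
Proof. exact: functional_extensionality_dep. Qed.

Definition add (f g : T) : T := fun i => f i + g i.
Definition opp (f : T) : T := fun i => - f i.
Definition mul (f g : T) : T := fun i => f i * g i.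
Definition zero : T := fun i => 0.
Definition one : T := fun i => 1.

Lemma addA : associative add. Proof. by move=> f g k; apply: ext => i; apply: addrA. Qed.
Lemma addC : commutative add. Proof. by move=> f g; apply: ext => i; apply: addrC. Qed.
Lemma add0 : left_id zero add. Proof. by move=> f; apply: ext => i; apply: add0r. Qed.
Lemma addN : left_inverse zero opp add. Proof. by move=> f; apply: ext => i; apply: addNr. Qed.
HB.instance Definition _ := GRing.isZmodule.Build T addA addC add0 addN.

Lemma mulA : associative mul. Proof. by move=> f g k; apply: ext => i; apply: mulrA. Qed.
Lemma mulC : commutative mul. Proof. by move=> f g; apply: ext => i; apply: mulrC. Qed.
Lemma mul1 : left_id one mul. Proof. by move=> f; apply: ext => i; apply: mul1r. Qed.
Lemma mulD : left_distributive mul add.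
Proof. by move=> f g k; apply: ext => i; apply: mulrDl. Qed.
Lemma one_neq0 : one != 0 :> T.
Proof.
apply/eqP => e; have : one i0 = zero i0 by rewrite e.
by move/eqP; rewrite /one /zero oner_eq0.
Qed.
HB.instance Definition _ := GRing.Zmodule_isComNzRing.Build T mulA mulC mul1 mulD one_neq0.

Definition ev i (f : T) : L i := f i.
Lemma ev_zmod i : zmod_morphism (ev i). Proof. by []. Qed.
Lemma ev_monoid i : monoid_morphism (ev i). Proof. by []. Qed.
HB.instance Definition _ i := GRing.isZmodMorphism.Build T (L i) (ev i) (ev_zmod i).
HB.instance Definition _ i := GRing.isMonoidMorphism.Build T (L i) (ev i) (ev_monoid i).
End ProductRing.
End ProductRing.
HB.export ProductRing.

(** An ultraproduct of splitting fields of finite sets of polynomials. The families vanishing at all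
    sufficiently large finite sets form a proper ideal; modulo a prime above it, a monic [p] factors
    through the families [rho i] of its roots. *)
Lemma splitting_all (K : fieldType) : exists (W : fieldType) (k : {rmorphism K -> W}),
  forall p, p \is monic -> splits_in k p.
Proof.
pose I := seq {poly K}.
have /choice [Lj hLj] : forall S : I, exists Lj : {L : fieldType & {rmorphism K -> L}},
    forall p, p \in S -> p \is monic -> splits_in (tagged Lj) p.
  by move=> S; have [L [j h]] := splitting_extension_seq S; exists (existT _ L j).
pose T : comNzRingType := ProductRing.prod (fun S => tag (Lj S) : comNzRingType) ([::] : I).
pose ev S : {rmorphism T -> tag (Lj S)} := ProductRing.ev S.
pose c (a : K) : T := fun S => tagged (Lj S) a.
have cB : zmod_morphism c.
  by move=> a b; apply: functional_extensionality_dep => S; exact: rmorphB.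
have cM : monoid_morphism c.
  split; first by apply: functional_extensionality_dep => S; exact: rmorph1.
  by move=> a b; apply: functional_extensionality_dep => S; exact: rmorphM.
pose cc : {rmorphism K -> T} := HB.pack c (GRing.isZmodMorphism.Build _ _ c cB)
  (GRing.isMonoidMorphism.Build _ _ c cM).
pose J : set T := [set f | exists S0 : I, forall S : I, {subset S0 <= S} -> ev S f = 0].
have iJ : is_ideal J.
  split.
  - by exists [::] => S _; rewrite rmorph0.
  - move=> f g [S hS] [S' hS']; exists (S ++ S') => U hU.
    rewrite rmorphD hS ?hS' ?addr0 // => p pS; apply: hU; rewrite mem_cat pS ?orbT //.
  - by move=> f g [S hS]; exists S => U hU; rewrite rmorphM hS // mulr0.
have [|Q [pQ JQ]] := exists_prime_over iJ.
  by move=> [S /(_ S (fun _ => id)) /eqP]; rewrite rmorph1 oner_eq0.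
have [W [f hf]] := field_of_prime pQ.
exists W, (f \o cc) => p mp.
pose rho (i : nat) : T := fun S =>
  if pselect (p \in S) is left pS then nth 0 (xget [::] [set rs | map_poly (tagged (Lj S)) p = \prod_(r <- rs) ('X - r%:P)]) i else 0.
pose n := (size p).-1.
have key S : p \in S -> map_poly (ev S) (\prod_(i < n) ('X - (rho i)%:P)) = map_poly (ev S) (map_poly cc p).
  move=> pS; rewrite -map_poly_comp.
  have -> : map_poly (ev S \o cc) p = map_poly (tagged (Lj S)) p by apply: eq_map_poly.
  have ex := hLj S p pS mp.
  have := @xgetPex _ [::] _ ex; set rs := xget _ _ => rsE.
  have -> : n = size rs.
    rewrite /n -(size_map_poly (tagged (Lj S))) rsE size_prod_XsubC //.
  rewrite rmorph_prod rsE (big_nth 0) big_mkord; apply: eq_bigr => i _.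
  rewrite rmorphB /= map_polyX map_polyC /=; congr (_ - _%:P).
  rewrite /ev /= /ProductRing.ev /rho; case: pselect => //.
exists [seq f (rho i) | i <- index_iota 0 n].
rewrite map_poly_comp big_map big_mkord.
have -> : \prod_(i < n) ('X - (f (rho i))%:P) = map_poly f (\prod_(i < n) ('X - (rho i)%:P)).
  by rewrite rmorph_prod; apply: eq_bigr => i _; rewrite rmorphB /= map_polyX map_polyC.
apply/polyP => i; rewrite !coef_map; apply/eqP; rewrite -subr_eq0 -rmorphB; apply/eqP/hf/JQ.
exists [:: p] => S hS; have pS : p \in S by apply: hS; rewrite mem_head.
have := congr1 (fun q : {poly _} => q`_i) (key S pS); rewrite !coef_map rmorphB => ->.
by rewrite subrr.
Qed.

Lemma integralOver_comp (K : comNzRingType) (L M : comNzRingType) (k : {rmorphism K -> L}) (j : {rmorphism L -> M}) z :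
  integralOver k z -> integralOver (j \o k) (j z).
Proof.
move=> [p mp /rootP rp]; exists p => //; apply/rootP.
by rewrite map_poly_comp horner_map rp rmorph0.
Qed.

Module AlgebraicSubfield.
Section AlgebraicSubfield.
Variables (K W : fieldType) (k : {rmorphism K -> W}).

Definition alg (z : W) : bool := `[< integralOver k z >].

Lemma alg_divring : divring_closed alg.
Proof.
split; first by apply/asboolP; apply: integral1.
  by move=> u v /asboolP hu /asboolP hv; apply/asboolP; apply: integral_sub.
by move=> u v /asboolP hu /asboolP hv; apply/asboolP; apply: integral_div.
Qed.
HB.instance Definition _ := GRing.isDivringClosed.Build W alg alg_divring.

Record T := mk { emb : W; _ : alg emb }.
HB.instance Definition _ := [isSub for emb].
HB.instance Definition _ := [Choice of T by <:].
HB.instance Definition _ := [SubChoice_isSubComUnitRing of T by <:].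
HB.instance Definition _ := [SubComUnitRing_isSubIntegralDomain of T by <:].
HB.instance Definition _ := [SubIntegralDomain_isSubField of T by <:].

Lemma embP z : integralOver k (emb z).
Proof. by case: z => z /= /asboolP. Qed.

Hypothesis splits : forall p, p \is monic -> splits_in k p.

(** A root in an extension of [W] is algebraic over [K], and its equation over [K] splits in [W]
    already. *)
Lemma T_closed : GRing.closed_field_axiom T.
Proof.
move=> n P n0.
pose f : {poly T} := 'X^n - \poly_(i < n) P i.
have sp : (size (\poly_(i < n) P i)%R <= n)%N by exact: size_poly.
have mf : f \is monic by rewrite monicE lead_coefDl ?lead_coefXn // size_polyXn size_polyN ltnS.
have sf : size f = n.+1 by rewrite size_polyDl ?size_polyXn // size_polyN ltnS.
pose v : {rmorphism T -> W} := (val : T -> W).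
have [|L [j [r rr]]] := @root_extension W (map_poly v f).
  by rewrite size_map_poly sf eqSS -lt0n.
have [q mq rq] : integralOver (j \o k) r.
  apply: integral_root_monic rr _; first by rewrite !map_monic.
  move=> _ /(nthP 0) [i _ <-]; rewrite !coef_map /=.
  by apply: integralOver_comp; apply: embP.
have [rs qE] := splits mq.
have : r \in map j rs.
  move: rq; rewrite map_poly_comp qE rmorph_prod.
  rewrite (_ : \prod_(s <- rs) _ = \prod_(z <- map j rs) ('X - z%:P)) ?root_prod_XsubC //.
  by rewrite big_map; apply: eq_bigr => s _; rewrite rmorphB /= map_polyX map_polyC.
move=> /mapP [s srs rE].
have alg_s : alg s.
  by apply/asboolP; exists q => //; rewrite qE root_prod_XsubC.
exists (mk alg_s).
have : root f (mk alg_s).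
  apply/rootP; apply: (fmorph_inj v); apply: (fmorph_inj j).
  rewrite !rmorph0 -[v _.[_]]horner_map -[j _.[_]]horner_map.
  by apply/rootP; rewrite /= -rE.
rewrite /root hornerD hornerN hornerXn horner_poly subr_eq0 => /eqP ->.
by [].
Qed.
(** The splitting hypothesis is made an argument of the type, so that the closed field structure,
    whose proof rests on it, can be attached. *)
Definition closure of (forall p : {poly K}, p \is monic -> splits_in k p) : Type := T.
HB.instance Definition _ := GRing.Field.on (closure splits).
HB.instance Definition _ := Field_isAlgClosed.Build (closure splits) T_closed.
End AlgebraicSubfield.
End AlgebraicSubfield.
HB.export AlgebraicSubfield.

Lemma algebraic_closure_exists (K : fieldType) :
  exists (E : closedFieldType) (j : {rmorphism K -> E}), algebraic_closure j.
Proof.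
have [W [k hk]] := splitting_all K.
pose E : closedFieldType := AlgebraicSubfield.closure hk.
have algk a : AlgebraicSubfield.alg k (k a) by apply/asboolP; apply: integral_id.
pose c (a : K) : E := AlgebraicSubfield.mk (algk a).
have cB : zmod_morphism c by move=> a b; apply: val_inj; exact: rmorphB.
have cM : monoid_morphism c.
  by split=> [|a b]; apply: val_inj; [exact: rmorph1 | exact: rmorphM].
pose j : {rmorphism K -> E} := HB.pack c (GRing.isZmodMorphism.Build _ _ c cB)
  (GRing.isMonoidMorphism.Build _ _ c cM).
exists E, j => z; apply/integral_algebraic.
have [p mp /rootP rp] := AlgebraicSubfield.embP (z : AlgebraicSubfield.T k).
exists p => //; apply/rootP; apply: val_inj.
pose v : {rmorphism E -> W} := (val : AlgebraicSubfield.T k -> W).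
by rewrite -[LHS]/(v _) -[RHS]/(v 0) rmorph0 -rp -horner_map -map_poly_comp.
Qed.

(** A finite substitute for the uniqueness of algebraic closures. To adjoin [z], a root [w] in [E']
    of its minimal polynomial is chosen, and the quotient of the polynomials over [F] by those
    vanishing at [z] is embedded in both fields. *)
Lemma common_subfield (K : fieldType) (E E' : closedFieldType) (j : {rmorphism K -> E})
    (j' : {rmorphism K -> E'}) (zs : seq E) : (forall z, z \in zs -> integralOver j z) ->
  exists (F : fieldType) (k : {rmorphism K -> F}) (u : {rmorphism F -> E}) (u' : {rmorphism F -> E'}),
    [/\ forall a, u (k a) = j a, forall a, u' (k a) = j' a &
        forall z, z \in zs -> exists y, u y = z].
Proof.
elim: zs => [_|z zs IH algz]; first by exists K, idfun, j, j'.
have [y yzs|F [k [u [u' [uk u'k hF]]]]] := IH.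
  by apply: algz; rewrite inE yzs orbT.
pose Q : set {poly F} := [set f | root (map_poly u f) z].
have pQ : prime_ideal Q.
  split; first split; first split.
  - by rewrite /Q /= rmorph0 root0.
  - by move=> a b /rootP ha /rootP hb; apply/rootP; rewrite rmorphD hornerD ha hb addr0.
  - by move=> a b hb; rewrite /Q /= rmorphM rootM hb orbT.
  - by apply/negP; rewrite rmorph1 root1.
  - by move=> a b; rewrite /Q /= rmorphM rootM => /orP.
have [f mf rf] := algz z (mem_head z zs).
have ex : exists n, `[< exists f, [/\ Q f, f != 0 & size f = n] >].
  exists (size (map_poly k f)); apply/asboolP; exists (map_poly k f); split=> //.
    rewrite /Q /= -map_poly_comp (_ : map_poly _ f = map_poly j f) //.
    by apply: eq_map_poly => a /=; rewrite uk.
  by rewrite map_poly_eq0 monic_neq0.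
case: (ex_minnP ex) => n /asboolP [p [Qp p0 sp]] minp.
have Qdvd q : Q q -> p %| q.
  move=> Qq; apply/eqP; apply: contrapT => /eqP r0.
  have : (n <= size (q %% p)%R)%N.
    apply: minp; apply/asboolP; exists (q %% p); split=> //.
    have -> : q %% p = q - q %/ p * p by rewrite {2}(divp_eq q p) addrC addKr.
    apply: idealB => //; first exact: prime_ideal_ideal.
    by apply: ideal_mull => //; apply: prime_ideal_ideal.
  by rewrite leqNgt -sp ltn_modp p0.
have sp1 : size p != 1%N.
  apply/eqP => /eqP /size_poly1P [c c0 pE]; move: Qp; rewrite pE /Q /= map_polyC /= => /rootP.
  by rewrite hornerC => /eqP; rewrite fmorph_eq0 (negPf c0).
have /closed_rootP [w rw] : size (map_poly u' p) != 1%N by rewrite size_map_poly.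
have [D [pi qpi]] := quotient_domain_exists pQ; have [surj ker] := qpi.
pose ev : {rmorphism {poly F} -> E} := horner_eval z \o map_poly u.
pose ev' : {rmorphism {poly F} -> E'} := horner_eval w \o map_poly u'.
have evE f1 : ev f1 = (map_poly u f1).[z] by [].
have evE' f1 : ev' f1 = (map_poly u' f1).[w] by [].
have [g hg] := quotient_lift (f := ev) qpi (fun f1 (h : Q f1) => rootP h).
have [|g' hg'] := quotient_lift (f := ev') qpi.
  move=> f1 /Qdvd /dvdpP [c ->]; rewrite evE' rmorphM hornerM (rootP rw) mulr0 //.
have inj_of (T : comNzRingType) (G : {rmorphism D -> T}) :
    (forall f1, G (pi f1) = 0 -> Q f1) -> injective G.
  move=> h a b e; have [f1 e1] := surj a; have [f2 e2] := surj b.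
  apply/eqP; rewrite -subr_eq0 -e1 -e2 -rmorphB; apply/eqP/ker; apply: h.
  by rewrite rmorphB e1 e2 rmorphB e subrr.
have ig : injective g by apply: inj_of => f1; rewrite hg evE => /rootP.
(* If [f1] vanished at [w] but not at [z], it would be coprime to the minimal polynomial [p], and a
   Bezout identity evaluated at [w] would read [0 = 1]. *)
have ig' : injective g'.
  apply: inj_of => f1; rewrite hg' evE' => /rootP r1; apply: contrapT => nQ.
  have [c pE] : exists c, p = c * gcdp f1 p by apply/dvdpP; apply: dvdp_gcdr.
  have [Qc|Qg] : Q c \/ Q (gcdp f1 p) by apply: (primeM pQ); rewrite -pE.
    have c0 : c != 0 by apply: contraNneq p0 => c0; rewrite pE c0 mul0r.
    have g0 : gcdp f1 p != 0 by rewrite gcdp_eq0 negb_and p0 orbT.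
    have : (n <= size c)%N by apply: minp; apply/asboolP; exists c.
    rewrite -sp {1}pE size_mul // => le.
    have : coprimep f1 p.
      rewrite /coprimep eqn_leq lt0n size_poly_eq0 g0 andbT.
      have : (0 < size c)%N by rewrite lt0n size_poly_eq0.
      by move: le; clear; lia.
    move=> /Bezout_eq1_coprimepP [[a b] /= /(congr1 ev')].
    rewrite rmorph1 evE' rmorphD !rmorphM hornerD !hornerM (rootP r1) (rootP rw) !mulr0 addr0 => /eqP.
    by rewrite eq_sym oner_eq0.
  apply: nQ; have /dvdpP [e ->] := dvdp_gcdl f1 p.
  by apply: ideal_mull => //; apply: prime_ideal_ideal.
have [G hG] := fraction_lift ig; have [G' hG'] := fraction_lift ig'.
exists {fraction D}, (@tofrac D \o pi \o polyC \o k), G, G'; split.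
- by move=> a /=; rewrite hG hg evE map_polyC hornerC /= uk.
- by move=> a /=; rewrite hG' hg' evE' map_polyC hornerC /= u'k.
move=> y; rewrite inE => /orP [/eqP ->|/hF [y' <-]].
  by exists (tofrac (pi 'X)); rewrite hG hg evE map_polyX hornerX.
by exists (tofrac (pi y'%:P)); rewrite hG hg evE map_polyC hornerC.
Qed.

(** Both maps extend to the fraction field of the quotient by their common kernel, and only the
    finitely many [z i] have to be carried over. This makes plus closure independent of the chosen
    field. *)
Lemma integral_combination_transfer (R : comNzRingType) (E E' : closedFieldType)
    (h : {rmorphism R -> E}) (h' : {rmorphism R -> E'}) (d : R) n (x : 'I_n -> R) (z : 'I_n -> E) :
  (forall a, h a = 0 <-> h' a = 0) -> (forall i, integralOver h (z i)) ->
  h d = \sum_i h (x i) * z i ->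
  exists z' : 'I_n -> E', (forall i, integralOver h' (z' i)) /\ h' d = \sum_i h' (x i) * z' i.
Proof.
move=> hh' iz e.
have pP : prime_ideal [set a | h a = 0].
  split; first split; first split=> /=.
  - exact: rmorph0.
  - by move=> a b ha hb; rewrite rmorphD ha hb addr0.
  - by move=> a b hb; rewrite rmorphM hb mulr0.
  - by rewrite /= rmorph1; apply/eqP/oner_neq0.
  - move=> a b /= /eqP; rewrite rmorphM mulf_eq0 => /orP [] /eqP; [by left | by right].
have [D [pi qpi]] := quotient_domain_exists pP; have [surj ker] := qpi.
have [g hg] := quotient_lift (f := h) qpi (fun a H => H).
have [g' hg'] := quotient_lift (f := h') qpi (fun a H => (hh' a).1 H).
have inj_of (T : comNzRingType) (G : {rmorphism D -> T}) :
    (forall a, G (pi a) = 0 -> h a = 0) -> injective G.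
  move=> H a b e'; have [f1 e1] := surj a; have [f2 e2] := surj b.
  apply/eqP; rewrite -subr_eq0 -e1 -e2 -rmorphB; apply/eqP/ker; apply: H.
  by rewrite rmorphB e1 e2 rmorphB e' subrr.
have [|G hG] := fraction_lift (u := g); first by apply: inj_of => a; rewrite hg.
have [|G' hG'] := fraction_lift (u := g'); first by apply: inj_of => a; rewrite hg' => /hh'.
have cmp a : G (tofrac (pi a)) = h a by rewrite hG hg.
have cmp' a : G' (tofrac (pi a)) = h' a by rewrite hG' hg'.
have lift_poly (T : comNzRingType) (H : {rmorphism R -> T}) (GG : {rmorphism {fraction D} -> T}) q :
    (forall a, GG (tofrac (pi a)) = H a) -> map_poly GG (map_poly (@tofrac D \o pi) q) = map_poly H q.
  by move=> hH; rewrite -map_poly_comp; apply: eq_map_poly => a /=; rewrite hH.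
have [|F [k [u [u' [uk u'k hF]]]]] := @common_subfield _ E E' G G' (codom z).
  move=> y /codomP [i ->]; have [q mq rq] := iz i.
  exists (map_poly (@tofrac D \o pi) q); first exact: monic_map.
  by rewrite (lift_poly _ h).
have /choice [y hy] : forall i, exists y, u y = z i by move=> i; apply: hF; apply: codom_f.
exists (fun i => u' (y i)); split.
  move=> i; have [q mq rq] := iz i; exists q => //.
  pose q' := map_poly (@tofrac D \o pi) q.
  have uq : map_poly u (map_poly k q') = map_poly h q.
    rewrite -(lift_poly _ h G q cmp) -map_poly_comp.
    by apply: eq_map_poly => a /=; rewrite uk.
  have uq' : map_poly u' (map_poly k q') = map_poly h' q.
    rewrite -(lift_poly _ h' G' q cmp') -map_poly_comp.
    by apply: eq_map_poly => a /=; rewrite u'k.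
  apply/rootP; rewrite -uq' horner_map; suff -> : (map_poly k q').[y i] = 0 by rewrite rmorph0.
  by apply: (fmorph_inj u); rewrite rmorph0 -horner_map hy uq (rootP rq).
have e0 : k (tofrac (pi d)) = \sum_i k (tofrac (pi (x i))) * y i.
  apply: (fmorph_inj u); rewrite uk cmp e rmorph_sum; apply: eq_bigr => i _.
  by rewrite rmorphM /= uk cmp hy.
rewrite -cmp' -u'k e0 rmorph_sum; apply: eq_bigr => i _.
by rewrite rmorphM /= u'k cmp'.
Qed.

Lemma closed_field_of_prime (R : comNzRingType) (P : set R) : prime_ideal P ->
  exists (E : closedFieldType) (h : {rmorphism R -> E}), forall a, h a = 0 <-> P a.
Proof.
move=> pP; have [F [f hf]] := field_of_prime pP.
have [E [j _]] := algebraic_closure_exists F.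
exists E, (j \o f) => a /=; rewrite -hf.
by split=> [/eqP|->]; rewrite ?rmorph0 // fmorph_eq0 => /eqP.
Qed.

(** Any algebraically closed field receiving [R] with kernel [P] will do, algebraic over the
    fraction field or not, because only integral elements occur. This avoids quotients and fraction
    fields in what follows. *)
Lemma plus_closureE (R : comNzRingType) (b : set R) r : plus_closure b r <->
  forall P, minimal_prime P -> forall (E : closedFieldType) (h : {rmorphism R -> E}),
    (forall a, h a = 0 <-> P a) -> extN h (integral_closure h) b (h r).
Proof.
split=> [hr P mP E h kerh|hr P mP D pi qpi].
  have [D [pi qpi]] := quotient_domain_exists mP.1.
  have [surj ker] := qpi.
  have [E0 [j [_ [n [x [z [bx iz e]]]]]]] := hr P mP D pi qpi.
  have /choice [x' hx'] : forall i, exists x', b x' /\ pi x' = x i.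
    by move=> i; have [x' bx' <-] := bx i; exists x'.
  pose h0 : {rmorphism R -> E0} := j \o (@tofrac D \o pi).
  have iz0 i : integralOver h0 (z i).
    have [p mp rp] := iz i; pose emb : {rmorphism D -> E0} := j \o @tofrac D.
    apply: (@integral_root_monic _ _ h0 _ (map_poly emb p)) => //; first exact: monic_map.
    move=> _ /(nthP 0) [l _ <-]; rewrite coef_map.
    by have [y <-] := surj p`_l; apply: (integral_id h0).
  have ker0 a : h0 a = 0 <-> h a = 0.
    rewrite kerh -ker /h0 /=; split=> [/eqP|->]; last by rewrite tofrac0 rmorph0.
    by rewrite fmorph_eq0 tofrac_eq0 => /eqP.
  have [|z' [iz' e']] := @integral_combination_transfer _ _ _ h0 h r n x' z ker0 iz0.
    by rewrite /h0 /= e; apply: eq_bigr => i _; case: (hx' i) => _ ->.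
  by exists n, x', z'; split=> // i; case: (hx' i).
have [surj ker] := qpi.
have [E [j algj]] := algebraic_closure_exists {fraction D}.
pose h0 : {rmorphism R -> E} := j \o (@tofrac D \o pi).
have [|n [x [z [bx iz e]]]] := hr P mP E h0.
  move=> a; rewrite -ker /h0 /=; split=> [/eqP|->]; last by rewrite tofrac0 rmorph0.
  by rewrite fmorph_eq0 tofrac_eq0 => /eqP.
exists E, j => emb; split=> //; exists n, (fun i => pi (x i)), z; split=> //.
  by move=> i; exists (x i).
move=> i; have [p mp rp] := iz i; exists (map_poly pi p); first exact: monic_map.
have -> // : map_poly emb (map_poly pi p) = map_poly h0 p.
apply/polyP => l; rewrite coef_map_id0; last by rewrite /emb tofrac0 rmorph0.
by rewrite !coef_map.
Qed.

Lemma comap_prime (C B : comPzRingType) (f : {rmorphism C -> B}) (Q : set B) :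
  prime_ideal Q -> prime_ideal (f @^-1` Q).
Proof.
move=> pQ; have iQ := prime_ideal_ideal pQ; split; first split; first split=> /=.
- by rewrite rmorph0; apply: ideal0.
- by move=> a b ha hb; rewrite rmorphD; apply: idealD.
- by move=> a b hb; rewrite rmorphM; apply: ideal_mull.
- by rewrite /= rmorph1; apply: prime1.
- by move=> a b /=; rewrite rmorphM; apply: primeM.
Qed.

(** * Integral extensions and primary decomposition *)

Section IntegralExtension.
Variables (C B : comNzRingType) (f : {rmorphism C -> B}).
Hypothesis integral_f : integralRange f.

Lemma integral_equation b : exists n (a : nat -> C), b ^+ n = \sum_(i < n) f (a i) * b ^+ i.
Proof.
have [q mq /rootP rq] := integral_f b; exists (size q).-1, (fun i => - q`_i).
have sz : size q = (size q).-1.+1 by rewrite prednK // size_poly_gt0 monic_neq0.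
have : (map_poly f q).[b] = \sum_(i < size q) f q`_i * b ^+ i.
  rewrite horner_coef size_map_poly_id0 ?(monicP mq) ?rmorph1 ?oner_neq0 //.
  by apply: eq_bigr => i _; rewrite coef_map.
rewrite rq sz big_ord_recr /= -[q`_(size q).-1]/(lead_coef q) (monicP mq) rmorph1 mul1r.
move=> /esym/eqP; rewrite addrC addr_eq0 => /eqP ->; rewrite -sumrN; apply: eq_bigr => i _.
by rewrite rmorphN mulNr.
Qed.

(** If [Q] missed the image of some [c] in [P], maximality would give [s] outside [P] with
    [f s = q + b * f c] and [q] in [Q]. The monic equation of [b], homogenized by [c], then yields a
    [t] that is [s ^+ n] modulo [P] although [f t] lies in [Q]. *)
Lemma lying_over (J : set B) (P : set C) : is_ideal J -> prime_ideal P ->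
  f @^-1` J `<=` P -> exists Q, [/\ prime_ideal Q, J `<=` Q & f @^-1` Q = P].
Proof.
move=> iJ pP JP; have iP := prime_ideal_ideal pP.
have [||Q [pQ JQ QS Qmax]] := @exists_max_disjoint B (f @` (~` P)) J _ iJ.
- split; first by exists 1; [apply: prime1 | rewrite rmorph1].
  by move=> _ _ [s ns <-] [t nt <-]; exists (s * t); [apply: primeNM | rewrite rmorphM].
- by move=> x Jx [s ns e]; apply: ns; apply: JP; rewrite /= e.
have iQ := prime_ideal_ideal pQ; exists Q; split=> //; apply/seteqP; split=> c.
  by move=> Qc; apply: contrapT => nPc; apply: (QS _ Qc); exists c.
move=> Pc; apply: contrapT => nQc.
have [q [b [Qq [s ns sE]]]] := Qmax _ nQc.
have [n [a bn]] := integral_equation b.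
pose t := s ^+ n - \sum_(i < n) a i * c ^+ (n - i) * s ^+ i.
suff : P (t + \sum_(i < n) a i * c ^+ (n - i) * s ^+ i) by rewrite subrK => /(primeX pP).
apply: idealD => //; last first.
  apply: (ideal_sum _ iP) => i _; apply: (ideal_mulr _ iP); apply: (ideal_mull _ iP).
  by rewrite (_ : (n - i)%N = (n - i.+1).+1) ?exprS; [apply: ideal_mulr | rewrite subnSK].
apply: contrapT => nPt; apply: (QS (f t)); last by exists t.
have sq m : exists r, Q r /\ f s ^+ m = (b * f c) ^+ m + r.
  elim: m => [|m [r [Qr e]]]; first by exists 0; rewrite !expr0 addr0; split=> //; apply: ideal0.
  exists (q * (b * f c) ^+ m + f s * r); split.
    by apply: idealD => //; [apply: ideal_mulr | apply: ideal_mull].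
  by rewrite !exprS e sE; ring.
have [r [Qr rE]] := sq n.
have /choice [u hu] : forall i : 'I_n, exists u, Q u /\ f s ^+ i = (b * f c) ^+ i + u.
  by move=> i; apply: sq.
rewrite (_ : f t = r - \sum_(i < n) f (a i) * f c ^+ (n - i) * u i); last first.
  rewrite /t rmorphB rmorphXn /= rE rmorph_sum /=.
  have -> : \sum_(i < n) f (a i * c ^+ (n - i) * s ^+ i) =
      \sum_(i < n) f (a i) * f c ^+ (n - i) * (b * f c) ^+ i + \sum_(i < n) f (a i) * f c ^+ (n - i) * u i.
    rewrite -big_split; apply: eq_bigr => i _; rewrite !rmorphM !rmorphXn /=.
    by case: (hu i) => _ ->; rewrite mulrDr.
  rewrite (_ : (b * f c) ^+ n = \sum_(i < n) f (a i) * f c ^+ (n - i) * (b * f c) ^+ i); first by ring.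
  rewrite exprMn bn mulr_suml; apply: eq_bigr => i _.
  have -> : f c ^+ n = f c ^+ (n - i) * f c ^+ i by rewrite -exprD subnK // ltnW.
  by rewrite exprMn; ring.
apply: idealB => //; apply: (ideal_sum _ iQ) => i _; apply: ideal_mull => //.
by case: (hu i).
Qed.

(** In an equation of least degree for [x] modulo [Q], the constant term lies in [Q'], hence in [Q],
    and a factor [x] can be cancelled. *)
Lemma incomparable (Q Q' : set B) : prime_ideal Q -> prime_ideal Q' -> Q `<=` Q' ->
  f @^-1` Q' `<=` f @^-1` Q -> Q' `<=` Q.
Proof.
move=> pQ pQ' QQ' h x Q'x; apply: contrapT => nQx.
have iQ := prime_ideal_ideal pQ; have iQ' := prime_ideal_ideal pQ'.
have ex : exists n, `[< exists a : nat -> C, Q (x ^+ n + \sum_(i < n) f (a i) * x ^+ i) >].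
  have [n [a e]] := integral_equation x; exists n; apply/asboolP; exists (fun i => - a i).
  rewrite e (_ : _ + _ = 0); first exact: ideal0.
  by rewrite -big_split big1 // => i _ /=; rewrite rmorphN mulNr addrN.
case: (ex_minnP ex) => -[|n] /asboolP [a Qa] minn.
  by move: Qa; rewrite expr0 big_ord0 addr0; apply: prime1.
have E : x ^+ n.+1 + \sum_(i < n.+1) f (a i) * x ^+ i =
   f (a 0%N) + x * (x ^+ n + \sum_(i < n) f (a i.+1) * x ^+ i).
  rewrite big_ord_recl /= expr0 mulr1 exprS mulrDr addrCA; congr (_ + (_ + _)).
  by rewrite mulr_sumr; apply: eq_bigr => i _; rewrite /bump /= exprS; ring.
have Qa0 : Q (f (a 0%N)).
  apply: h; rewrite /=; have := QQ' _ Qa; rewrite E addrC; apply: idealDl => //.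
  exact: ideal_mulr.
have := Qa; rewrite E => /(idealDl iQ Qa0) /(primeM pQ) [//|Qy].
by have := minn n (asboolT (ex_intro _ (fun i => a i.+1) Qy)); rewrite ltnn.
Qed.

Lemma going_up n (P : nat -> set C) : injective f -> prime_chain n P ->
  exists Q, prime_chain n Q /\ f @^-1` (Q n) = P n.
Proof.
move=> inj; elim: n => [|n IH] cP.
  have [|Q [pQ _ QE]] := lying_over (@ideal_zero B) (cP.1 0%N (leqnn _)).
    move=> c /= fc0; have -> : c = 0 by apply: inj; rewrite fc0 rmorph0.
    by apply: ideal0; apply: prime_ideal_ideal; apply: cP.1.
  by exists (fun=> Q); split.
have [Q [cQ QE]] := IH (prime_chainW (leqnSn n) cP).
have [Pn nPn] := cP.2 n (ltnSn n).
have [|Q' [pQ' QQ' Q'E]] := lying_over (prime_ideal_ideal (cQ.1 n (leqnn n))) (cP.1 n.+1 (leqnn _)).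
  by rewrite QE.
exists (fun i => if (i <= n)%N then Q i else Q'); rewrite ltnn; split=> //.
apply: prime_chain_rcons => //; split=> // Q'Q; apply: nPn.
by rewrite -QE -Q'E => c; apply: Q'Q.
Qed.

(** A chain of length [d] above [P] contracts to one of the same length in [C]. A prime strictly
    below the contraction of [P] would lengthen it, and going up would give a chain of length [d.+1]
    in [B]. *)
Lemma minimal_prime_comap (P : set B) : injective f -> equidimensional B -> minimal_prime P ->
  minimal_prime (f @^-1` P).
Proof.
move=> inj [d [[_ dimB] eqd]] mP; have pP := mP.1.
split; first exact: comap_prime.
move=> q' pq' q'P; apply: contrapT => ne.
have [D [pi qpi]] := quotient_domain_exists pP; have [surj ker] := qpi.
have [[T cT] _] := eqd P mP D pi qpi.
have cT' : prime_chain d (fun i => f @^-1` (pi @^-1` T i)).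
  split=> i hi; first by apply/comap_prime/comap_prime; apply: cT.1.
  have [TT nTT] := cT.2 i hi; split; first by move=> c; apply: TT.
  move=> h; apply: nTT => y Ty; have [x e] := surj y.
  have := @incomparable (pi @^-1` T i) (pi @^-1` T i.+1) _ _ _ h x; rewrite /= e; apply=> //.
  - by apply: comap_prime; apply: cT.1; apply: ltnW.
  - by apply: comap_prime; apply: cT.1.
  - by move=> z; apply: TT.
have lt0 : q' `<` f @^-1` (pi @^-1` T 0%N).
  have sub : f @^-1` P `<=` f @^-1` (pi @^-1` T 0%N).
    move=> c Pc /=; rewrite (_ : pi (f c) = 0); last exact/ker.
    by apply: ideal0; apply: prime_ideal_ideal; apply: cT.1.
  split; first by move=> c /q'P /sub.
  by move=> h; apply: ne; apply/seteqP; split=> // c /sub /h.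
have [Q [cQ _]] := going_up inj (prime_chain_cons pq' lt0 cT').
by have := dimB _ _ cQ; rewrite ltnn.
Qed.

End IntegralExtension.

Lemma count_lt (T : eqType) (a1 a2 : pred T) (s : seq T) x :
  (forall y, a1 y -> a2 y) -> x \in s -> a2 x -> ~~ a1 x -> (count a1 s < count a2 s)%N.
Proof.
move=> a12; elim: s => // y s IH; rewrite inE => /orP [/eqP <-|xs] a2x na1x /=.
  by rewrite a2x (negbTE na1x) add0n add1n ltnS; apply: sub_count.
rewrite -addnS; apply: leq_add; last exact: IH.
by case: (boolP (a1 y)) => // /a12 ->.
Qed.

Section NoetherianDecomposition.
Variable A : comPzRingType.
Hypothesis noeth : noetherian A.
Implicit Types (I J P Q : set A).

Definition minimal_over I P :=
  [/\ prime_ideal P, I `<=` P & forall Q, prime_ideal Q -> I `<=` Q -> Q `<=` P -> Q = P].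

(** Noetherian induction: when [x * y] in [M] shows that [M] is not prime, the lists for [M] plus
    [x] and [M] plus [y] are joined. *)
Lemma prime_product I : is_ideal I -> exists Ps : seq (set A),
  (forall P, P \in Ps -> prime_ideal P /\ I `<=` P) /\
  forall Q, prime_ideal Q -> I `<=` Q -> exists2 P, P \in Ps & P `<=` Q.
Proof.
move=> iI; apply: contrapT => nI.
pose good I := exists Ps : seq (set A),
  (forall P, P \in Ps -> prime_ideal P /\ I `<=` P) /\
  forall Q, prime_ideal Q -> I `<=` Q -> exists2 P, P \in Ps & P `<=` Q.
have [||M [[iM nM] _ Mmax]] := @noeth_max A [set I | is_ideal I /\ ~ good I] I noeth.
- by move=> J [].
- by [].
have [M1|nM1] := pselect (M 1).
  by apply: nM; exists [::]; split=> // Q pQ /(_ 1 M1) /(prime1 pQ).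
have [pM|npM] := pselect (prime_ideal M).
  apply: nM; exists [:: M]; split; first by move=> P; rewrite inE => /eqP ->; split.
  by move=> Q _ MQ; exists M; rewrite ?mem_head.
have [x [y [Mxy nMx nMy]]] : exists x y, [/\ M (x * y), ~ M x & ~ M y].
  apply: contrapT => no; apply: npM; split=> // x y Mxy; apply: contrapT => /not_orP [nx ny].
  by apply: no; exists x, y.
have g z : ~ M z -> good (adj M z).
  move=> nMz; apply: contrapT => ng; apply: nMz.
  rewrite -(Mmax (adj M z)); first exact: mem_adj.
    by split=> //; apply: adj_ideal.
  exact: sub_adj.
have [Ps [hPs Px]] := g x nMx; have [Ps' [hPs' Py]] := g y nMy.
apply: nM; exists (Ps ++ Ps'); split.
  move=> P; rewrite mem_cat => /orP [/hPs [pP MP]|/hPs' [pP MP]]; split=> //; apply: subset_trans MP; exact: sub_adj.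
move=> Q pQ MQ; have iQ := prime_ideal_ideal pQ.
have [Qx|Qy] := primeM pQ (MQ _ Mxy).
  have [|P PPs PQ] := Px Q pQ; first exact: adj_min.
  by exists P; rewrite // mem_cat PPs.
have [|P PPs PQ] := Py Q pQ; first exact: adj_min.
by exists P; rewrite // mem_cat PPs orbT.
Qed.

(** Below a given [Q], a listed prime that contains the fewest members of the list is minimal over
    [I]. *)
Lemma minimal_primes_over I : is_ideal I -> exists Ps : seq (set A),
  [/\ uniq Ps, forall P, P \in Ps <-> minimal_over I P &
      forall Q, prime_ideal Q -> I `<=` Q -> exists2 P, P \in Ps & P `<=` Q].
Proof.
move=> iI; have [Ps [hPs below]] := prime_product iI.
have mem P : minimal_over I P -> P \in Ps.
  by move=> [pP IP mP]; have [P' P'Ps P'P] := below P pP IP; have [pP' IP'] := hPs _ P'Ps; rewrite -(mP P').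
exists (undup [seq P <- Ps | `[< minimal_over I P >]]); split; first exact: undup_uniq.
  move=> P; rewrite mem_undup mem_filter; split=> [/andP[/asboolP]//|mP].
  by rewrite mem ?andbT //; apply/asboolP.
move=> Q pQ IQ.
pose cnt P := count (fun P' => `[< P' `<=` P >]) Ps.
have ex : exists n, `[< exists P, [/\ P \in Ps, P `<=` Q & cnt P = n] >].
  by have [P PPs PQ] := below Q pQ IQ; exists (cnt P); apply/asboolP; exists P.
case: (ex_minnP ex) => n /asboolP [P [PPs PQ Pn]] minn.
exists P => //; rewrite mem_undup mem_filter PPs andbT; apply/asboolP.
have [pP IP] := hPs _ PPs; split=> // Q' pQ' IQ' Q'P; apply/seteqP; split=> //.
have [P' P'Ps P'Q'] := below Q' pQ' IQ'.
apply: contrapT => nPQ'.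
have : (n <= cnt P')%N by apply: minn; apply/asboolP; exists P'; split=> // x /P'Q' /Q'P /PQ.
suff : (cnt P' < cnt P)%N by rewrite Pn ltnNge => /negbTE ->.
apply: (@count_lt _ _ _ _ P) => //.
- by move=> X /asboolP h; apply/asboolP => x /h /P'Q' /Q'P.
- exact/asboolP.
- by apply/negP => /asboolP h; apply: nPQ' => x /h /P'Q'.
Qed.

Lemma minimal_prime_over0 P : minimal_prime P <-> minimal_over [set 0] P.
Proof.
split=> [[pP mP]|[pP _ mP]].
  by split=> // [_ ->|Q pQ _]; [apply: ideal0; apply: prime_ideal_ideal | apply: mP].
by split=> // Q pQ; apply: mP => // _ ->; apply: ideal0; apply: prime_ideal_ideal.
Qed.

Lemma minimal_prime_below Q : prime_ideal Q -> exists2 P : set A, minimal_prime P & P `<=` Q.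
Proof.
move=> pQ; have [Ps [_ hPs below]] := minimal_primes_over (@ideal_zero A).
have [|P /hPs mP PQ] := below Q pQ; last by exists P => //; apply/minimal_prime_over0.
by move=> _ ->; apply: ideal0; apply: prime_ideal_ideal.
Qed.

Lemma prime_avoid (Ps : seq (set A)) P : prime_ideal P ->
  (forall P', P' \in Ps -> is_ideal P' /\ ~ P' `<=` P) ->
  exists x, ~ P x /\ forall P', P' \in Ps -> P' x.
Proof.
move=> pP; elim: Ps => [_|Q Ps IH h]; first by exists 1; split=> //; apply: prime1.
have [|x [nPx hx]] := IH; first by move=> P' P'Ps; apply: h; rewrite inE P'Ps orbT.
have [iQ nQP] := h Q (mem_head _ _).
have [y [Qy nPy]] : exists y, Q y /\ ~ P y.
  by apply: contrapT => no; apply: nQP => y Qy; apply: contrapT => nPy; apply: no; exists y.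
exists (x * y); split; first exact: primeNM.
move=> P'; rewrite inE => /orP [/eqP ->|P'Ps]; first exact: ideal_mull.
by apply: ideal_mulr; [case: (h P') => //; rewrite inE P'Ps orbT | apply: hx].
Qed.

Lemma nil_of_minimal_primes I x : is_ideal I ->
  (forall P, minimal_over I P -> P x) -> exists k, I (x ^+ k).
Proof.
move=> iI h; apply: contrapT => no.
have [||y Iy [k yE]|P [pP IP PS]] := @exists_prime_disjoint A [set y | exists k, y = x ^+ k] I.
- split; first by exists 0%N.
  by move=> _ _ [k ->] [l ->]; exists (k + l)%N; rewrite exprD.
- exact: iI.
- by apply: no; exists k; rewrite -yE.
have [Ps [_ memPs below]] := minimal_primes_over iI.
have [P' P'Ps P'P] := below P pP IP.
apply: (PS x); last by exists 1%N.
by apply: P'P; apply: h; apply/memPs.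
Qed.

Lemma radical_ideal I : is_ideal I -> is_ideal (radical I).
Proof.
move=> iI; split.
- by exists 1%N; rewrite expr1; apply: ideal0.
- move=> x y [n hx] [m hy]; exists (n + m)%N; rewrite exprDn.
  apply: (ideal_sum _ iI) => i _; rewrite -mulr_natr; apply: (ideal_mulr _ iI).
  have [mi|im] := leqP m i.
    by apply: (ideal_mull _ iI); apply: (idealX iI mi hy).
  have ni : (n <= n + m - i)%N by lia.
  by apply: (ideal_mulr _ iI); apply: (idealX iI ni hx).
- by move=> a x [n hx]; exists n; rewrite exprMn; apply: ideal_mull.
Qed.

Lemma sub_radical I : I `<=` radical I. Proof. by move=> x Ix; exists 1%N. Qed.

Lemma primary_radical_prime Q : primary_ideal Q -> prime_ideal (radical Q).
Proof.
move=> [[iQ nQ1] hQ]; split; first split.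
- exact: radical_ideal.
- by move=> [n]; rewrite expr1n.
move=> x y [n]; rewrite exprMn => /hQ [Qx|[m Qy]]; first by left; exists n.
by right; exists (n * m)%N; rewrite exprM.
Qed.

Lemma colon_stable (M : set A) y : is_ideal M -> exists k, forall z, M (z * y ^+ k.+1) -> M (z * y ^+ k).
Proof.
move=> iM.
have [||N [[iN [k Nk]] _ Nmax]] := @noeth_max A [set K | is_ideal K /\ (exists k, K = colon M (y ^+ k))] M noeth.
- by move=> K [].
- by split=> //; exists 0%N; rewrite expr0; apply/seteqP; split=> z; rewrite /colon /= mulr1.
exists k => z Mz.
have E : colon M (y ^+ k.+1) = N.
  apply: Nmax; first by split; [apply: colon_ideal | exists k.+1].
  by rewrite Nk => w; rewrite /colon /= exprS => Mw; rewrite mulrCA; apply: ideal_mull.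
by have := Mz; rewrite -[M _]/(colon M (y ^+ k.+1) z) E Nk.
Qed.

(** No irreducible ideals are involved. If [x * y] in [M] shows that [M] is not primary and the
    colons of [M] by powers of [y] are stable from [k] on, then [M] is the intersection of its colon
    by [y ^+ k.+1] with [M] plus [y ^+ k.+1], and both are larger. *)
Lemma primary_decomposition_exists I : is_ideal I -> has_primary_decomposition I.
Proof.
move=> iI; apply: contrapT => nI.
have [||M [[iM nM] _ Mmax]] := @noeth_max A [set I | is_ideal I /\ ~ has_primary_decomposition I] I noeth.
- by move=> J [].
- by [].
have [M1|nM1] := pselect (M 1).
  apply: nM; exists 0%N, (fun=> setT); split; first by case.
  by apply/seteqP; split=> [x _ []//|x _]; rewrite -[x]mulr1; apply: ideal_mull.
have [prM|nprM] := pselect (primary_ideal M).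
  apply: nM; exists 1%N, (fun=> M); split=> //.
  by apply/seteqP; split=> [x Mx i _ //|x /(_ ord0 Logic.I)]; apply.
have [x [y [Mxy nMx nry]]] : exists x y, [/\ M (x * y), ~ M x & ~ radical M y].
  apply: contrapT => no; apply: nprM; split=> // x y Mxy; apply: contrapT => /not_orP [nx ny].
  by apply: no; exists x, y.
have ndec K : is_ideal K -> M `<=` K -> ~ K `<=` M -> has_primary_decomposition K.
  move=> iK MK nKM; apply: contrapT => ndK; apply: nKM.
  by rewrite (Mmax K).
have [k stab] := colon_stable y iM.
have stabj j z : M (z * y ^+ (k + j)) -> M (z * y ^+ k).
  elim: j z => [|j IH] z; first by rewrite addn0.
  by rewrite addnS exprS mulrA => /IH; rewrite -mulrA -exprS; apply: stab.
have [k1 [q1 [pq1 E1]]] : has_primary_decomposition (colon M (y ^+ k.+1)).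
  apply: ndec; first exact: colon_ideal.
    by move=> z Mz; apply: ideal_mulr.
  move=> h; apply: nMx; apply: h; rewrite /colon /= exprS mulrA; exact: ideal_mulr.
have [k2 [q2 [pq2 E2]]] : has_primary_decomposition (adj M (y ^+ k.+1)).
  apply: ndec; first exact: adj_ideal.
    exact: sub_adj.
  by move=> h; apply: nry; exists k.+1; apply: h; apply: mem_adj.
apply: nM; exists (k1 + k2)%N, (fun i => match split i with inl a => q1 a | inr a => q2 a end).
split; first by move=> i; case: (split i).
have ME : M = colon M (y ^+ k.+1) `&` adj M (y ^+ k.+1).
  apply/seteqP; split=> [z Mz|z [Mzy [m [a [Mm zE]]]]].
    by split; [apply: ideal_mulr | apply: sub_adj].
  rewrite zE; apply: idealD => //.
  move: Mzy; rewrite /colon /= zE mulrDl => /(idealDl iM (ideal_mulr _ iM Mm)).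
  rewrite -mulrA -exprD => h; rewrite exprS mulrCA; apply: ideal_mull => //.
  by apply: (stabj k.+2); rewrite addSnnS in h.
rewrite ME E1 E2; apply/seteqP; split=> z.
  by move=> [h1 h2] i _; case: (split i) => a; [apply: h1 | apply: h2].
move=> h; split=> i _.
  by have := h (lshift k2 i) Logic.I; rewrite (unsplitK (inl i)).
by have := h (rshift k1 i) Logic.I; rewrite (unsplitK (inr i)).
Qed.
End NoetherianDecomposition.

Section MinimalDecomposition.
Variable A : comPzRingType.
Implicit Types (I J P Q X Y : set A).

Lemma primary_ideal_cap X Y : primary_ideal X -> primary_ideal Y -> radical X = radical Y ->
  primary_ideal (X `&` Y) /\ radical (X `&` Y) = radical X.
Proof.
move=> [[iX nX] hX] [[iY nY] hY] XY.
have rE : radical (X `&` Y) = radical X.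
  apply/seteqP; split=> [z [n [Xz _]]|z rz]; first by exists n.
  have [n Xz] := rz; have [m Yz] : radical Y z by rewrite -XY.
  by exists (n + m)%N; rewrite exprD; split; [apply: ideal_mulr | apply: ideal_mull].
split=> //; split; first by split; [apply: ideal_setI | case].
rewrite rE => x y [/hX [Xx|?] /hY [Yx|]]; by [left | right | rewrite -XY; right].
Qed.

(** A shortest list is minimal: components with equal radicals could be merged and a redundant one
    dropped. *)
Lemma minimal_primary_decomposition_exists I : noetherian A -> is_ideal I ->
  exists k (q : 'I_k -> set A), minimal_primary_decomposition I q.
Proof.
move=> noeth iI.
pose dec (s : seq (set A)) := (forall X, X \in s -> primary_ideal X) /\
  forall x, I x <-> forall X, X \in s -> X x.
have ex : exists n, `[< exists s, dec s /\ size s = n >].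
  have [k [q [pq IE]]] := primary_decomposition_exists noeth iI.
  exists (size (map q (enum 'I_k))); apply/asboolP; exists (map q (enum 'I_k)); split=> //; split.
    by move=> X /mapP [i _ ->].
  rewrite IE => x; split=> [h X /mapP [i _ ->]|h i _]; first exact: h.
  by apply: h; apply: map_f; rewrite mem_enum.
case: (ex_minnP ex) => n /asboolP [s [[ps Is] sn]] min.
have mins s' : dec s' -> (size s <= size s')%N.
  by move=> ds; rewrite sn; apply: min; apply/asboolP; exists s'.
have us : uniq s.
  apply: contrapT => /negP; rewrite -ltn_size_undup ltnNge => /negP; apply.
  apply: mins; split=> [X|x]; rewrite ?mem_undup; first exact: ps.
  by rewrite Is; split=> h X; have := h X; rewrite mem_undup.
exists (size s), (fun i => nth setT s i); split.
- by move=> i; apply: ps; apply: mem_nth.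
- apply/seteqP; split=> x; first by move=> /Is h i _; apply: h; apply: mem_nth.
  move=> h; apply/Is => X /(nthP setT) [i ilt <-]; exact: (h (Ordinal ilt)).
- move=> i j /= rE; apply: val_inj; apply: contrapT => /eqP nij.
  set X := nth setT s i in rE; set Y := nth setT s j in rE.
  have Xs : X \in s by apply: mem_nth.
  have Ys : Y \in s by apply: mem_nth.
  have XY : X != Y by rewrite nth_uniq.
  have [pXY _] := primary_ideal_cap (ps _ Xs) (ps _ Ys) rE.
  have memr Z : (Z \in rem Y (rem X s)) = [&& Z != Y, Z != X & Z \in s].
    by rewrite mem_rem_uniq ?rem_uniq // !inE mem_rem_uniq // !inE.
  have : (size s <= size ((X `&` Y)%classic :: rem Y (rem X s)))%N.
    apply: mins; split=> [Z|x].
      by rewrite inE memr => /orP [/eqP -> //|/and3P [_ _ /ps]].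
    rewrite Is; split=> h Z.
      by rewrite inE memr => /orP [/eqP ->|/and3P [_ _ /h //]]; split; apply: h.
    have [Xx Yx] := h _ (mem_head _ _).
    have [-> //|ZX] := eqVneq Z X; have [-> //|ZY] := eqVneq Z Y.
    by move=> Zs; apply: h; rewrite inE memr ZX ZY Zs orbT.
  have sY : Y \in rem X s by rewrite mem_rem_uniq // !inE eq_sym XY.
  have s0 : (0 < size s)%N by case: (s) Xs.
  have r0 : (0 < size (rem X s))%N by case: (rem X s) sY.
  by rewrite /= (size_rem sY) prednK // (size_rem Xs) leqNgt ltn_predL s0.
- move=> j sub.
  set X := nth setT s j in sub.
  have Xs : X \in s by apply: mem_nth.
  have : (size s <= size (rem X s))%N.
    apply: mins; split=> [Z|x]; first by rewrite mem_rem_uniq // !inE => /andP [_ /ps].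
    rewrite Is; split=> h Z; first by rewrite mem_rem_uniq // !inE => /andP [_ /h].
    have [->|ZX] := eqVneq Z X; last by move=> Zs; apply: h; rewrite mem_rem_uniq // !inE ZX.
    move=> _; apply: sub => i /= nij; apply: h; rewrite mem_rem_uniq // !inE mem_nth // andbT.
    by rewrite nth_uniq.
  by rewrite size_rem // leqNgt ltn_predL; case: (s) Xs.
Qed.

Lemma minimal_decomposition_witness I k (q : 'I_k -> set A) i :
  minimal_primary_decomposition I q -> exists x, ~ q i x /\ forall j, j != i -> q j x.
Proof.
move=> [_ _ _ irr]; apply: contrapT => no; apply: (irr i) => x hx.
by apply: contrapT => nx; apply: no; exists x.
Qed.

(** Let [x] lie in all components except [q i]. What multiplies [x] into [I] lies in [P], and [P]
    lies in the radical of every [q' j] without [x]; by avoidance one of these radicals lies in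
    [P]. *)
Lemma associated_prime_unique I k (q : 'I_k -> set A) k' (q' : 'I_k' -> set A) i :
  minimal_primary_decomposition I q -> (forall j, primary_ideal (q' j)) ->
  I = \bigcap_j q' j -> exists j, radical (q i) = radical (q' j).
Proof.
move=> mq pq' IE'; have [x [nqx hx]] := minimal_decomposition_witness i mq.
have [pq IE _ _] := mq; set P := radical (q i).
have pP : prime_ideal P := primary_radical_prime (pq i).
have col y : I (x * y) -> P y.
  by rewrite IE => /(_ i Logic.I) /(pq i).2 [].
have Pq' j : ~ q' j x -> P `<=` radical (q' j).
  move=> nx y [n qy].
  have : I (x * y ^+ n).
    rewrite IE => l _; have [->|li] := eqVneq l i.
      by apply: ideal_mull => //; case: (pq i) => [[]].
    by apply: ideal_mulr; [case: (pq l) => [[]] | apply: hx].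
  rewrite IE' => /(_ j Logic.I) /(pq' j).2 [//|[m]]; rewrite -exprM => h.
  by exists (n * m)%N.
suff [j [nx sub]] : exists j, ~ q' j x /\ radical (q' j) `<=` P.
  by exists j; apply/seteqP; split=> //; apply: Pq'.
apply: contrapT => no.
have [|z [nPz hz]] := @prime_avoid A [seq q' j | j <- enum 'I_k' & ~~ `[< q' j x >]] P pP.
  move=> Q' /mapP [j]; rewrite mem_filter => /andP [/asboolP nx _] ->; split; first by case: (pq' j) => [[]].
  move=> sub; apply: no; exists j; split=> // y [n /sub Py].
  by move: Py; apply: contraPP => nPy; apply: primeNX.
apply: nPz; apply: col; rewrite IE' => j _.
have iq : is_ideal (q' j) by case: (pq' j) => [[]].
have [qx|nx] := pselect (q' j x); first exact: ideal_mulr.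
apply: ideal_mull => //; apply: hz; apply: map_f; rewrite mem_filter mem_enum andbT; exact/asboolP.
Qed.

(** The pigeonhole principle for monomials in the generators: removing a factor [z] replaces [X] by
    its colon and lowers the exponent of [z] by one. *)
Lemma ideal_pow_gen_sub (s : seq A) (e : A -> nat) X N : is_ideal X ->
  (forall z, z \in s -> X (z ^+ e z)) -> (\sum_(z <- s) e z < N)%N ->
  ideal_pow (ideal_gen [set` s]) N `<=` X.
Proof.
elim: N X e => // N IH X e iX Xs lt.
rewrite /ideal_pow iterS; apply: ideal_gen_min => // _ [x [y [Jx Jy ->]]].
suff : ideal_gen [set` s] `<=` colon X y by move=> /(_ _ Jx).
apply: ideal_gen_min => [|z /= zs]; first exact: colon_ideal.
case ez: (e z) => [|m].
  by have := Xs z zs; rewrite ez => X1; rewrite /colon /= -[_ * _]mul1r; apply: ideal_mulr.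
rewrite /colon /= mulrC; pose e' w := if w == z then m else e w.
apply: (IH (colon X z) e') => //.
- exact: colon_ideal.
- move=> w ws; rewrite /colon /= /e'; case: eqP => [->|_]; last by apply: ideal_mulr => //; apply: Xs.
  by rewrite -exprSr -ez; apply: Xs.
- rewrite ltnS in lt; apply: leq_trans lt.
  rewrite !(big_rem z zs) /= /e' eqxx ez addSn ltnS leq_add2l.
  by apply: leq_sum => w _; case: eqP => // ->; rewrite ez.
Qed.

End MinimalDecomposition.

Section Extension.
Variables (A B : comPzRingType) (f : {rmorphism A -> B}).
Implicit Types (I : set A) (J : set B).

Lemma ideal_ext_ideal I : is_ideal (ideal_ext f I).
Proof. exact: ideal_gen_ideal. Qed.

Lemma mem_ideal_ext I a : I a -> ideal_ext f I (f a).
Proof. by move=> Ia; apply: sub_ideal_gen; exists a. Qed.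

Lemma ideal_extS I I' : I `<=` I' -> ideal_ext f I `<=` ideal_ext f I'.
Proof. by move=> h; apply: ideal_genS => _ [a /h Ia <-]; exists a. Qed.

Lemma ideal_ext_min I J : is_ideal J -> I `<=` f @^-1` J -> ideal_ext f I `<=` J.
Proof. by move=> iJ h; apply: ideal_gen_min => // _ [a /h Ia <-]. Qed.

Lemma comap_ideal J : is_ideal J -> is_ideal (f @^-1` J).
Proof.
move=> iJ; split=> /=; first by rewrite rmorph0; apply: ideal0.
  by move=> x y; rewrite rmorphD; apply: idealD.
by move=> a x; rewrite rmorphM; apply: ideal_mull.
Qed.

Lemma ideal_ext_gen (X : set A) : ideal_ext f (ideal_gen X) = ideal_gen (f @` X).
Proof.
apply/seteqP; split.
  apply: ideal_ext_min; first exact: ideal_gen_ideal.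
  apply: ideal_gen_min; first by apply: comap_ideal; apply: ideal_gen_ideal.
  by move=> x Xx; apply: sub_ideal_gen; exists x.
by apply: ideal_gen_min => [|_ [x Xx <-]]; [apply: ideal_gen_ideal | apply: mem_ideal_ext; apply: sub_ideal_gen].
Qed.
End Extension.

Lemma frobenius_power_ext p n (A B : comNzRingType) (f : {rmorphism A -> B}) (I : set A) :
  p \in [pchar B] ->
  frobenius_power p n (ideal_ext f I) = ideal_ext f (frobenius_power p n I).
Proof.
move=> charB; rewrite /ideal_ext frobenius_power_gen // -/(ideal_ext f _) ideal_ext_gen.
congr ideal_gen; apply/seteqP; split=> [_ [_ [a Ia <-] <-]|_ [_ [a Ia <-] <-]].
  by exists (a ^+ (p ^ n)%N); rewrite ?rmorphXn //; exists a.
by exists (f a); rewrite ?rmorphXn //; exists a.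
Qed.

(** * Closure operations compatible with colons, intersections and Frobenius powers *)

Section ClosureDecomposition.
Variables (p : nat) (A R : comNzRingType) (iota : {rmorphism A -> R}).
Hypotheses (charA : p \in [pchar A]) (charR : p \in [pchar R]).
Hypotheses (regA : regular_ring A) (noethR : noetherian R).
Hypotheses (inj_iota : injective iota) (integral_iota : integralRange iota).
Implicit Types (I : set A) (Q : set R).

Local Notation fp := (frobenius_power p).

(** The operation is defined on ideals of [A], not of [R], since flatness controls colons and
    intersections only for ideals and elements coming from [A]. *)
Record ideal_closure (c : set A -> set R) : Prop := IdealClosure {
  closure_ideal : forall I, is_ideal I -> is_ideal (c I);
  closure_ext : forall I, is_ideal I -> ideal_ext iota I `<=` c I;
  closure_colon : forall I s r, is_ideal I -> c I (iota s * r) -> c (colon I s) r;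
  closure_cap : forall I I', is_ideal I -> is_ideal I' -> c I `&` c I' `<=` c (I `&` I');
  closureS : forall I I', is_ideal I -> is_ideal I' -> I `<=` I' -> c I `<=` c I';
  closure_frobenius : forall I r, is_ideal I -> c (fp 1 I) (r ^+ p) <-> c I r;
  closure_prime : forall P Q, prime_ideal Q -> iota @^-1` Q = P -> c P `<=` Q }.

(** By incomparability the primes over [P j] are minimal over its extension, hence finite in
    number. *)
Lemma primes_over_index (k : nat) (P : 'I_k -> set A) : injective P -> (forall l, prime_ideal (P l)) ->
  exists (m : nat) (l : 'I_m -> 'I_k) (Q : 'I_m -> set R),
    [/\ forall i, prime_ideal (Q i), forall i, iota @^-1` Q i = P (l i), injective Q &
        forall j X, prime_ideal X -> iota @^-1` X = P j -> exists i, l i = j /\ Q i = X].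
Proof.
move=> injP pP.
have /choice [Ps hPs] : forall j, exists s : seq (set R), forall X,
    prime_ideal X -> iota @^-1` X = P j -> X \in s.
  move=> j; have [s [_ hs _]] := minimal_primes_over noethR (ideal_ext_ideal iota (P j)).
  exists s => X pX XE; apply/hs; split=> //.
    by apply: ideal_ext_min; [apply: prime_ideal_ideal | rewrite XE].
  move=> Y pY PY YX; apply/seteqP; split=> //.
  apply: (incomparable integral_iota pY pX YX); rewrite XE => a Pa.
  by apply: PY; apply: mem_ideal_ext.
pose s := undup [seq X <- flatten [seq Ps j | j <- enum 'I_k] |
  `[< prime_ideal X /\ exists j, iota @^-1` X = P j >]].
have sP X : X \in s <-> prime_ideal X /\ exists j, iota @^-1` X = P j.
  rewrite mem_undup mem_filter; split=> [/andP [/asboolP]//|h].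
  apply/andP; split; first exact/asboolP.
  have [pX [j XE]] := h; apply/flattenP; exists (Ps j); last exact: hPs.
  by apply: map_f; rewrite mem_enum.
have Qs i : tnth (in_tuple s) i \in s by apply: mem_tnth.
have /choice [l hl] : forall i, exists j, iota @^-1` (tnth (in_tuple s) i) = P j.
  by move=> i; have [_] := (sP _).1 (Qs i).
exists (size s), l, (tnth (in_tuple s)); split=> //.
- by move=> i; have [] := (sP _).1 (Qs i).
- by apply/tuple_uniqP; apply: undup_uniq.
move=> j X pX XE; have /tnthP [i Xi] : X \in in_tuple s by apply/sP; split=> //; exists j.
by exists i; split=> //; apply: injP; rewrite -XE -hl Xi.
Qed.

Variable c : set A -> set R.
Hypothesis cc : ideal_closure c.
Variables (b : set A) (k : nat) (q : 'I_k -> set A).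
Hypothesis b_dec : minimal_primary_decomposition b q.
Variables (m : nat) (l : 'I_m -> 'I_k) (Q : 'I_m -> set R).
Hypotheses (prQ : forall i, prime_ideal (Q i))
  (comapQ : forall i, iota @^-1` Q i = radical (q (l i))) (injQ : injective Q)
  (coverQ : forall j X, prime_ideal X -> iota @^-1` X = radical (q j) ->
     exists i, l i = j /\ Q i = X).

Definition component n i := sat (Q i) (c (fp n (q (l i)))).

Let prim i : primary_ideal (q i) := let: And4 h _ _ _ := b_dec in h i.
Let qi i : is_ideal (q i). Proof. by case: (prim i) => [[]]. Qed.
Let bE : b = \bigcap_i q i. Proof. by case: b_dec. Qed.
Let ib : is_ideal b.
Proof.
rewrite bE; split.
- by move=> i _; apply: ideal0.
- by move=> x y hx hy i _; apply: idealD; [|apply: hx|apply: hy].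
- by move=> a x hx i _; apply: ideal_mull; [|apply: hx].
Qed.
Let fpi n I : is_ideal (fp n I). Proof. exact: ideal_gen_ideal. Qed.
Let cfpi n I : is_ideal (c (fp n I)). Proof. exact: closure_ideal. Qed.
Let Qi i : is_ideal (Q i) := prime_ideal_ideal (prQ i).

Lemma component_ideal n i : is_ideal (component n i).
Proof. exact: sat_ideal. Qed.

Lemma component_sub n i : component n i `<=` Q i.
Proof.
apply: sat_sub_prime => //.
apply: subset_trans (closure_prime cc (prQ i) (comapQ i)).
apply: closureS => //; first by apply: radical_ideal.
apply: subset_trans (@sub_radical _ _); exact: frobenius_power_sub.
Qed.

(** Some [t * z ^+ e] with [t] outside [Q i] lies in the extension of the primary ideal, and its
    Frobenius powers give one [e] for all [n]. Linear growth comes from here. *)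
Lemma component_power i z : Q i z -> exists e, forall n, component n i (z ^+ (e * p ^ n)%N).
Proof.
move=> Qz.
have [t [e [nt h]]] : exists t e, ~ Q i t /\ ideal_ext iota (q (l i)) (t * z ^+ e).
  apply: contrapT => no.
  have [|X [pX qX XQ nXz]] := @exists_prime_notin R (Q i) (ideal_ext iota (q (l i))) z (prQ i) (ideal_ext_ideal _ _).
    by move=> t e nt h; apply: no; exists t, e.
  apply: nXz; apply: (incomparable integral_iota pX (prQ i) XQ) Qz.
  rewrite comapQ => a [n qa] /=.
  have : X (iota (a ^+ n)) by apply: qX; apply: mem_ideal_ext.
  by rewrite rmorphXn; apply: contraPP => nX; apply: primeNX.
exists e => n; exists (t ^+ (p ^ n)%N); split; first exact: primeNX.
rewrite exprM -exprMn; apply: (closure_ext cc) => //.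
by rewrite -frobenius_power_ext //; apply: mem_frobenius_power.
Qed.

Lemma component_primary n i : primary_ideal (component n i).
Proof.
split; first split; first exact: component_ideal.
  by move=> /component_sub; apply: prime1.
move=> x y [u [nu h]]; have [Qy|nQy] := pselect (Q i y).
  by right; have [e he] := component_power Qy; exists (e * p ^ n)%N.
left; exists (u * y); split; first exact: primeNM.
by rewrite -mulrA (mulrC y).
Qed.

Lemma component_radical n i : radical (component n i) = Q i.
Proof.
apply/seteqP; split=> [z [e /component_sub]|z Qz]; last first.
  by have [e he] := component_power Qz; exists (e * p ^ n)%N.
by apply: contraPP => nX; apply: primeNX.
Qed.

Lemma component_frobenius n i r : component n.+1 i (r ^+ p) <-> component n i r.
Proof.
rewrite /component -addn1 -frobenius_powerD //; split=> [[u [nu h]]|[u [nu h]]].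
  exists u; split=> //; apply/(closure_frobenius cc) => //.
  rewrite exprMn -(prednK (prime_gt0 (pcharf_prime charA))) exprS -mulrA.
  by rewrite mulrCA prednK ?(prime_gt0 (pcharf_prime charA)) //; apply: ideal_mull.
exists (u ^+ p); split; first exact: primeNX.
by rewrite -exprMn; apply/(closure_frobenius cc).
Qed.

Lemma closure_components n : c (fp n b) = \bigcap_i component n i.
Proof.
apply/seteqP; split=> [r cr i _|r hr].
  apply: sub_sat => //; apply: (closureS cc) cr => //; apply: frobenius_powerS.
  by rewrite bE => x; apply.
have cq j : c (fp n (q j)) r.
  apply: contrapT => ncr.
  (* An [s] outside the radical of [q j] cannot lie in the contraction of [J], since [q j] is its
     own colon by [s] and [s] could be cancelled. So some [Q i] over this radical contains [J],
     which contradicts the membership of [r] in component [i]. *)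
  pose J := colon (c (fp n (q j))) r.
  have iJ : is_ideal J by apply: colon_ideal.
  have [|X [pX JX XE]] := lying_over integral_iota iJ (primary_radical_prime (prim j)).
    move=> s Js; apply: contrapT => ns; apply: ncr.
    have := closure_colon cc (fpi _ _) Js; apply: (closureS cc) => //; first exact: colon_ideal.
    move=> a fa; suff : fp n (colon (q j) s) a.
      apply: frobenius_powerS => a' qa'; have [//|ra] := (prim j).2 _ _ qa'.
      by case: ns.
    apply: (frobenius_power_colon charA regA) => //.
    rewrite -(prednK (_ : 0 < p ^ n)%N) ?expn_gt0 ?(prime_gt0 (pcharf_prime charA)) //.
    by rewrite exprS mulrA; apply: (ideal_mulr _ (fpi n (q j))).
  have [i [li QX]] := coverQ pX XE.
  have [u [nu cu]] := hr i Logic.I; apply: nu; rewrite QX; apply: JX.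
  by move: cu; rewrite li.
suff h (s : seq 'I_k) : is_ideal [set x | forall j, j \in s -> q j x] /\
    c (fp n [set x | forall j, j \in s -> q j x]) r.
  have [is' hs] := h (enum 'I_k); apply: (closureS cc) hs => //; apply: frobenius_powerS => x hx.
  by rewrite bE => j _; apply: hx; rewrite mem_enum.
elim: s => [|j s [iI cI]].
  have -> : [set x : A | forall j : 'I_k, j \in [::] -> q j x] = setT by apply/seteqP.
  split; first exact: ideal_setT.
  rewrite -[r]mulr1; apply: ideal_mull => //; apply: (closure_ext cc) => //.
  rewrite -(rmorph1 iota); apply: mem_ideal_ext.
  by rewrite -(expr1n _ (p ^ n)%N); apply: mem_frobenius_power.
have -> : [set x | forall i, i \in j :: s -> q i x] = q j `&` [set x | forall j, j \in s -> q j x].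
  apply/seteqP; split=> [x hx|x [hj hs] i]; last by rewrite inE => /orP [/eqP ->|/hs].
  by split=> [|i is_]; apply: hx; rewrite ?mem_head // inE is_ orbT.
split; first exact: ideal_setI.
by rewrite -(frobenius_power_capI charA regA) //; apply: (closure_cap cc).
Qed.

(** To see that component [j] is irredundant, take [x] in all primary ideals of [b] but the one
    below it, and [u] outside [Q j] in all other components over the same prime of [A]. Then [u]
    times a Frobenius power of [x] is in every component except [j]. *)
Lemma components_minimal n : minimal_primary_decomposition (c (fp n b)) (component n).
Proof.
split; [exact: component_primary | exact: closure_components | |].
  by move=> i j; rewrite !component_radical => /injQ.
move=> j sub; have [x [nqx hx]] := minimal_decomposition_witness (l j) b_dec.
have [|u [nQu hu]] := @prime_avoid R [seq component n i | i <- enum 'I_m & (i != j) && (l i == l j)] (Q j) (prQ j).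
  move=> Y /mapP [i]; rewrite mem_filter => /andP [/andP [ij /eqP lij] _] ->.
  split; first exact: component_ideal.
  move=> h; move/eqP: ij; apply; apply: injQ; apply/seteqP.
  have QQ : Q i `<=` Q j.
    move=> z /component_power [e /(_ n) /h]; apply: contraPP => nQ; exact: primeNX.
  split=> //; apply: (incomparable integral_iota (prQ i) (prQ j) QQ).
  by rewrite !comapQ lij.
have iC i : is_ideal (component n i) := component_ideal n i.
have [v [nv cv]] : component n j (u * iota (x ^+ (p ^ n)%N)).
  apply: sub => i /= ij; have [lij|lij] := eqVneq (l i) (l j).
    by apply: ideal_mulr => //; apply: hu; apply: map_f; rewrite mem_filter ij lij eqxx mem_enum.
  apply: ideal_mull => //; apply: sub_sat => //; apply: (closure_ext cc) => //.
  by apply: mem_ideal_ext; apply: mem_frobenius_power; apply: hx.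
have nvu : ~ Q j (v * u) by apply: primeNM.
apply: nvu; apply: (closure_prime cc (prQ j) (comapQ j)).
move: cv; rewrite mulrA mulrC => /(closure_colon cc (fpi _ _)); apply: (closureS cc).
- exact: colon_ideal.
- exact: radical_ideal.
move=> a /(frobenius_power_colon charA regA (qi _)) /(frobenius_power_sub charA (colon_ideal _ (qi _))).
by rewrite /colon /= mulrC => /(prim (l j)).2 [].
Qed.

Lemma ass_closure n : ass (c (fp n b)) = range Q.
Proof.
apply/seteqP; split=> [P [k' [q' [mq [i ->]]]]|P [i _ <-]].
  have [j ->] := associated_prime_unique i mq (component_primary n) (closure_components n).
  by rewrite component_radical; exists j.
exists m, (component n); split; first exact: components_minimal.
by exists i; rewrite component_radical.
Qed.

Lemma closure_f_sequence : f_sequence p (fun n => c (fp n b)).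
Proof.
split=> n //; apply/seteqP.
by rewrite -addn1 -frobenius_powerD //; split=> r /(closure_frobenius cc _ (fpi _ _)).
Qed.

Lemma components_f_sequence i : f_sequence p (fun n => component n i).
Proof.
split=> n; first exact: component_ideal.
by apply/seteqP; split=> r /component_frobenius.
Qed.

Hypothesis nb1 : ~ b 1.

Lemma component_exists : exists i : 'I_m, True.
Proof.
have [j _] : exists j : 'I_k, ~ q j 1.
  by apply: contrapT => no; apply: nb1; rewrite bE => j _; apply: contrapT => h; apply: no; exists j.
have [|X [pX _ XE]] := lying_over integral_iota (@ideal_zero R) (primary_radical_prime (prim j)).
  move=> a /=; rewrite -(rmorph0 iota) => /inj_iota ->; apply: ideal0; exact: radical_ideal.
by have [i _] := coverQ pX XE; exists i.
Qed.

Lemma closure_proper n : proper_ideal (c (fp n b)).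
Proof.
split=> //; rewrite closure_components; have [i _] := component_exists => /(_ i Logic.I).
by move/component_sub; apply: prime1.
Qed.

Lemma closure_linear_growth : linear_growth p (fun n => c (fp n b)).
Proof.
split; [exact: closure_f_sequence | exact: closure_proper |].
have /choice [h hh] : forall i, exists h, forall n N, (h < N)%N ->
    ideal_pow (fp n (Q i)) N `<=` component n i.
  move=> i; have [s Qs] := noethR (Qi i).
  have /choice [e he] : forall z, exists e, Q i z -> forall n, component n i (z ^+ (e * p ^ n)%N).
    move=> z; have [/component_power [e he]|] := pselect (Q i z); first by exists e.
    by move=> nQ; exists 0%N.
  (* The inner sum is an exponent common to all generators; the outer one is the count made by
     [ideal_pow_gen_sub]. *)
  exists (\sum_(z <- s) \sum_(z <- s) e z)%N => n N ltN; rewrite [in fp n _]Qs frobenius_power_gen //.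
  have -> : (fun x : R => x ^+ (p ^ n)%N) @` [set` s] = [set` [seq x ^+ (p ^ n)%N | x <- s]].
    apply/seteqP; split=> [_ [x /= xs <-]|_ /mapP [x xs ->]]; last by exists x.
    by apply/mapP; exists x.
  apply: (@ideal_pow_gen_sub _ _ (fun=> (\sum_(z <- s) e z)%N)); first exact: component_ideal.
    move=> _ /mapP [x xs ->]; rewrite -exprM mulnC; apply: (@idealX _ _ _ (e x * p ^ n)).
    - exact: component_ideal.
    - by rewrite leq_mul2r (big_rem x xs) leq_addr orbT.
    - by apply: he; rewrite Qs; apply: sub_ideal_gen.
  by rewrite big_map.
exists (\sum_i h i).+1; split=> // n; exists m, (component n); split; first exact: components_minimal.
move=> i; rewrite component_radical; apply: hh.
by rewrite ltnS (bigD1 i) //= leq_addr.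
Qed.

End ClosureDecomposition.

Lemma expr_pB p (W : comNzRingType) (charW : p \in [pchar W]) n (x y : W) :
  (x - y) ^+ (p ^ n)%N = x ^+ (p ^ n)%N - y ^+ (p ^ n)%N.
Proof. by apply: (addIr (y ^+ (p ^ n)%N)); rewrite -(expr_pD charW) !subrK. Qed.

Lemma frobenius_field_inj p (E : fieldType) (charE : p \in [pchar E]) (x y : E) :
  x ^+ p = y ^+ p -> x = y.
Proof.
move=> e; have : (x - y) ^+ (p ^ 1)%N == 0 by rewrite (expr_pB charE) !expn1 e subrr.
by rewrite expf_eq0 subr_eq0 => /andP [_ /eqP].
Qed.

Lemma closed_field_root (E : closedFieldType) n (y : E) : (0 < n)%N -> exists z, z ^+ n = y.
Proof.
move=> n0; have [z ze] := solve_monicpoly (fun i => if i == 0%N then y else 0) n0.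
exists z; rewrite ze; case: n n0 {ze} => // n _.
by rewrite big_ord_recl expr0 mulr1 big1 ?addr0 // => i _; rewrite mul0r.
Qed.

Section Subring.
Variables (W : comNzRingType) (D : set W).
Hypotheses (D1 : D 1) (DB : forall x y, D x -> D y -> D (x - y))
  (DM : forall x y, D x -> D y -> D (x * y)).

Let mem_D : pred W := fun z => `[< D z >].

Let subring_D : subring_closed mem_D.
Proof.
split; first exact/asboolP.
  by move=> x y /asboolP Dx /asboolP Dy; apply/asboolP; apply: DB.
by move=> x y /asboolP Dx /asboolP Dy; apply/asboolP; apply: DM.
Qed.
HB.instance Definition _ := GRing.isSubringClosed.Build W mem_D subring_D.

Record subring_type := SubringType { subring_val : W; _ : mem_D subring_val }.
HB.instance Definition _ := [isSub for subring_val].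
HB.instance Definition _ := [Choice of subring_type by <:].
HB.instance Definition _ := [SubChoice_isSubComNzRing of subring_type by <:].

Lemma subring_exists : exists (T : comNzRingType) (v : {rmorphism T -> W}),
  injective v /\ forall w, D w <-> exists t, v t = w.
Proof.
exists subring_type, (val : subring_type -> W); split; first exact: val_inj.
move=> w; split=> [Dw|[[t /= /asboolP Dt] <-]//].
by have mw : mem_D w by [apply/asboolP]; exists (SubringType mw).
Qed.
End Subring.

Lemma rmorphism_corestrict (R T W : comNzRingType) (v : {rmorphism T -> W})
    (f : {rmorphism R -> W}) : injective v -> (forall r, exists t, v t = f r) ->
  exists g : {rmorphism R -> T}, forall r, v (g r) = f r.
Proof.
move=> injv /choice [g gE].
have addg : zmod_morphism g by move=> x z; apply: injv; rewrite rmorphB !gE rmorphB.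
have mulg : monoid_morphism g.
  by split; [apply: injv | move=> x z; apply: injv]; rewrite ?rmorphM ?rmorph1 !gE ?rmorph1 ?rmorphM.
pose ga := GRing.isZmodMorphism.Build R T g addg.
pose gm := GRing.isMonoidMorphism.Build R T g mulg.
by exists (HB.pack_for {rmorphism R -> T} g ga gm).
Qed.

Lemma inj_surj_bijective (X Y : Type) (f : X -> Y) :
  injective f -> (forall y, exists x, f x = y) -> bijective f.
Proof.
by move=> inj /choice [g gK]; exists g => // x; apply: inj; rewrite gK.
Qed.

(** * The perfect closure *)

Section PerfectClosure.
Variables (p : nat) (R Rinf : comNzRingType) (psi0 : {rmorphism R -> Rinf}).
Hypotheses (charR : p \in [pchar R]) (noethR : noetherian R).
Hypothesis perfR : is_perfect_closure p psi0.

Let charI : p \in [pchar Rinf] := perfR.1.1.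
Let bij : bijective (fun x : Rinf => x ^+ p) := perfR.1.2.
Let p_gt0 : (0 < p)%N := prime_gt0 (pcharf_prime charR).

Lemma frobenius_inj n : injective (fun x : Rinf => x ^+ (p ^ n)%N).
Proof.
elim: n => [|n IH] x y /=; first by rewrite expn0 !expr1.
by rewrite expnSr !exprM => /(bij_inj bij) /IH.
Qed.

Lemma frobenius_surj n (y : Rinf) : exists x, x ^+ (p ^ n)%N = y.
Proof.
elim: n y => [|n IH] y; first by exists y; rewrite expn0 expr1.
have [g _ gK] := bij; have [x xE] := IH (g y).
by exists x; rewrite expnSr exprM xE; apply: gK.
Qed.

Lemma psiX n r : psi p psi0 n r ^+ (p ^ n)%N = psi0 r.
Proof.
rewrite /psi; case: xgetP => // no; have [x xE] := frobenius_surj n (psi0 r).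
by have := no x; rewrite /= xE.
Qed.

Lemma psi_unique n r y : y ^+ (p ^ n)%N = psi0 r -> y = psi p psi0 n r.
Proof. by rewrite -(psiX n r) => /frobenius_inj. Qed.

Lemma psiD n r s : psi p psi0 n (r + s) = psi p psi0 n r + psi p psi0 n s.
Proof. by apply/esym/psi_unique; rewrite (expr_pD charI) !psiX rmorphD. Qed.

Lemma psiM n r s : psi p psi0 n (r * s) = psi p psi0 n r * psi p psi0 n s.
Proof. by apply/esym/psi_unique; rewrite exprMn !psiX rmorphM. Qed.

Lemma psi_shift n k r : psi p psi0 (n + k) (r ^+ (p ^ k)%N) = psi p psi0 n r.
Proof. by apply/esym/psi_unique; rewrite expnD exprM psiX rmorphXn. Qed.

(** The elements with some [p ^ n]-th power in the image of [psi0] form a perfect subring. The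
    universal map to it, followed by the inclusion, is the identity by uniqueness. *)
Lemma psi_surj (y : Rinf) : exists n r, y = psi p psi0 n r.
Proof.
suff [n [r yE]] : exists n r, y ^+ (p ^ n)%N = psi0 r by exists n, r; apply: psi_unique.
pose D := [set y : Rinf | exists n r, y ^+ (p ^ n)%N = psi0 r].
have [|x1 x2 [n [r e1]] [k [s e2]]|x1 x2 [n [r e1]] [k [s e2]]|T [v [injv vD]]] := @subring_exists Rinf D.
- by exists 0%N, 1; rewrite expr1n rmorph1.
- exists (n + k)%N, (r ^+ (p ^ k)%N - s ^+ (p ^ n)%N); rewrite rmorphB !rmorphXn -e1 -e2.
  by rewrite (expr_pB charI) -!exprM -!expnD (addnC k).
- exists (n + k)%N, (r ^+ (p ^ k)%N * s ^+ (p ^ n)%N); rewrite rmorphM !rmorphXn -e1 -e2.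
  by rewrite exprMn -!exprM -!expnD (addnC k).
have [g gE] : exists g : {rmorphism R -> T}, forall r, v (g r) = psi0 r.
  by apply: rmorphism_corestrict => // r; apply/vD; exists 0%N, r; rewrite expn0 expr1.
have perfT : perfect_ring p T.
  split.
    rewrite inE (pcharf_prime charR) /=; apply/eqP; apply: injv.
    by rewrite rmorph_nat rmorph0 (pcharf0 charI).
  apply: inj_surj_bijective => [x z /= e|z].
    by apply: injv; apply: (bij_inj bij); rewrite /= -!rmorphXn e.
  have [w we] := frobenius_surj 1 (v z).
  have [t te] : exists t, v t = w.
    have [n [r ze]] : D (v z) by apply/vD; exists z.
    by apply/vD; exists n.+1, r; rewrite expnS -[(_ * _)%N]/(p ^ 1 * _)%N exprM we ze.
  by exists t; apply: injv; rewrite rmorphXn te -we expn1.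
have [h [hE _]] := perfR.2 T g perfT.
have [h' [_ uniq]] := perfR.2 Rinf psi0 perfR.1.
have [e1 e2] : h' y = y /\ h' y = v (h y).
  split; apply/esym.
    by apply: (uniq idfun).
  by apply: (uniq (v \o h)) => r /=; rewrite hE gE.
by have [n [r yE]] : D y by [apply/vD; exists (h y); rewrite -e2 e1]; exists n, r.
Qed.

(** An algebraically closed field receiving [R] with kernel [P] is perfect, so the map to it factors
    through [Rinf]. *)
Lemma perfect_closure_ker r P : psi0 r = 0 -> prime_ideal P -> P r.
Proof.
move=> r0 pP; have [E [h hE]] := closed_field_of_prime pP.
have charE : p \in [pchar E] := rmorph_pchar h charR.
have perfE : perfect_ring p E.
  split=> //; apply: inj_surj_bijective => [x y /= e|y]; last exact: closed_field_root.
  exact: frobenius_field_inj charE _ _ e.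
have [h' [h'E _]] := perfR.2 E h perfE.
by apply/hE; rewrite -h'E r0 rmorph0.
Qed.

Lemma nilpotent_difference r s : psi0 r = psi0 s ->
  exists k, r ^+ (p ^ k)%N = s ^+ (p ^ k)%N.
Proof.
move=> e; have [||k rs0] := @nil_of_minimal_primes R noethR [set 0] (r - s).
- exact: ideal_zero.
- by move=> P [pP _ _]; apply: perfect_closure_ker pP; rewrite rmorphB e subrr.
exists k; apply/eqP; rewrite -subr_eq0 -(expr_pB charR).
have /subnK <- : (k <= p ^ k)%N by apply/ltnW/ltn_expl/prime_gt1/(pcharf_prime charR).
by rewrite exprD (_ : _ ^+ k = 0) ?mulr0.
Qed.

Section FSequence.
Variable a : nat -> set R.
Hypothesis fa : f_sequence p a.

Lemma f_sequenceX n k r : a (n + k) (r ^+ (p ^ k)%N) <-> a n r.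
Proof.
elim: k => [|k IH]; first by rewrite addn0 expr1.
by rewrite -IH -(fa.2 (n + k)%N) addnS /= -exprM -expnSr.
Qed.

Lemma mem_corresponding_ideal n r : corresponding_ideal p psi0 a (psi p psi0 n r) <-> a n r.
Proof.
split=> [[k _ [s aks e]]|anr]; last by exists n => //; exists r.
have e0 : psi0 (s ^+ (p ^ n)%N) = psi0 (r ^+ (p ^ k)%N).
  by rewrite !rmorphXn -(psiX k s) -(psiX n r) -e -!exprM mulnC.
have [j] := nilpotent_difference e0; rewrite -!exprM -!expnD => ej.
apply/(f_sequenceX n (k + j)); rewrite -ej addnCA.
exact/f_sequenceX.
Qed.

Lemma psi_common_level (x y : Rinf) :
  exists n r s, x = psi p psi0 n r /\ y = psi p psi0 n s.
Proof.
have [n [r ->]] := psi_surj x; have [k [s ->]] := psi_surj y.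
exists (n + k)%N, (r ^+ (p ^ k)%N), (s ^+ (p ^ n)%N).
by split; rewrite ?psi_shift // addnC psi_shift.
Qed.

Lemma corresponding_ideal_ideal : is_ideal (corresponding_ideal p psi0 a).
Proof.
split.
- have <- : psi p psi0 0 0 = 0 by apply/esym/psi_unique; rewrite expr1 rmorph0.
  by apply/mem_corresponding_ideal; apply: ideal0 (fa.1 _).
- move=> x y; have [n [r [s [-> ->]]]] := psi_common_level x y.
  rewrite -psiD => /mem_corresponding_ideal hr /mem_corresponding_ideal hs.
  by apply/mem_corresponding_ideal; apply: idealD (fa.1 _) _ _.
- move=> x y; have [n [r [s [-> ->]]]] := psi_common_level x y.
  rewrite -psiM => /mem_corresponding_ideal hs.
  by apply/mem_corresponding_ideal; apply: ideal_mull (fa.1 _) _.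
Qed.

Lemma corresponding_ideal_primary : (forall n, primary_ideal (a n)) ->
  primary_ideal (corresponding_ideal p psi0 a).
Proof.
move=> pa; split; first split; first exact: corresponding_ideal_ideal.
  have <- : psi p psi0 0 1 = 1 by apply/esym/psi_unique; rewrite expr1 rmorph1.
  by move/mem_corresponding_ideal; case: (pa 0%N) => [[]].
move=> x y; have [n [r [s [-> ->]]]] := psi_common_level x y.
rewrite -psiM => /mem_corresponding_ideal /(pa n).2 [ar|[k ask]].
  by left; apply/mem_corresponding_ideal.
right; exists k; have <- : psi p psi0 n (s ^+ k) = psi p psi0 n s ^+ k.
  by apply/esym/psi_unique; rewrite -exprM mulnC exprM psiX rmorphXn.
exact/mem_corresponding_ideal.
Qed.
End FSequence.

Lemma corresponding_primary_decomposition a m (comp : nat -> 'I_m -> set R) :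
  f_sequence p a -> (forall i, f_sequence p (fun n => comp n i)) ->
  (forall n i, primary_ideal (comp n i)) -> (forall n, a n = \bigcap_i comp n i) ->
  has_primary_decomposition (corresponding_ideal p psi0 a).
Proof.
move=> fa fc pc aE; exists m, (fun i => corresponding_ideal p psi0 (fun n => comp n i)).
split=> [i|]; first exact: corresponding_ideal_primary.
apply/seteqP; split=> x; have [n [r ->]] := psi_surj x.
  move=> /(mem_corresponding_ideal fa); rewrite aE => h i _.
  by apply/(mem_corresponding_ideal (fc i)); apply: h.
move=> h; apply/(mem_corresponding_ideal fa); rewrite aE => i _.
exact/(mem_corresponding_ideal (fc i))/h.
Qed.
End PerfectClosure.

Section ExtN.
Variables (A B : comNzRingType) (g : {rmorphism A -> B}) (N : set B).
Hypothesis sN : submodule g N.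

Lemma extN_submodule X : submodule g (extN g N X).
Proof.
split.
- by exists 0%N, (fun=> 0), (fun=> 0); split=> [[]//|[]//|]; rewrite big_ord0.
- move=> x y [n [c [v [Xc Nv ->]]]] [m [c' [v' [Xc' Nv' ->]]]].
  exists (n + m)%N, (fun i => match split i with inl j => c j | inr j => c' j end),
    (fun i => match split i with inl j => v j | inr j => v' j end).
  split=> [i|i|]; [by case: split | by case: split |].
  rewrite big_split_ord /=; congr (_ + _); apply: eq_bigr => i _.
    by rewrite (unsplitK (inl i)).
  by rewrite (unsplitK (inr i)).
- move=> a x [n [c [v [Xc Nv ->]]]]; exists n, c, (fun i => g a * v i); split=> //.
    by move=> i; apply: (submoduleZ _ sN).
  by rewrite mulr_sumr; apply: eq_bigr => i _; rewrite mulrCA.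
Qed.

Lemma mem_extN (X : set A) a z : X a -> N z -> extN g N X (g a * z).
Proof.
by move=> Xa Nz; exists 1%N, (fun=> a), (fun=> z); split=> //; rewrite big_ord_recl big_ord0 addr0.
Qed.

Lemma extNS (X Y : set A) : X `<=` Y -> extN g N X `<=` extN g N Y.
Proof. by move=> XY _ [n [c [v [Xc Nv ->]]]]; exists n, c, v; split=> // i; apply: XY. Qed.

Lemma extN_gen (X : set A) : extN g N (ideal_gen X) `<=` extN g N X.
Proof.
move=> _ [n [c [v [Xc Nv ->]]]]; apply: (submodule_sum _ (extN_submodule X)) => i _.
have iX : is_ideal [set a | forall z, N z -> extN g N X (g a * z)].
  have sX := extN_submodule X; split.
  - by move=> z _; rewrite rmorph0 mul0r; apply: submodule0 sX.
  - by move=> a a' ha ha' z Nz; rewrite rmorphD mulrDl; apply: (submoduleD sX); [apply: ha | apply: ha'].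
  - by move=> a a' ha z Nz; rewrite rmorphM -mulrA; apply: (submoduleZ _ sX); apply: ha.
by apply: (ideal_gen_min iX _ (Xc i)) => // a Xa z Nz; apply: mem_extN.
Qed.
End ExtN.

Lemma plus_closure_ideal (R : comNzRingType) (b : set R) : is_ideal (plus_closure b).
Proof.
split.
- apply/plus_closureE => P mP E h _; rewrite rmorph0; apply: (submodule0 (extN_submodule (integral_closure_submodule h) _)).
- move=> x y /plus_closureE hx /plus_closureE hy; apply/plus_closureE => P mP E h kh.
  rewrite rmorphD; apply: (submoduleD (extN_submodule (integral_closure_submodule h) _)).
    exact: hx mP _ _ kh.
  exact: hy mP _ _ kh.
- move=> a x /plus_closureE hx; apply/plus_closureE => P mP E h kh.
  rewrite rmorphM; apply: (submoduleZ _ (extN_submodule (integral_closure_submodule h) _)).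
  exact: hx mP _ _ kh.
Qed.

Lemma integral_root (K L : comNzRingType) (h : {rmorphism K -> L}) n z : (0 < n)%N ->
  integralOver h (z ^+ n) -> integralOver h z.
Proof.
move=> n0 iz; apply: (@integral_root_monic _ _ h z ('X^n - (z ^+ n)%:P)).
- exact: monicXnsubC.
- by rewrite /root hornerD hornerN hornerXn hornerC subrr.
move=> _ /(nthP 0) [i _ <-]; rewrite coefB coefXn coefC.
apply: integral_sub; first exact: integral_nat.
by case: eqP => _ //; apply: integral0.
Qed.

(** * Plus closure *)

Section PlusClosure.
Variables (p : nat) (A R : comNzRingType) (iota : {rmorphism A -> R}).
Hypotheses (charA : p \in [pchar A]) (charR : p \in [pchar R]).
Hypotheses (regA : regular_ring A) (noethR : noetherian R) (equidimR : equidimensional R).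
Hypotheses (inj_iota : injective iota) (integral_iota : integralRange iota).

(** By transitivity of integrality, plus closure in [R] is computed in a module that is flat over
    [A]. *)
Lemma integral_closure_iota (E : closedFieldType) (h : {rmorphism R -> E}) :
  integral_closure h = integral_closure (h \o iota).
Proof.
apply/seteqP; split=> z [q mq rq].
  apply: (@integral_root_monic _ _ (h \o iota) z (map_poly h q)) rq _; first exact: monic_map.
  move=> _ /(nthP 0) [i _ <-]; rewrite coef_map.
  exact/integralOver_comp/integral_iota.
by exists (map_poly iota q); rewrite ?monic_map // -map_poly_comp.
Qed.

Lemma plus_closure_extE (b : set A) r : plus_closure (ideal_ext iota b) r <->
  forall P, minimal_prime P -> forall (E : closedFieldType) (h : {rmorphism R -> E}),
    (forall a, h a = 0 <-> P a) ->
    extN (h \o iota) (integral_closure (h \o iota)) b (h r).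
Proof.
rewrite plus_closureE; split=> hr P mP E h kh; have := hr P mP E h kh.
  move/(extN_gen (integral_closure_submodule h)); rewrite integral_closure_iota.
  move=> [n [c [v [Xc Nv ->]]]].
  have /choice [a ha] : forall i, exists a, b a /\ iota a = c i.
    by move=> i; have [a ba <-] := Xc i; exists a.
  exists n, a, v; split=> //; first by move=> i; case: (ha i).
  by apply: eq_bigr => i _; case: (ha i) => _ <-.
move=> [n [c [v [Xc Nv ->]]]]; rewrite -integral_closure_iota in Nv.
exists n, (iota \o c), v; split=> // i; exact: mem_ideal_ext.
Qed.

Lemma plus_flat P (E : closedFieldType) (h : {rmorphism R -> E}) : minimal_prime P ->
  (forall a, h a = 0 <-> P a) -> flat (h \o iota) (integral_closure (h \o iota)).
Proof.
move=> mP kh; apply: (@integral_closure_flat _ _ _ p) => //; first exact: rmorph_pchar charR.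
have -> : [set a | (h \o iota) a = 0] = iota @^-1` P by apply/seteqP; split=> a /= /kh.
exact: minimal_prime_comap.
Qed.

Lemma plus_image (E : closedFieldType) (h : {rmorphism R -> E}) r :
  integral_closure (h \o iota) (h r).
Proof. by rewrite -integral_closure_iota; apply: integral_id. Qed.

Lemma plus_ideal_closure : ideal_closure p iota (fun b => plus_closure (ideal_ext iota b)).
Proof.
split.
- by move=> b _; apply: plus_closure_ideal.
- move=> b ib; apply: ideal_ext_min; first exact: plus_closure_ideal.
  move=> a ba; apply/plus_closure_extE => P mP E h kh; rewrite -[X in extN _ _ _ X]mulr1.
  by apply: mem_extN => //; apply: integral1.
- move=> b s r ib /plus_closure_extE hr; apply/plus_closure_extE => P mP E h kh.
  apply: extN_colon => //; [exact: plus_flat mP kh | exact: plus_image |].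
  by have := hr P mP E h kh; rewrite rmorphM.
- move=> b b' ib ib' r [/plus_closure_extE hr /plus_closure_extE hr'].
  apply/plus_closure_extE => P mP E h kh; apply: extN_capI => //; first exact: plus_flat mP kh.
    exact: hr mP _ _ kh.
  exact: hr' mP _ _ kh.
- move=> b b' _ _ bb' r /plus_closure_extE hr; apply/plus_closure_extE => P mP E h kh.
  by apply: (extNS bb'); apply: hr mP _ _ kh.
(* Integral elements have integral [p]-th roots in [E], and Frobenius is injective there. *)
- have p0 := prime_gt0 (pcharf_prime charA); move=> b r ib; rewrite !plus_closure_extE; split=> hr P mP E h kh.
    have sN := integral_closure_submodule (h \o iota).
    have := hr P mP E h kh; rewrite rmorphXn => /(extN_gen sN) [n [c [v [Xc Nv e]]]].
    have /choice [a ha] : forall i, exists a, b a /\ a ^+ p = c i.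
      by move=> i; have [a ba <-] := Xc i; exists a; rewrite expn1.
    have /choice [u hu] : forall i, exists u, u ^+ p = v i.
      by move=> i; apply: closed_field_root.
    exists n, a, u; split=> [i|i|]; first by case: (ha i).
      by apply: (integral_root p0); rewrite hu; apply: Nv.
    apply: (frobenius_field_inj (rmorph_pchar h charR)).
    have := expr_p_sum (rmorph_pchar h charR) 1 (index_enum _) (fun i => (h \o iota) (a i) * u i).
    rewrite expn1 => ->; rewrite e; apply: eq_bigr => i _; case: (ha i) => _ <-.
    by rewrite exprMn hu rmorphXn.
  have [n [c [v [bc Nv e]]]] := hr P mP E h kh.
  exists n, (fun i => c i ^+ p), (fun i => v i ^+ p); split=> [i|i|].
  - by have := @mem_frobenius_power p _ 1 b _ (bc i); rewrite expn1.
  - by apply: integralX; apply: Nv.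
  have := expr_p_sum (rmorph_pchar h charR) 1 (index_enum _) (fun i => (h \o iota) (c i) * v i).
  rewrite expn1 rmorphXn e => ->; apply: eq_bigr => i _.
  by rewrite exprMn rmorphXn.
(* The integral closure of [R] in [E] is made into a ring [T], and a prime of [T] over [Q] contains
   all integral combinations of elements of [P]. *)
- move=> P Q pQ QE r /plus_closure_extE hr.
  have [P0 mP0 P0Q] := minimal_prime_below noethR pQ.
  have [E [h kh]] := closed_field_of_prime mP0.1.
  have [n [c [v [Pc Nv e]]]] := hr P0 mP0 E h kh.
  have [|||T [w [injw wN]]] := @subring_exists E (integral_closure h).
  - exact: integral1.
  - by move=> x y; apply: integral_sub.
  - by move=> x y; apply: integral_mul.
  have [|g gE] := @rmorphism_corestrict R T E w h injw.
    by move=> x; apply/wN; apply: integral_id.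
  have integral_g : integralRange g.
    move=> t; have [q mq /rootP rq] : integral_closure h (w t) by apply/wN; exists t.
    exists q => //; apply/rootP; apply: injw; rewrite rmorph0 -horner_map -map_poly_comp -rq.
    by congr (_.[_]); apply: eq_map_poly => x /=; rewrite gE.
  have [|Q' [pQ' _ Q'E]] := lying_over integral_g (@ideal_zero T) pQ.
    by move=> x /= gx0; apply: P0Q; apply/kh; rewrite -gE gx0 rmorph0.
  have /choice [t ht] : forall i, exists t, w t = v i.
    by move=> i; apply/wN; rewrite integral_closure_iota; apply: Nv.
  rewrite -Q'E /=; have -> : g r = \sum_(i < n) g (iota (c i)) * t i.
    apply: injw; rewrite gE e rmorph_sum; apply: eq_bigr => i _.
    by rewrite rmorphM gE ht.
  have iQ' := prime_ideal_ideal pQ'; apply: (ideal_sum _ iQ') => i _; apply: (ideal_mulr _ iQ').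
  have : (iota @^-1` (g @^-1` Q')) (c i) by rewrite Q'E QE; apply: Pc.
  by [].
Qed.
End PlusClosure.

(** * Linear functionals and multipliers for plus closure *)

Section Functional.
Variables (R : comNzRingType) (E : closedFieldType) (h : {rmorphism R -> E}).

(** A linear functional on the module generated by 1 and the [m i], with values modulo the kernel
    and value [c] at 1. A generator that depends on the others gets the forced value, after
    multiplication by [e]; an independent one gets 0. *)
Lemma kernel_functional n (m : 'I_n -> E) : exists (c : R) (lam : 'I_n -> R), h c != 0 /\
  forall (d0 : R) (d : 'I_n -> R), h d0 + \sum_(i < n) h (d i) * m i = 0 ->
    h (c * d0 + \sum_(i < n) d i * lam i) = 0.
Proof.
elim: n m => [|n IH] m.
  exists 1, (fun=> 0); rewrite rmorph1 oner_neq0; split=> // d0 d.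
  by rewrite !big_ord0 !addr0 mul1r.
have [c [lam [c0 hc]]] := IH (fun i => m (lift ord0 i)).
have [[e [f0 [f [e0 ef]]]]|no] := pselect (exists (e f0 : R) (f : 'I_n -> R), h e != 0 /\
    h e * m ord0 = h f0 + \sum_(i < n) h (f i) * m (lift ord0 i)).
  exists (e * c), (fun i => if unlift ord0 i is Some j then e * lam j
                            else c * f0 + \sum_(j < n) f j * lam j).
  split=> [|d0 d]; first by rewrite rmorphM mulf_neq0.
  rewrite !big_ord_recl unlift_none => ed.
  under [X in h (_ + (_ + X))]eq_bigr => i _ do rewrite liftK.
  have := hc (e * d0 + d ord0 * f0) (fun i => e * d (lift ord0 i) + d ord0 * f i).
  set S1 := \sum_(i < n) _; set S2 := \sum_(i < n) _; move=> H.
  have -> : e * c * d0 + (d ord0 * (c * f0 + \sum_(j < n) f j * lam j) +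
     \sum_(i < n) d (lift ord0 i) * (e * lam i)) = c * (e * d0 + d ord0 * f0) + S2.
    have -> : S2 = e * (\sum_(i < n) d (lift ord0 i) * lam i) + d ord0 * \sum_(j < n) f j * lam j.
      rewrite !mulr_sumr -big_split /=; apply: eq_bigr => i _.
      by rewrite mulrDl !mulrA.
    have -> : \sum_(i < n) d (lift ord0 i) * (e * lam i) = e * (\sum_(i < n) d (lift ord0 i) * lam i).
      by rewrite mulr_sumr; apply: eq_bigr => i _; rewrite mulrCA.
    by ring.
  apply: H; have -> : S1 = h e * (\sum_(i < n) h (d (lift ord0 i)) * m (lift ord0 i)) +
      h (d ord0) * \sum_(i < n) h (f i) * m (lift ord0 i).
    rewrite !mulr_sumr -big_split /=; apply: eq_bigr => i _.
    by rewrite rmorphD !rmorphM mulrDl !mulrA.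
  have -> : \sum_(i < n) h (f i) * m (lift ord0 i) = h e * m ord0 - h f0 by rewrite ef addrAC subrr add0r.
  have -> : h (e * d0 + d ord0 * f0) + (h e * (\sum_(i < n) h (d (lift ord0 i)) * m (lift ord0 i)) +
    h (d ord0) * (h e * m ord0 - h f0)) = h e * (h d0 + (h (d ord0) * m ord0 +
    \sum_(i < n) h (d (lift ord0 i)) * m (lift ord0 i))).
    by rewrite rmorphD !rmorphM; ring.
  by rewrite ed mulr0.
exists c, (fun i => if unlift ord0 i is Some j then lam j else 0); split=> // d0 d.
rewrite !big_ord_recl unlift_none mulr0 add0r.
under [X in h (_ + X)]eq_bigr => i _ do rewrite liftK.
move=> ed; apply: hc.
have [d00|dn0] := eqVneq (h (d ord0)) 0; first by move: ed; rewrite d00 mul0r add0r.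
case: no; exists (d ord0), (- d0), (fun i => - d (lift ord0 i)); split=> //.
under eq_bigr => i _ do rewrite rmorphN mulNr.
by rewrite sumrN rmorphN -opprD; apply/eqP; rewrite -addr_eq0 addrCA ed.
Qed.

Lemma kernel_functional_fin (I : finType) (m : I -> E) : exists (c : R) (lam : I -> R), h c != 0 /\
  forall (d0 : R) (d : I -> R), h d0 + \sum_i h (d i) * m i = 0 ->
    h (c * d0 + \sum_i d i * lam i) = 0.
Proof.
have [c [lam [c0 hc]]] := kernel_functional (fun j : 'I_#|I| => m (enum_val j)).
exists c, (lam \o enum_rank); split=> // d0 d.
rewrite !(reindex _ (onW_bij _ (enum_val_bij I))) /=.
under [X in h (_ + X)]eq_bigr => i _ do rewrite enum_valK.
exact: hc.
Qed.

Lemma integral_powers z : integralOver h z ->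
  exists D : nat, forall N, exists rho : 'I_D -> R, z ^+ N = \sum_(e < D) h (rho e) * z ^+ e.
Proof.
move=> [q mq /rootP rq]; exists (size q) => N.
exists (fun e => (Pdiv.Ring.rmodp 'X^N q)`_e).
have := Pdiv.RingMonic.rdivp_eq mq 'X^N => /(congr1 (fun u => (map_poly h u).[z])).
rewrite rmorphD rmorphM /= map_polyXn hornerXn hornerD hornerM rq mulr0 add0r => ->.
rewrite (@horner_coef_wide _ (size q)); last first.
  by apply: leq_trans (size_poly _ _) _; apply: ltnW; apply: Pdiv.Ring.ltn_rmodpN0; apply: monic_neq0.
by apply: eq_bigr => i _; rewrite coef_map.
Qed.

(** The functional is applied to the [p ^ n]-th power of the integral combination. All powers of the
    [z i] are combinations of finitely many, so a single [c] serves every [n]. *)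
Lemma plus_multiplier p (charR : p \in [pchar R]) (b : set R) r :
  extN h (integral_closure h) b (h r) ->
  exists c, h c != 0 /\ forall n, exists2 w, frobenius_power p n b w & h (c * r ^+ (p ^ n)%N) = h w.
Proof.
move=> [k [x [z [bx iz e]]]].
have /choice [D hD] : forall i, exists D : nat, forall N, exists rho : 'I_D -> R,
    z i ^+ N = \sum_(e < D) h (rho e) * z i ^+ e by move=> i; apply: integral_powers; apply: iz.
have [c [lam [c0 hc]]] := kernel_functional_fin (fun u : {i : 'I_k & 'I_(D i)} => z (tag u) ^+ tagged u).
exists c; split=> // n.
pose rho i := projT1 (cid (hD i (p ^ n)%N)).
have hrho i : z i ^+ (p ^ n)%N = \sum_(e < D i) h (rho i e) * z i ^+ e :=
  projT2 (cid (hD i (p ^ n)%N)).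
exists (\sum_(u : {i : 'I_k & 'I_(D i)}) x (tag u) ^+ (p ^ n)%N * rho (tag u) (tagged u) * lam u).
  apply: (ideal_sum _ (frobenius_power_ideal _ _ _)) => u _.
  do 2 apply: (ideal_mulr _ (frobenius_power_ideal _ _ _)).
  exact: mem_frobenius_power.
apply/eqP; rewrite -subr_eq0 -rmorphB -sumrN; apply/eqP.
under eq_bigr => u _ do rewrite -mulNr.
apply: hc; rewrite rmorphXn e (expr_p_sum (rmorph_pchar h charR)).
rewrite [X in _ + X](_ : _ = \sum_(i < k) \sum_(e < D i) h (- (x i ^+ (p ^ n)%N * rho i e)) * z i ^+ e); last first.
  by rewrite sig_big_dep; apply: eq_big.
rewrite -big_split big1 //= => i _; rewrite exprMn hrho mulr_sumr -big_split big1 //= => j _.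
by rewrite rmorphN rmorphM rmorphXn mulNr mulrA subrr.
Qed.
End Functional.

(** * Tight closure *)

Section PlusTight.
Variables (p : nat) (R : comNzRingType).
Hypotheses (charR : p \in [pchar R]) (noethR : noetherian R).

Lemma nilradical_frobenius : exists K, forall u : R, radical [set 0] u -> u ^+ (p ^ K)%N = 0.
Proof.
have [s sE] := noethR (radical_ideal (@ideal_zero R)).
have /choice [e he] : forall z : R, exists e, radical [set 0] z -> z ^+ e = 0.
  by move=> z; have [[e ze]|] := pselect (radical [set 0] z); [exists e | exists 0%N].
exists (\sum_(z <- s) e z)%N => u; rewrite sE => /ideal_genP [n [c [x [xs ->]]]].
rewrite (expr_p_sum charR) big1 // => i _; rewrite exprMn.
have lt : (e (x i) <= p ^ \sum_(z <- s) e z)%N.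
  apply: leq_trans (ltnW (ltn_expl _ (prime_gt1 (pcharf_prime charR)))).
  by rewrite (big_rem (x i)) ?leq_addr //; apply: xs.
have xe : x i ^+ e (x i) = 0 by apply: he; rewrite sE; apply: sub_ideal_gen.
by rewrite -[in x i ^+ _](subnK lt) exprD xe !mulr0.
Qed.

Lemma avoids_minimal_primesM (B : comPzRingType) (c c' : B) :
  avoids_minimal_primes c -> avoids_minimal_primes c' -> avoids_minimal_primes (c * c').
Proof.
move=> hc hc' [P mP /(primeM mP.1) [Pc|Pc']]; first by apply: hc; exists P.
by apply: hc'; exists P.
Qed.

Lemma avoids_minimal_primesX (B : comPzRingType) (c : B) n :
  avoids_minimal_primes c -> avoids_minimal_primes (c ^+ n).
Proof.
by move=> hc [P mP h]; apply: hc; exists P => //; move: h; apply: contraPP => nPc; apply: primeNX mP.1 nPc.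
Qed.

(** The multipliers [c P] at the minimal primes are glued to [d] by elements [e P] outside [P] and
    inside all other minimal primes. The resulting relation holds up to a nilpotent, which a fixed
    further Frobenius power kills. *)
Lemma plus_sub_tight (b : set R) : is_ideal b -> plus_closure b `<=` tight_closure p b.
Proof.
move=> ib r /plus_closureE hr.
have [Ps [uPs hPs below]] := minimal_primes_over noethR (@ideal_zero R).
have mPs P : P \in Ps -> minimal_prime P by move=> /hPs /minimal_prime_over0.
have /choice [c hc] : forall P : set R, exists c, P \in Ps -> ~ P c /\
    forall n, exists2 w, frobenius_power p n b w & P (c * r ^+ (p ^ n)%N - w).
  move=> P; have [PPs|] := boolP (P \in Ps); last by exists 0.
  have [E [h kh]] := closed_field_of_prime (mPs P PPs).1.
  have [c [c0 hc]] := plus_multiplier charR (hr P (mPs P PPs) E h kh).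
  exists c => _; split=> [/kh /eqP|n]; first exact/negP.
  by have [w fw ew] := hc n; exists w => //; apply/kh; rewrite rmorphB ew subrr.
have /choice [e he] : forall P : set R, exists e, P \in Ps -> ~ P e /\
    forall P', P' \in Ps -> P' != P -> P' e.
  move=> P; have [PPs|] := boolP (P \in Ps); last by exists 0.
  have [|e [nPe hPe]] := @prime_avoid R (rem P Ps) P (mPs P PPs).1.
    move=> P'; rewrite mem_rem_uniq // inE => /andP [/= P'P P'Ps].
    split; first exact: prime_ideal_ideal (mPs _ P'Ps).1.
    by move=> sub; move/eqP: P'P; apply; apply: (mPs P PPs).2 (mPs P' P'Ps).1 sub.
  by exists e => _; split=> // P' P'Ps P'P; apply: hPe; rewrite mem_rem_uniq // inE; apply/andP.
have [K hK] := nilradical_frobenius.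
pose d := \sum_(P <- Ps) e P * c P.
have hd : avoids_minimal_primes d.
  move=> [P mP]; have /hPs PPs : minimal_over [set 0] P by apply/minimal_prime_over0.
  have iP := prime_ideal_ideal mP.1.
  rewrite /d (big_rem P) //= addrC => h.
  have nP : ~ P (e P * c P).
    by apply: (primeNM mP.1); [case: (he P PPs) | case: (hc P PPs)].
  apply: nP; apply: (idealDl iP _ h).
  rewrite big_seq; apply: (ideal_sum _ iP) => P'; rewrite mem_rem_uniq // inE => /andP [/= P'P P'Ps].
  by apply: (ideal_mulr _ iP); case: (he P' P'Ps) => _; apply=> //; rewrite eq_sym.
exists (d ^+ (p ^ K)%N); split; first exact: avoids_minimal_primesX.
exists K => n /subnK <-; set k := (n - K)%N.
have /choice [w hw] : forall P : set R, exists w, P \in Ps ->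
    frobenius_power p k b w /\ P (c P * r ^+ (p ^ k)%N - w).
  move=> P; have [PPs|] := boolP (P \in Ps); last by exists 0.
  by have [w fw Pw] := (hc P PPs).2 k; exists w.
pose v := \sum_(P <- Ps) e P * w P.
have : radical [set 0] (d * r ^+ (p ^ k)%N - v).
  apply: nil_of_minimal_primes => //; first exact: ideal_zero.
  move=> P /hPs PPs; have iP := prime_ideal_ideal (mPs P PPs).1.
  rewrite /d /v mulr_suml -sumrB big_seq. apply: (ideal_sum _ iP) => P' P'Ps.
  rewrite -mulrA -mulrBr; have [->|P'P] := eqVneq P' P.
    by apply: (ideal_mull _ iP); case: (hw P PPs).
  by apply: (ideal_mulr _ iP); case: (he P' P'Ps) => _; apply=> //; rewrite eq_sym.
move/hK/eqP; rewrite (expr_pB charR) subr_eq0 exprMn -exprM -expnD => /eqP ->.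
rewrite -frobenius_powerD //; apply: mem_frobenius_power.
rewrite /v big_seq; apply: (ideal_sum _ (frobenius_power_ideal _ _ _)) => P PPs.
by apply: (ideal_mull _ (frobenius_power_ideal _ _ _)); case: (hw P PPs).
Qed.
End PlusTight.

Section TightClosure.
Variables (p : nat) (R : comNzRingType).
Hypotheses (charR : p \in [pchar R]) (noethR : noetherian R).
Implicit Types (I b Q : set R).

Let p_gt1 : (1 < p)%N := prime_gt1 (pcharf_prime charR).

Lemma avoids_minimal_primes1 (B : comPzRingType) : avoids_minimal_primes (1 : B).
Proof. by move=> [P mP]; apply: prime1 mP.1. Qed.

Lemma tight_closure_ideal b : is_ideal b -> is_ideal (tight_closure p b).
Proof.
move=> ib; have ifp n := frobenius_power_ideal p n b; split.
- exists 1; split; first exact: avoids_minimal_primes1.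
  exists 0%N => n _; rewrite mul1r expr0n expn_eq0 gtn_eqF ?(ltnW p_gt1) //=; exact: (ideal0 (ifp n)).
- move=> x y [c [hc [N hx]]] [d [hd [M hy]]]; exists (c * d); split; first exact: avoids_minimal_primesM.
  exists (maxn N M) => n; rewrite geq_max => /andP [/hx h1 /hy h2].
  rewrite (expr_pD charR) mulrDr; apply: (idealD (ifp n)).
    by rewrite mulrAC; apply: (ideal_mulr _ (ifp n)).
  by rewrite -mulrA; apply: (ideal_mull _ (ifp n)).
- move=> a x [c [hc [N hx]]]; exists c; split=> //; exists N => n /hx h.
  by rewrite exprMn mulrCA; apply: (ideal_mull _ (ifp n)).
Qed.

Lemma sub_tight_closure b : b `<=` tight_closure p b.
Proof.
move=> x bx; exists 1; split; first exact: avoids_minimal_primes1.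
by exists 0%N => n _; rewrite mul1r; apply: mem_frobenius_power.
Qed.

Lemma tight_closureS b b' : b `<=` b' -> tight_closure p b `<=` tight_closure p b'.
Proof.
move=> bb x [c [hc [N hx]]]; exists c; split=> //; exists N => n /hx.
exact: frobenius_powerS.
Qed.

Lemma tight_closure_frobenius b r :
  tight_closure p (frobenius_power p 1 b) (r ^+ p) <-> tight_closure p b r.
Proof.
split=> [[c [hc [N h]]]|[c [hc [N h]]]]; exists c; split=> //.
  exists N.+1 => [[//|n]] /h; rewrite frobenius_powerD // -exprM -expnS; exact.
exists N => n Nn; rewrite frobenius_powerD // -exprM -expnS; apply: h; lia.
Qed.

(* Krull's intersection theorem in the localization at [Q]; [W] is maximal among the ideals that
   contain [Q c] and meet [(c)] inside the saturation of [Q c]. *)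
Lemma frobenius_krull Q c : prime_ideal Q -> exists N, forall n u, (N <= n)%N -> ~ Q u ->
  frobenius_power p n Q (u * c) -> exists2 v, ~ Q v & v * c = 0.
Proof.
move=> pQ; have iQ := prime_ideal_ideal pQ.
pose Qc := [set x | exists2 z, Q z & x = z * c].
have iQc : is_ideal Qc.
  split; first by exists 0; rewrite ?mul0r //; apply: ideal0.
    by move=> _ _ [z Qz ->] [w Qw ->]; exists (z + w); rewrite ?mulrDl //; apply: idealD.
  by move=> a _ [z Qz ->]; exists (a * z); rewrite ?mulrA //; apply: ideal_mull.
have [||W [[iW hW] QcW Wmax]] := @noeth_max R
  [set W | is_ideal W /\ forall y, W (y * c) -> sat Q Qc (y * c)] Qc noethR.
- by move=> J [].
- by split=> // y; apply: sub_sat.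
(* Once the colons of [W] by powers of [z] are stable, adding [z ^+ k] to [W] creates no new
   multiples of [c], so maximality applies. *)
have powW z : Q z -> exists k, W (z ^+ k).
  move=> Qz; have [k stab] := colon_stable noethR z iW; exists k.
  rewrite -(Wmax (adj W (z ^+ k))); [exact: mem_adj | split; first exact: adj_ideal | exact: sub_adj].
  move=> y [w [a [Ww ycE]]]; apply: hW; rewrite ycE; apply: idealD => //; apply: stab.
  apply: (idealDl iW (ideal_mull z iW Ww)).
  rewrite exprS mulrCA -mulrDr -ycE; apply: QcW; exists (z * y); rewrite ?mulrA //; exact: ideal_mulr.
have [s sE] := noethR iQ.
have /choice [e he] : forall z, exists e, Q z -> W (z ^+ e).
  by move=> z; have [/powW [e we]|] := pselect (Q z); [exists e | exists 0%N].
exists (\sum_(z <- s) e z)%N => n u Nn nQu fu.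
have : W (u * c).
  move: fu; rewrite {1}sE frobenius_power_gen //; apply: ideal_gen_min => // _ [z /= zs <-].
  apply: (idealX iW _ (he z _)); last by rewrite sE; apply: sub_ideal_gen.
  apply: leq_trans (ltnW (ltn_expl _ p_gt1)); apply: leq_trans Nn.
  by rewrite (big_rem z) // leq_addr.
move=> /hW [t [nt [z Qz tE]]]; exists (t * u - z).
  move=> h; have nQ := primeNM pQ nt nQu; apply: nQ.
  by rewrite -[t * u](subrK z); apply: idealD.
by rewrite mulrBl -mulrA tE subrr.
Qed.
(** The test element is used at level [m0] only. Applied to [c * r ^+ (p ^ k)], it gives a relation
    of level [k + m0] whose multiplier does not depend on [k]. *)
Lemma tight_closure_multiplier (m0 : nat) (c0 : R) (J : set R) c N r : weak_test_element p m0 c0 -> is_ideal J -> avoids_minimal_primes c ->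
  (forall n, (N <= n)%N -> tight_closure p (frobenius_power p n J) (c * r ^+ (p ^ n)%N)) -> tight_closure p J r.
Proof.
move=> test0 iJ hc h; exists (c0 * c ^+ (p ^ m0)%N); split.
  by apply: avoids_minimal_primesM; [case: test0 | apply: avoids_minimal_primesX].
exists (N + m0)%N => n Nn; set k := (n - m0)%N.
have nE : n = (k + m0)%N by rewrite subnK //; lia.
have /h : (N <= k)%N by lia.
move/(test0.2 (frobenius_power p k J) (frobenius_power_ideal _ _ _)) => /(_ m0 (leqnn _)).
by rewrite frobenius_powerD // -nE exprMn -exprM -expnD -nE mulrA.
Qed.

End TightClosure.

Section TightIdealClosure.
Variables (p : nat) (A R : comNzRingType) (iota : {rmorphism A -> R}).
Hypotheses (charA : p \in [pchar A]) (charR : p \in [pchar R]).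
Hypotheses (regA : regular_ring A) (noethR : noetherian R) (equidimR : equidimensional R).
Hypotheses (inj_iota : injective iota) (integral_iota : integralRange iota).
Variables (m0 : nat) (c0 : R).
Hypothesis test0 : weak_test_element p m0 c0.

Local Notation fp := (frobenius_power p).
Local Notation cplus := (fun b => plus_closure (ideal_ext iota b)).

Let plusC : ideal_closure p iota cplus := plus_ideal_closure charA charR regA noethR equidimR inj_iota integral_iota.

Lemma tight_closure_plusE (b : set A) r : is_ideal b ->
  tight_closure p (ideal_ext iota b) r <-> exists2 c, avoids_minimal_primes c &
    exists N, forall n, (N <= n)%N -> cplus (fp n b) (c * r ^+ (p ^ n)%N).
Proof.
move=> ib; split=> [[c [hc [N h]]]|[c hc [N h]]].
  exists c => //; exists N => n /h; rewrite frobenius_power_ext //.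
  by apply: (closure_ext plusC); apply: frobenius_power_ideal.
apply: (tight_closure_multiplier charR test0 (ideal_ext_ideal iota b) hc (N := N)) => n /h.
rewrite frobenius_power_ext //; apply: plus_sub_tight => //; exact: ideal_ext_ideal.
Qed.

Lemma tight_ideal_closure : ideal_closure p iota (fun b => tight_closure p (ideal_ext iota b)).
Proof.
have ifp := fun n b => frobenius_power_ideal (A := A) p n b.
split.
- by move=> b _; apply: tight_closure_ideal => //; apply: ideal_ext_ideal.
- by move=> b _; apply: sub_tight_closure.
- move=> b s r ib /(tight_closure_plusE _ ib) [c hc [N h]].
  apply/tight_closure_plusE; first exact: colon_ideal.
  exists c => //; exists N => n /h; rewrite exprMn mulrCA -rmorphXn.
  move/(closure_colon plusC (ifp n b)); apply: (closureS plusC).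
  + exact: colon_ideal.
  + exact: ifp.
  by move=> a; apply: frobenius_power_colon.
- move=> b b' ib ib' r [/(tight_closure_plusE _ ib) [c hc [N h]] /(tight_closure_plusE _ ib') [d hd [M h']]].
  apply/tight_closure_plusE; first exact: ideal_setI.
  exists (c * d); first exact: avoids_minimal_primesM.
  exists (maxn N M) => n; rewrite geq_max => /andP [/h hn /h' hn'].
  rewrite -(frobenius_power_capI charA regA) //; apply: (closure_cap plusC) => //; split.
    by rewrite mulrAC; apply: (ideal_mulr _ (plus_closure_ideal _)).
  by rewrite -mulrA; apply: (ideal_mull _ (plus_closure_ideal _)).
- by move=> b b' _ _ bb'; apply: tight_closureS; apply: ideal_extS.
- by move=> b r ib; rewrite -frobenius_power_ext //; apply: tight_closure_frobenius.
(* By [frobenius_krull] some [v] outside [Q] kills [c], which would put [c] into a minimal prime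
   inside [Q]. *)
- move=> P Q pQ QE r [c [hc [N h]]]; apply: contrapT => nQr.
  have [M hM] := frobenius_krull charR noethR c pQ.
  have fQ : frobenius_power p (maxn N M) Q (r ^+ (p ^ maxn N M)%N * c).
    rewrite mulrC; apply: frobenius_powerS (h _ (leq_maxl _ _)).
    by apply: ideal_ext_min; [apply: prime_ideal_ideal | rewrite QE].
  have [v nQv vc] := hM _ _ (leq_maxr _ _) (primeNX pQ nQr) fQ.
  have [P0 mP0 P0Q] := minimal_prime_below noethR pQ.
  have iP0 := prime_ideal_ideal mP0.1.
  have : P0 (v * c) by rewrite vc; apply: ideal0.
  by move/(primeM mP0.1) => [/P0Q|P0c] //; apply: hc; exists P0.
Qed.
End TightIdealClosure.

(** * Tight closure and localization *)

Section LocalizedIdeals.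
Variables (R L : comPzRingType) (S : set R) (phi : {rmorphism R -> L}).
Hypotheses (mS : mult_closed S) (locL : is_localization S phi).
Implicit Types (I P : set R).

Lemma localization_unit s : S s -> exists t, phi s * t = 1. Proof. by case: locL => h _ _; apply: h. Qed.

Lemma localization_fraction w : exists s x, S s /\ phi s * w = phi x.
Proof. by case: locL => _ h _; have [x [s [Ss e]]] := h w; exists s, x. Qed.

Lemma localization_eq x y : phi x = phi y -> exists2 s, S s & s * x = s * y.
Proof.
case: locL => _ _ h e; have [s [Ss se]] : exists s, S s /\ s * (x - y) = 0 by apply/h; rewrite rmorphB e subrr.
by exists s => //; apply/eqP; rewrite -subr_eq0 -mulrBr se.
Qed.

Lemma mult_closed_prod (J : Type) (r : seq J) (F : J -> R) :
  (forall j, S (F j)) -> S (\prod_(j <- r) F j).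
Proof. by move=> h; elim/big_ind: _ => // [|x y]; [case: mS | case: mS => _; apply]. Qed.

Definition fractions_of I : set L := [set w | exists s x, [/\ S s, I x & phi s * w = phi x]].

Lemma fractions_of_ideal I : is_ideal I -> is_ideal (fractions_of I).
Proof.
move=> iI; split.
- by exists 1, 0; split; [case: mS | apply: ideal0 | rewrite mulr0 rmorph0].
- move=> w w' [s [x [Ss Ix e]]] [s' [x' [Ss' Ix' e']]]; exists (s * s'), (s' * x + s * x'); split.
  + by case: mS => _; apply.
  + by apply: idealD => //; apply: ideal_mull.
  + by rewrite rmorphD !rmorphM -e -e'; ring.
- move=> a w [s [x [Ss Ix e]]]; have [u [y [Su ae]]] := localization_fraction a.
  exists (u * s), (y * x); split; first by case: mS => _; apply.
    exact: ideal_mull.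
  by rewrite !rmorphM -e -ae; ring.
Qed.

Lemma ideal_ext_fractions I : is_ideal I -> ideal_ext phi I = fractions_of I.
Proof.
move=> iI; apply/seteqP; split.
  apply: ideal_ext_min; first exact: fractions_of_ideal.
  by move=> x Ix; exists 1, x; split=> //; [case: mS | rewrite rmorph1 mul1r].
move=> w [s [x [Ss Ix e]]]; have [t st] := localization_unit Ss.
rewrite -[w]mul1r -st mulrAC e mulrC; apply: (ideal_mull _ (ideal_ext_ideal _ _)).
exact: mem_ideal_ext.
Qed.

Lemma comap_fractions P x : prime_ideal P -> P `&` S = set0 -> fractions_of P (phi x) -> P x.
Proof.
move=> pP PS [s [y [Ss Py]]]; rewrite -rmorphM => /localization_eq [u Su e].
have nP z : S z -> ~ P z by move=> Sz Pz; have : set0 z by rewrite -PS.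
have : P (u * (s * x)) by rewrite e; apply: ideal_mull => //; apply: prime_ideal_ideal.
by do 2 (move=> /(primeM pP) [/nP|] //).
Qed.

Lemma fractions_of_prime P : prime_ideal P -> P `&` S = set0 -> prime_ideal (fractions_of P).
Proof.
move=> pP PS; have iP := prime_ideal_ideal pP; have iF := fractions_of_ideal iP.
split; first split=> //.
  by rewrite -(rmorph1 phi) => /(comap_fractions pP PS); apply: prime1.
move=> w w' h; have [s [x [Ss e]]] := localization_fraction w; have [s' [x' [Ss' e']]] := localization_fraction w'.
have : P (x * x').
  apply: (comap_fractions pP PS); rewrite rmorphM -e -e' mulrACA; exact: (ideal_mull _ iF h).
by move=> /(primeM pP) [Px|Px']; [left; exists s, x | right; exists s', x'].
Qed.

Lemma comap_disjoint (X : set L) : prime_ideal X -> (phi @^-1` X) `&` S = set0.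
Proof.
move=> pX; apply/seteqP; split=> // s [/= Xs /localization_unit [t st]].
by apply: (prime1 pX); rewrite -st; apply: ideal_mulr => //; apply: prime_ideal_ideal.
Qed.

Lemma fractions_of_sub P (X : set L) : prime_ideal X -> P `<=` phi @^-1` X -> fractions_of P `<=` X.
Proof.
move=> pX PX w [s [x [Ss /PX /= Xx e]]]; rewrite -e in Xx.
case: (primeM pX Xx) => // Xs.
by have : set0 s by rewrite -(comap_disjoint pX).
Qed.

(** The contraction of a minimal prime [X] of [L] contains a minimal prime of [R], whose fractions
    form a prime inside [X] and hence all of it. *)
Lemma avoids_minimal_primes_localization c : noetherian R ->
  avoids_minimal_primes c -> avoids_minimal_primes (phi c).
Proof.
move=> noethR hc [X mX Xc]; have pX := mX.1.
have [P mP PX] := minimal_prime_below noethR (comap_prime phi pX).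
have PS : P `&` S = set0.
  by apply/seteqP; split=> // s [/PX Xs Ss]; rewrite -(comap_disjoint pX).
have XE := mX.2 _ (fractions_of_prime mP.1 PS) (fractions_of_sub pX PX).
by apply: hc; exists P => //; apply: (comap_fractions mP.1 PS); rewrite XE.
Qed.

Lemma minimal_prime_fractions P : minimal_prime P -> P `&` S = set0 -> minimal_prime (fractions_of P).
Proof.
move=> mP PS; split; first exact: fractions_of_prime mP.1 PS.
move=> X pX XP; apply/seteqP; split=> //; apply: fractions_of_sub => //.
rewrite (mP.2 _ (comap_prime phi pX)) //.
by move=> x /= /XP; apply: comap_fractions mP.1 PS.
Qed.

Lemma frobenius_power_fractions p n I : is_ideal I ->
  frobenius_power p n (fractions_of I) `<=` fractions_of (frobenius_power p n I).
Proof.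
move=> iI; apply: ideal_gen_min; first by apply: fractions_of_ideal; apply: ideal_gen_ideal.
move=> _ [w [s [x [Ss Ix e]]] <-]; exists (s ^+ (p ^ n)%N), (x ^+ (p ^ n)%N); split.
- exact: mult_closedX.
- by apply: sub_ideal_gen; exists x.
- by rewrite !rmorphXn -exprMn e.
Qed.
End LocalizedIdeals.

Section TightLocalization.
Variables (p : nat) (R : comNzRingType).
Hypotheses (charR : p \in [pchar R]) (noethR : noetherian R).
Variables (m0 : nat) (c0 : R).
Hypothesis test0 : weak_test_element p m0 c0.
Variables (J : set R) (iJ : is_ideal J).
Variables (m : nat) (Q : 'I_m -> set R) (comp : nat -> 'I_m -> set R).
Hypotheses (compi : forall n i, is_ideal (comp n i))
  (comp_sat : forall n i, saturated (Q i) (comp n i))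
  (comp_pow : forall i z, Q i z -> exists e, forall n, comp n i (z ^+ (e * p ^ n)%N))
  (tightE : forall n, tight_closure p (frobenius_power p n J) = \bigcap_i comp n i).

Variables (S : set R) (L : comPzRingType) (phi : {rmorphism R -> L}).
Hypotheses (mS : mult_closed S) (locL : is_localization S phi).

Let iT : is_ideal (tight_closure p J) := tight_closure_ideal charR iJ.

Lemma tight_closure_ext_sub : ideal_ext phi (tight_closure p J) `<=` tight_closure p (ideal_ext phi J).
Proof.
rewrite (ideal_ext_fractions mS locL) // => w [s [r [Ss [c [hc [N h]]] e]]].
have [t st] := localization_unit locL Ss.
have -> : w = phi r * t by rewrite -e mulrAC st mul1r.
exists (phi c); split; first exact: (avoids_minimal_primes_localization mS locL).
exists N => n /h fr; rewrite exprMn mulrA -rmorphXn -rmorphM.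
have iF : is_ideal (frobenius_power p n (ideal_ext phi J)) by apply: ideal_gen_ideal.
apply: (ideal_mulr _ iF).
have : frobenius_power p n J `<=` phi @^-1` frobenius_power p n (ideal_ext phi J).
  apply: ideal_gen_min; first exact: comap_ideal.
  move=> _ [x Jx <-] /=; rewrite rmorphXn; apply: sub_ideal_gen; exists (phi x) => //.
  exact: mem_ideal_ext.
exact.
Qed.

(* [t] lies in the minimal primes meeting [S] and [d] in the others only; so [t d] is nilpotent, and
   [g t + d ^+ k.+1] avoids all minimal primes. *)
Lemma avoids_minimal_primes_correction (g : R) :
  (forall P, minimal_prime P -> P `&` S = set0 -> ~ P g) ->
  exists c t, [/\ avoids_minimal_primes c, S t & exists u, t * c = u * g].
Proof.
move=> hg.
have [Ps [uPs hPs _]] := minimal_primes_over noethR (@ideal_zero R).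
have mPs P : P \in Ps <-> minimal_prime P by rewrite hPs minimal_prime_over0.
have /choice [s hs] : forall P : set R, exists s, S s /\ (P `&` S <> set0 -> P s).
  move=> P; have [PS|PS] := pselect (P `&` S = set0); first by exists 1; split=> //; case: mS.
  have /set0P [s [Ps_ Ss]] : P `&` S != set0 by apply/eqP.
  by exists s.
have /choice [e he] : forall P : set R, exists e, P \in Ps -> ~ P e /\
    forall P', P' \in Ps -> P' != P -> P' e.
  move=> P; have [PPs|] := boolP (P \in Ps); last by exists 0.
  have mP := (mPs P).1 PPs.
  have [|e [nPe hPe]] := @prime_avoid R (rem P Ps) P mP.1.
    move=> P'; rewrite mem_rem_uniq // inE => /andP [/= P'P /mPs mP'].
    split; first exact: prime_ideal_ideal mP'.1.
    by move=> sub; move/eqP: P'P; apply; apply: mP.2 mP'.1 sub.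
  by exists e => _; split=> // P' P'Ps P'P; apply: hPe; rewrite mem_rem_uniq // inE; apply/andP.
pose meets P := `[< P `&` S <> set0 >].
pose t := \prod_(P <- [seq P <- Ps | meets P]) s P.
pose d := \sum_(P <- [seq P <- Ps | meets P]) e P.
have St : S t by apply: mult_closed_prod => // P; case: (hs P).
have meets_t P : minimal_prime P -> meets P -> P t.
  move=> mP meetP; rewrite /t (big_rem P) /=; last by rewrite mem_filter meetP; apply/mPs.
  apply: (ideal_mulr _ (prime_ideal_ideal mP.1)); case: (hs P) => _; apply; exact/asboolP.
have meets_d P : minimal_prime P -> meets P -> ~ P d.
  move=> mP meetP; have iP := prime_ideal_ideal mP.1; have PPs := (mPs P).2 mP.
  rewrite /d (big_rem P) /=; last by rewrite mem_filter meetP.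
  rewrite addrC => h; case: (he P PPs) => nPe _; apply: nPe; apply: (idealDl iP _ h).
  rewrite big_seq; apply: (ideal_sum _ iP) => P'; rewrite mem_rem_uniq ?filter_uniq // inE mem_filter.
  move=> /andP [/= P'P /andP [_ P'Ps]]; case: (he P' P'Ps) => _; apply=> //; by rewrite eq_sym.
have disjoint_d P : minimal_prime P -> ~~ meets P -> P d.
  move=> mP nmeetP; rewrite /d big_seq; apply: (ideal_sum _ (prime_ideal_ideal mP.1)) => P'.
  rewrite mem_filter => /andP [meetP' P'Ps]; case: (he P' P'Ps) => _; apply; first exact/mPs.
  by apply: contraNneq nmeetP => ->.
have [||k td0] := @nil_of_minimal_primes R noethR [set 0] (t * d).
- exact: ideal_zero.
- move=> P /minimal_prime_over0 mP; have iP := prime_ideal_ideal mP.1.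
  have [meetP|nmeetP] := boolP (meets P); first by apply: (ideal_mulr _ iP); apply: meets_t.
  by apply: (ideal_mull _ iP); apply: disjoint_d.
exists (g * t + d ^+ k.+1), (t ^+ k.+1); split.
- move=> [P mP]; have iP := prime_ideal_ideal mP.1.
  have [meetP|nmeetP] := boolP (meets P).
    move/(idealDl iP (ideal_mull g iP (meets_t P mP meetP))).
    exact: primeNX mP.1 (meets_d P mP meetP).
  rewrite addrC => hc.
  have PS : P `&` S = set0 by apply: contrapT => h; move/asboolP: nmeetP.
  have nPt : ~ P t by move=> Pt; have : set0 t by rewrite -PS.
  apply: (primeNM mP.1 (hg P mP PS) nPt); apply: (idealDl iP _ hc).
  by rewrite exprS; apply: (ideal_mulr _ iP); apply: disjoint_d.
- exact: mult_closedX.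
have td : t ^+ k.+1 * d ^+ k.+1 = 0 by rewrite -exprMn [_ ^+ k.+1]exprS td0 mulr0.
by exists (t ^+ k.+1 * t); rewrite mulrDr td addr0 mulrCA mulrC.
Qed.

Lemma tight_closure_ext : ideal_ext phi (tight_closure p J) = tight_closure p (ideal_ext phi J).
Proof.
apply/seteqP; split; first exact: tight_closure_ext_sub.
move=> y [gam [hgam [N h]]].
have [s0 [r [Ss0 re]]] := localization_fraction locL y.
have [s1 [g [Ss1 ge]]] := localization_fraction locL gam.
have [|c [t [hc St [u tc]]]] := @avoids_minimal_primes_correction g.
  move=> P mP PS Pg; apply: hgam; exists (fractions_of S phi P).
    exact: (minimal_prime_fractions mS locL).
  by exists s1, g.
(* Clearing denominators costs a factor [sig] that varies with [n] and so cannot be absorbed in the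
   multiplier [c]. *)
have hcr n : (N <= n)%N -> exists2 sig, S sig & frobenius_power p n J (sig * (c * r ^+ (p ^ n)%N)).
  move=> /h hn; have ifp := frobenius_power_ideal p n J.
  have : fractions_of S phi (frobenius_power p n J) (phi (g * r ^+ (p ^ n)%N)).
    rewrite rmorphM rmorphXn -ge -re exprMn mulrACA.
    apply: (ideal_mull _ (fractions_of_ideal mS locL ifp)).
    by apply: (frobenius_power_fractions mS locL iJ); rewrite -(ideal_ext_fractions mS locL iJ).
  move=> [s [x [Ss fx]]]; rewrite -rmorphM => /(localization_eq locL) [s' Ss' e].
  exists (s' * s * t); first by case: mS => _ SM; do 2 apply: (SM) => //.
  have -> : s' * s * t * (c * r ^+ (p ^ n)%N) = u * (s' * (s * (g * r ^+ (p ^ n)%N))).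
    have -> : s' * s * t * (c * r ^+ (p ^ n)%N) = t * c * (s' * s * r ^+ (p ^ n)%N) by ring.
    by rewrite tc; ring.
  by rewrite e; do 2 apply: (ideal_mull _ ifp).
have /choice [v hv] : forall i, exists v, S v /\ (Q i `&` S <> set0 -> forall n, comp n i (v ^+ (p ^ n)%N)).
  move=> i; have [QS|QS] := pselect (Q i `&` S = set0); first by exists 1; split=> //; case: mS.
  have /set0P [s [Qs Ss]] : Q i `&` S != set0 by apply/eqP.
  have [e he] := comp_pow Qs; exists (s ^+ e); split; first exact: mult_closedX.
  by move=> _ n; rewrite -exprM.
pose V := \prod_i v i.
have SV : S V by apply: mult_closed_prod => // i; case: (hv i).
have TV : tight_closure p J (V * r).
  apply: (tight_closure_multiplier charR test0 iJ hc (N := N)) => n /hcr [sig Ssig hsig].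
  (* Where the prime misses [S], the factor [sig] is cancelled by saturation; where it meets [S],
     the fixed [V] gives membership. *)
  rewrite tightE => i _; have [QS|QS] := pselect (Q i `&` S = set0).
    have nQ : ~ Q i sig by move=> Qsig; have : set0 sig by rewrite -QS.
    rewrite exprMn mulrCA; apply: (ideal_mull _ (compi n i)); apply: (comp_sat nQ).
    have : tight_closure p (frobenius_power p n J) `<=` comp n i by rewrite tightE => x; apply.
    by apply; apply: sub_tight_closure.
  rewrite exprMn mulrCA; apply: (ideal_mulr _ (compi n i)).
  rewrite /V (bigD1 i) //= exprMn; apply: (ideal_mulr _ (compi n i)).
  by case: (hv i) => _; apply.
rewrite (ideal_ext_fractions mS locL) //; exists (V * s0), (V * r); split=> //.
  by case: mS => _; apply.
by rewrite !rmorphM -mulrA re.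
Qed.
End TightLocalization.

Theorem theorem8p9 (p : nat) (R A : comNzRingType) (iota : {rmorphism A -> R})
    (b : set A) (Rinf : comNzRingType) (psi0 : {rmorphism R -> Rinf})
    (charR : p \in [pchar R])
    (noethR : noetherian R)
    (equidimR : equidimensional R)
    (subringA : injective iota)
    (integralR : integralRange iota)
    (regularA : regular_ring A)
    (excellentA : excellent A)
    (proper_b : proper_ideal b)
    (perfR : is_perfect_closure p psi0) :
  let a := ideal_ext iota b in
  let aplus := fun n : nat => plus_closure (frobenius_power p n a) in
  let astar := fun n : nat => tight_closure p (frobenius_power p n a) in
  [/\ has_primary_decomposition (corresponding_ideal p psi0 aplus),
      linear_growth p aplus,
      finite_set (\bigcup_n ass (aplus n)) &
      (exists (m0 : nat) (c : R), weak_test_element p m0 c) ->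
      [/\ forall S : set R, mult_closed S ->
            forall (L : comPzRingType) (phi : {rmorphism R -> L}),
              is_localization S phi ->
              ideal_ext phi (tight_closure p a) =
              tight_closure p (ideal_ext phi a),
          has_primary_decomposition (corresponding_ideal p psi0 astar),
          linear_growth p astar,
          \bigcup_n ass (astar n) `<=` \bigcup_n ass (aplus n) &
          finite_set (\bigcup_n ass (astar n))]].
Proof.
have charA : p \in [pchar A].
  rewrite inE (pcharf_prime charR) /=; apply/eqP; apply: subringA.
  by rewrite rmorph_nat rmorph0 (pcharf0 charR).
have noethA := regularA.1.
have [k [q b_dec]] := minimal_primary_decomposition_exists noethA proper_b.1.
have [m [l [Q [prQ comapQ injQ coverQ]]]] : exists (m : nat) (l : 'I_m -> 'I_k) (Q : 'I_m -> set R),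
    [/\ forall i, prime_ideal (Q i), forall i, iota @^-1` Q i = radical (q (l i)), injective Q &
        forall j X, prime_ideal X -> iota @^-1` X = radical (q j) -> exists i, l i = j /\ Q i = X].
  have [pq _ injq _] := b_dec.
  by apply: primes_over_index => // j; apply: primary_radical_prime.
move=> a aplus astar.
(* The primes [Q] are chosen from [b] before [c] is given, so plus closure and tight closure receive
   the same associated primes. *)
have main (c : set A -> set R) : ideal_closure p iota c ->
  [/\ has_primary_decomposition (corresponding_ideal p psi0 (fun n => c (frobenius_power p n b))),
    linear_growth p (fun n => c (frobenius_power p n b)) &
    forall n, ass (c (frobenius_power p n b)) = range Q].
  move=> cc; split.
  - apply: (corresponding_primary_decomposition (comp := component p c q l Q) charR noethR perfR).
    + exact: (closure_f_sequence charA cc b).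
    + exact: (components_f_sequence charA cc q l prQ).
    + exact: (component_primary charA charR integralR cc b_dec prQ comapQ).
    + exact: (closure_components charA regularA integralR cc b_dec prQ coverQ).
  - exact: (closure_linear_growth charA charR regularA noethR subringA integralR cc b_dec
      prQ comapQ injQ coverQ proper_b.2).
  - exact: (ass_closure charA charR regularA integralR cc b_dec prQ comapQ injQ coverQ).
have finQ : finite_set (range Q) by apply/finite_image/finite_finset.
have plusE : aplus = fun n => plus_closure (ideal_ext iota (frobenius_power p n b)).
  by apply/funext => n; rewrite /aplus /a frobenius_power_ext.
have starE : astar = fun n => tight_closure p (ideal_ext iota (frobenius_power p n b)).
  by apply/funext => n; rewrite /astar /a frobenius_power_ext.
have [plus_dec plus_growth plus_ass] :=
  main _ (plus_ideal_closure charA charR regularA noethR equidimR subringA integralR).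
have all_ass (x : nat -> set R) : (forall n, ass (x n) = range Q) -> \bigcup_n ass (x n) = range Q.
  move=> xE; apply/seteqP; split=> [P [n _]|P QP]; first by rewrite xE.
  by exists 0%N; rewrite ?xE.
rewrite plusE; split=> //; first by rewrite all_ass.
move=> [m0 [c0 test0]].
have cc := tight_ideal_closure charA charR regularA noethR equidimR subringA integralR test0.
have [star_dec star_growth star_ass] := main _ cc.
rewrite starE; split=> //; [|by rewrite !all_ass..].
move=> S mS L phi locL.
apply: (tight_closure_ext (comp := component p _ q l Q) charR noethR test0 (ideal_ext_ideal _ _) _ _ _ _ mS locL).
- exact: (component_ideal cc).
- by move=> n i; apply: sat_saturated.
- exact: (component_power charR integralR cc prQ comapQ).
- move=> n; rewrite frobenius_power_ext //.
  exact: (closure_components charA regularA integralR cc b_dec prQ coverQ n).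
Qed.
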